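(* For each random discrete distribution $P$, the collection of distributions of its $P$-means $M_P(X)$, as $X$ ranges over simple random variables, is an encoding of the partition structure of $P$. That is to say, for any two random discrete distributions $P$ and $Q$, the following conditions are equivalent: (a) $P^{\downarrow}\stackrel{d}{=}Q^{\downarrow}$; (b) $P^{*}\stackrel{d}{=}Q^{*}$; (c) $p_P(n_1,\ldots,n_k)=p_Q(n_1,\ldots,n_k)$ for all finite sequences $(n_1,\ldots,n_k)$ of positive integers, $k\ge 1$; (d) the processes $(F_P[0,v])_{0\le v\le 1}$ and $(F_Q[0,v])_{0\le v\le 1}$ have the same finite-dimensional distributions; (e) $M_P(X)\stackrel{d}{=}M_Q(X)$ for every simple real random variable $X$.
   Context: A random discrete distribution is a sequence $P=(P_1,P_2,\ldots)$ of random variables with $P_j\ge 0$ and $\sum_j P_j=1$ almost surely. $P^{\downarrow}$ is the ranked (non-increasing) rearrangement of $P$. $P^{*}$ is the size-biased permutation of $P$: if, conditionally given $P$, $J_1,J_2,\ldots$ are i.i.d. with $\mathbb{P}(J_i=j\mid P)=P_j$, and $J_k^*$ is the $k$th distinct value to appear in $J_1,J_2,\ldots$, then $P^*_k=P_{J^*_k}$ (with $P^*_k=0$ if there is no $k$th distinct value). The exchangeable partition probability function (EPPF) of $P$ is $$p_P(n_1,\ldots,n_k)=\sum_{(j_1,\ldots,j_k)}\mathbb{E}\prod_{i=1}^k P_{j_i}^{n_i},$$ the sum over all sequences of $k$ distinct positive integers; it encodes the partition structure of $P$ (the laws, for all $n$, of the random partition $\Pi_n$ of $\{1,\ldots,n\}$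 in which $i\sim i'$ iff $J_i=J_{i'}$). $F_P[0,v]=\sum_j P_j 1(U_j\le v)$ with $U_1,U_2,\ldots$ i.i.d. uniform on $[0,1]$, independent of $P$. A random variable is simple if it takes only finitely many values. The $P$-mean of $X$ is $M_P(X)=\sum_j X_jP_j$ with $X_1,X_2,\ldots$ i.i.d. copies of $X$, independent of $P$. $\stackrel{d}{=}$ denotes equality in distribution. *)

(* Defs.v *)
(* Sequences are indexed by [nat], so index [j] stands for
   the positive integer [j + 1]. *)
From HB Require Import structures.
From mathcomp Require Import all_boot all_order all_algebra.
From mathcomp Require Import all_classical all_reals all_analysis.

Set Implicit Arguments.
Unset Strict Implicit.
Unset Printing Implicit Defensive.

Import Order.TTheory GRing.Theory Num.Theory.
Import numFieldNormedType.Exports.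

Local Open Scope classical_set_scope.
Local Open Scope ring_scope.

Definition cylinders (R : realType) : set (set (nat -> R)) :=
  [set C | exists j (B : set R), measurable B /\ C = [set x | B (x j)]].

(* R^nat with its product sigma-algebra *)
Definition seqspace (R : realType) := g_sigma_algebraType (@cylinders R).

Definition path_of (R : realType) (T : Type) (X : nat -> T -> R) (w : T) :
  seqspace R := fun j => X j w.

Definition same_law (R : realType) (d1 d2 d : measure_display)
    (T1 : measurableType d1) (T2 : measurableType d2) (E : measurableType d)
    (Pr1 : probability T1 R) (Pr2 : probability T2 R)
    (X : T1 -> E) (Y : T2 -> E) : Prop :=
  forall A : set E, measurable A ->
    pushforward Pr1 X A = pushforward Pr2 Y A.

Definition same_law_seq (R : realType) (d1 d2 : measure_display)
    (T1 : measurableType d1) (T2 : measurableType d2)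
    (Pr1 : probability T1 R) (Pr2 : probability T2 R)
    (X : nat -> {RV Pr1 >-> R}) (Y : nat -> {RV Pr2 >-> R}) : Prop :=
  same_law Pr1 Pr2 (path_of X) (path_of Y).

Definition random_discrete_distribution (R : realType) (d : measure_display)
    (T : measurableType d) (Pr : probability T R)
    (P : nat -> {RV Pr >-> R}) : Prop :=
  {ae Pr, forall w, (forall j, 0 <= P j w) /\
                    series (fun j => P j w) @ \oo --> (1 : R)}.

(* [q] lists the positive terms of [p], each with its multiplicity, in
   non-increasing order, followed by zeros if there are finitely many. *)
Definition is_ranking (R : realType) (p q : nat -> R) : Prop :=
  [/\ forall k, 0 <= q k,
      forall k, q k.+1 <= q k &
      forall x, 0 < x -> ([set j | q j = x] #= [set j | p j = x])%card].

Definition is_ranked (R : realType) (d : measure_display)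
    (T : measurableType d) (Pr : probability T R)
    (P D : nat -> {RV Pr >-> R}) : Prop :=
  {ae Pr, forall w, is_ranking (P ^~ w) (D ^~ w)}.

(* The auxiliary variables (J_k), (U_j), (X_j) live jointly with [P] on a space
   that may have to be richer than the one on which [P] is given.  Hence the
   predicates [is_size_biased], [is_random_cdf] and [is_mean] below allow a
   copy [P'] of [P], equal to it in law, on an arbitrary probability space
   [Pr'].  The law of the object they describe depends only on the law of
   [P] (and of [X]). *)

(* Conditionally given [P], the [J_k] are i.i.d. with law (P_j)_j. *)
Definition sample_from (R : realType) (d : measure_display)
    (T : measurableType d) (Pr : probability T R)
    (P : nat -> {RV Pr >-> R}) (J : nat -> {RV Pr >-> nat}) : Prop :=
  forall (n : nat) (j : n.-tuple nat) (A : set (seqspace R)), measurable A ->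
    Pr (path_of P @^-1` A `&` [set w | forall i : 'I_n, J i w = tnth j i]) =
    (\int[Pr]_(w in path_of P @^-1` A) (\prod_(i < n) P (tnth j i) w)%R%:E)%E.

(* [j i] differs from all earlier values, which comprise exactly [k] distinct
   ones: [j i] is the distinct value number [k], counting from 0. *)
Definition new_value_at (j : nat -> nat) (k i : nat) : bool :=
  (j i \notin [seq j l | l <- iota 0 i]) &&
  (size (undup [seq j l | l <- iota 0 i]) == k).

Definition size_biased_term (R : realType) (p : nat -> R) (j : nat -> nat)
    (k : nat) : R :=
  if pselect (exists i, new_value_at j k i) is left h
  then p (j (ex_minn h)) else 0.

Definition is_size_biased (R : realType) (d d' : measure_display)
    (T : measurableType d) (T' : measurableType d')
    (Pr : probability T R) (Pr' : probability T' R)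
    (P : nat -> {RV Pr >-> R}) (S : nat -> {RV Pr' >-> R}) : Prop :=
  exists (P' : nat -> {RV Pr' >-> R}) (J : nat -> {RV Pr' >-> nat}),
    [/\ same_law_seq P' P, sample_from P' J &
        {ae Pr', forall w k, S k w = size_biased_term (P' ^~ w) (J ^~ w) k}].

Definition eppf (R : realType) (d : measure_display)
    (T : measurableType d) (Pr : probability T R)
    (P : nat -> {RV Pr >-> R}) (ns : seq nat) : \bar R :=
  (\esum_(j in [set j : (size ns).-tuple nat | uniq j])
    'E_Pr[fun w => (\prod_(i < size ns) P (tnth j i) w ^+ nth 0%N ns i)%R])%E.

Definition mutually_independent (R : realType) (d : measure_display)
    (T : measurableType d) (Pr : probability T R)
    (X : nat -> {RV Pr >-> R}) : Prop :=
  forall (n : nat) (B : 'I_n -> set R), (forall i, measurable (B i)) ->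
    Pr [set w | forall i : 'I_n, B i (X i w)] =
    (\prod_(i < n) Pr (X i @^-1` B i))%E.

Definition independent_seqs (R : realType) (d : measure_display)
    (T : measurableType d) (Pr : probability T R)
    (X Y : nat -> {RV Pr >-> R}) : Prop :=
  forall A B : set (seqspace R), measurable A -> measurable B ->
    Pr (path_of X @^-1` A `&` path_of Y @^-1` B) =
    (Pr (path_of X @^-1` A) * Pr (path_of Y @^-1` B))%E.

(* [F] is the process v |-> sum_j P_j 1(U_j <= v), for v in [0, 1]. *)
Definition is_random_cdf (R : realType) (d d' : measure_display)
    (T : measurableType d) (T' : measurableType d')
    (Pr : probability T R) (Pr' : probability T' R)
    (P : nat -> {RV Pr >-> R}) (F : R -> {RV Pr' >-> R}) : Prop :=
  exists P' U : nat -> {RV Pr' >-> R},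
    [/\ same_law_seq P' P,
        forall j (B : set R), measurable B ->
          distribution Pr' (U j) B = uniform_prob (@ltr01 R) B,
        mutually_independent U, independent_seqs P' U &
        forall v, 0 <= v <= 1 ->
          {ae Pr', forall w,
            series (fun j => P' j w * (U j w <= v)%R%:R) @ \oo --> F v w}].

Definition same_fdd01 (R : realType) (d1 d2 : measure_display)
    (T1 : measurableType d1) (T2 : measurableType d2)
    (Pr1 : probability T1 R) (Pr2 : probability T2 R)
    (F : R -> {RV Pr1 >-> R}) (G : R -> {RV Pr2 >-> R}) : Prop :=
  forall (n : nat) (v : n.-tuple R), (forall i, 0 <= tnth v i <= 1) ->
    same_law Pr1 Pr2 (fun w => [tuple F (tnth v i) w | i < n])
                     (fun w => [tuple G (tnth v i) w | i < n]).

(* [M] is the P-mean sum_j X_j P_j, the [X_j] being i.i.d. copies of [X]. *)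
Definition is_mean (R : realType) (d d' dX : measure_display)
    (T : measurableType d) (T' : measurableType d') (TX : measurableType dX)
    (Pr : probability T R) (Pr' : probability T' R) (PrX : probability TX R)
    (P : nat -> {RV Pr >-> R}) (X : {RV PrX >-> R}) (M : {RV Pr' >-> R}) :
    Prop :=
  exists P' X' : nat -> {RV Pr' >-> R},
    [/\ same_law_seq P' P,
        forall j, same_law Pr' PrX (X' j) X,
        mutually_independent X', independent_seqs P' X' &
        {ae Pr', forall w, series (fun j => X' j w * P' j w) @ \oo --> M w}].

(* Main.v *)
(** Every condition is compared with the joint moments of the power sums
    s_n = sum_j P_j^n.  Sorting the index sequences of a product of such sums by
    their coincidences shows that these moments and the EPPF determine each
    other.  They also determine the joint moments of statistics of a sample
    (J_i) and of the random measure sum_j P_j delta_(U_j): expanded over the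
    atoms, such a moment is a sum in which the auxiliary variables contribute a
    weight depending only on the equality pattern of the indices.  The pairs of
    statistics of P and Q with the same moments are closed under polynomials
    and L1-limits, hence reach indicators, and equality of laws follows.

    Conversely, s_n is the L1-limit of sum_l F(l/N, (l+1)/N]^n, so it is
    determined by the finite-dimensional distributions of F; the joint moments
    of values of F are in turn the coefficients of the moments of the P-means of
    step functions.  Finally, almost surely every atom of positive mass is
    sampled, so that the ranked sequence is a function of the size-biased
    permutation. *)

Require Import Defs.
From HB Require Import structures.
From mathcomp Require Import all_boot all_order all_algebra finmap.
From mathcomp Require Import all_classical all_reals all_analysis measurable_realfun.
From mathcomp Require Import ring lra zify.

Set Implicit Arguments.
Unset Strict Implicit.
Unset Printing Implicit Defensive.

Import Order.TTheory GRing.Theory Num.Theory.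
Import numFieldNormedType.Exports.

Local Open Scope classical_set_scope.
Local Open Scope ring_scope.

(** * Expectations of bounded measurable functions *)

(** Statistics of P and of Q live on different probability spaces, so equality of laws is carried by
    an inductive relation between pairs of functions. Indicators are reached through explicit
    polynomials that tend to the indicator of x < a on [0, 1], with no appeal to a moment problem.
    Expansions over atoms are made on the indices below N, where they are finite identities; only
    differences of truncated sums are sent to the limit. Conditions (b), (d) and (e) quantify over
    all realizations of the auxiliary variables, so nothing can be drawn from them without
    exhibiting one. It is built on the product of the given space with [0, 1]: the binary digits of
    a single uniform variable supply a whole i.i.d. sequence, from which samples, random cdfs and
    means are made. The L1-rate for the power sums comes from collisions: two distinct atoms fall in
    the same one of N equal cells with probability 1/N, so the expected excess of the squared cell
    masses over s_2 is at most 1/N, and this excess controls that of every higher power. *)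

Lemma measurable_preimageT d1 d2 (T1 : measurableType d1) (T2 : measurableType d2)
    (f : T1 -> T2) A :
  measurable_fun setT f -> measurable A -> measurable (f @^-1` A).
Proof. by move=> mf mA; rewrite -[X in measurable X]setTI; exact: mf. Qed.

Lemma measurable_forall d (T : measurableType d) (I : countType) (A : I -> set T) :
  (forall i, measurable (A i)) -> measurable [set x | forall i, A i x].
Proof.
move=> mA; rewrite (_ : [set x | _] =
    \bigcap_n (if @choice.unpickle I n is Some i then A i else setT)).
  by apply: bigcapT_measurable => n; case: (@choice.unpickle I n).
apply/seteqP; split => x Ax i; first by case: (@choice.unpickle I i).
by have := Ax (choice.pickle i) Logic.I; rewrite choice.pickleK.
Qed.

Lemma cvgn_le (R : realType) (u : nat -> R) (l c : R) :
  u @ \oo --> l -> (\forall n \near \oo, u n <= c) -> l <= c.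
Proof.
move=> ul uc; rewrite -(cvg_lim _ ul)//; apply: limr_le => //.
by apply/cvg_ex; exists l.
Qed.

Section Expectation.
Context d (T : measurableType d) (R : realType) (Pr : probability T R).
Implicit Types f g : T -> R.

(** The bound holds everywhere, not almost surely, so that the class is closed under sums and
    products with no exceptional sets to carry along. *)
Definition bmf f := measurable_fun setT f /\ exists M, forall x, `|f x| <= M.

Definition Ex f : R := \int[Pr]_x f x.

Lemma bmf_cst c : bmf (fun=> c).
Proof. by split; [exact: measurable_cst|exists `|c|]. Qed.

Lemma bmfD f g : bmf f -> bmf g -> bmf (fun x => f x + g x).
Proof.
move=> [mf [M fM]] [mg [N gN]]; split; first exact: measurable_funD.
by exists (M + N) => x; rewrite (le_trans (ler_normD _ _))// lerD.
Qed.

Lemma bmfN f : bmf f -> bmf (fun x => - f x).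
Proof.
by move=> [mf [M fM]]; split; [exact: measurableT_comp|exists M => x; rewrite normrN].
Qed.

Lemma bmfB f g : bmf f -> bmf g -> bmf (fun x => f x - g x).
Proof. by move=> bf bg; apply: bmfD => //; exact: bmfN. Qed.

Lemma bmfM f g : bmf f -> bmf g -> bmf (fun x => f x * g x).
Proof.
move=> [mf [M fM]] [mg [N gN]]; split; first exact: measurable_funM.
by exists (M * N) => x; rewrite normrM ler_pM.
Qed.

Lemma bmfZ c f : bmf f -> bmf (fun x => c * f x).
Proof. by move=> bf; apply: bmfM => //; exact: bmf_cst. Qed.

Lemma bmfX n f : bmf f -> bmf (fun x => f x ^+ n).
Proof.
move=> bf; elim: n => [|n IH]; first exact: bmf_cst.
by under eq_fun do rewrite exprS; exact: bmfM.
Qed.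

Lemma bmf_abs f : bmf f -> bmf (fun x => `|f x|).
Proof.
move=> [mf [M fM]]; split; first exact: measurableT_comp.
by exists M => x; rewrite normr_id.
Qed.

Lemma bmf_sum (I : Type) (s : seq I) (P : pred I) (F : I -> T -> R) :
  (forall i, bmf (F i)) -> bmf (fun x => \sum_(i <- s | P i) F i x).
Proof.
move=> bF; elim: s => [|i s IH].
  by under eq_fun do rewrite big_nil; exact: bmf_cst.
under eq_fun do rewrite big_cons.
by case: (P i) => //; exact: bmfD.
Qed.

Lemma bmf_prod (I : Type) (s : seq I) (P : pred I) (F : I -> T -> R) :
  (forall i, bmf (F i)) -> bmf (fun x => \prod_(i <- s | P i) F i x).
Proof.
move=> bF; elim: s => [|i s IH].
  by under eq_fun do rewrite big_nil; exact: bmf_cst.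
under eq_fun do rewrite big_cons.
by case: (P i) => //; exact: bmfM.
Qed.

Lemma bmf_indic (A : set T) : measurable A -> bmf \1_A.
Proof.
move=> mA; split; first exact: measurable_indic.
by exists 1 => x; rewrite indicE ger0_norm ?ler0n// lern1 leq_b1.
Qed.

Lemma bmf_int f : bmf f -> Pr.-integrable setT (EFin \o f).
Proof.
move=> [mf [M fM]].
apply: (@le_integrable _ _ _ _ _ _ _ (EFin \o cst M)) => //.
- exact/measurable_EFinP.
- by move=> x _ /=; rewrite lee_fin (le_trans (fM x))// ler_norm.
- exact: finite_measure_integrable_cst.
Qed.

Lemma ExE f : bmf f -> (\int[Pr]_x (f x)%:E)%E = (Ex f)%:E.
Proof.
move=> bf; rewrite /Ex /Rintegral fineK//.
exact: (integrable_fin_num measurableT (bmf_int bf)).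
Qed.

Lemma Ex_cst c : Ex (fun=> c) = c.
Proof.
have := @probability_setT _ _ _ Pr => /= p1.
by rewrite /Ex Rintegral_cst//= [X in fine X]p1 mulr1.
Qed.

Lemma eq_Ex f g : f =1 g -> Ex f = Ex g.
Proof. by move=> /funext ->. Qed.

Lemma eq_bmf f g : f =1 g -> bmf f -> bmf g.
Proof. by move=> /funext ->. Qed.

Lemma ExD f g : bmf f -> bmf g -> Ex (fun x => f x + g x) = Ex f + Ex g.
Proof. by move=> bf bg; rewrite /Ex RintegralD//; exact: bmf_int. Qed.

Lemma ExB f g : bmf f -> bmf g -> Ex (fun x => f x - g x) = Ex f - Ex g.
Proof. by move=> bf bg; rewrite /Ex RintegralB//; exact: bmf_int. Qed.

Lemma ExZ c f : bmf f -> Ex (fun x => c * f x) = c * Ex f.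
Proof. by move=> bf; rewrite /Ex RintegralZl//; exact: bmf_int. Qed.

Lemma Ex_sum (I : Type) (s : seq I) (P : pred I) (F : I -> T -> R) :
  (forall i, bmf (F i)) ->
  Ex (fun x => \sum_(i <- s | P i) F i x) = \sum_(i <- s | P i) Ex (F i).
Proof.
move=> bF; elim: s => [|i s IH].
  by under eq_fun do rewrite big_nil; rewrite Ex_cst big_nil.
under eq_fun do rewrite big_cons.
rewrite big_cons; case: (P i) => //.
by rewrite ExD ?IH//; exact: bmf_sum.
Qed.

Lemma Ex_le f g : bmf f -> bmf g -> (forall x, f x <= g x) -> Ex f <= Ex g.
Proof. by move=> bf bg fg; apply: le_Rintegral => //; exact: bmf_int. Qed.

Lemma Ex_ge0 f : (forall x, 0 <= f x) -> 0 <= Ex f.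
Proof. by move=> f0; apply: Rintegral_ge0. Qed.

Lemma Ex_abs f : bmf f -> `|Ex f| <= Ex (fun x => `|f x|).
Proof. by move=> bf; apply: le_normr_Rintegral => //; exact: bmf_int. Qed.

Lemma Ex_ae f g : bmf f -> bmf g -> {ae Pr, forall x, f x = g x} -> Ex f = Ex g.
Proof.
move=> [mf _] [mg _] fg; rewrite /Ex /Rintegral; congr fine.
apply: ae_eq_integral => //; try exact/measurable_EFinP.
by apply: filterS fg => x /= ->.
Qed.

Lemma Ex_le_ae f g : bmf f -> bmf g -> {ae Pr, forall x, f x <= g x} ->
  Ex f <= Ex g.
Proof.
move=> bf bg fg.
(* [Num.max (f x) (g x)] equals [g x] almost surely and dominates [f x] everywhere. *)
have bm : bmf (fun x => Num.max (f x) (g x)).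
  have [[mf [M fM]] [mg [N gN]]] := (bf, bg).
  split; first exact: measurable_maxr.
  exists (M + N) => x; have := fM x; have := gN x.
  have := normr_ge0 (f x); have := normr_ge0 (g x).
  rewrite /Num.max; case: ifP => _; lra.
rewrite (@Ex_ae g (fun x => Num.max (f x) (g x)))//.
  by apply: Ex_le => // x; rewrite le_max lexx.
by apply: filterS fg => x; rewrite -/(f x <= g x) => /max_idPr ->.
Qed.

Lemma Ex_indic (A : set T) : measurable A -> (Ex \1_A)%:E = Pr A.
Proof.
move=> mA; rewrite -ExE; last exact: bmf_indic.
by rewrite integral_indic// setIT.
Qed.

(** Dominated convergence with a constant bound. The L1 form, unlike convergence of expectations,
    survives multiplication by a bounded factor. *)
Lemma Ex_cvg_L1 (f_ : nat -> T -> R) f (M : R) :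
  (forall n, bmf (f_ n)) -> bmf f ->
  {ae Pr, forall x, (fun n => f_ n x) @ \oo --> f x} ->
  {ae Pr, forall x n, `|f_ n x| <= M} ->
  (fun n => Ex (fun x => `|f_ n x - f x|)) @ \oo --> (0 : R).
Proof.
move=> bf_ bf cf fM.
have [] := @dominated_convergence _ _ _ Pr setT measurableT
  (fun n => EFin \o f_ n) (EFin \o f) (EFin \o cst M).
- by move=> n; apply/measurable_EFinP; case: (bf_ n).
- by apply/measurable_EFinP; case: bf.
- by apply: filterS cf => x cx _; apply/fine_cvgP; split => //; near=> n.
- exact: finite_measure_integrable_cst.
- by apply: filterS fM => x fMx n _; rewrite /= lee_fin.
move=> _ + _ => /fine_cvgP [_]; apply: cvg_trans.
by apply: near_eq_cvg; near=> n.
Unshelve. all: by end_near. Qed.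

Lemma L1_cvg_Ex (f_ : nat -> T -> R) f :
  (forall n, bmf (f_ n)) -> bmf f ->
  (fun n => Ex (fun x => `|f_ n x - f x|)) @ \oo --> (0 : R) ->
  (fun n => Ex (f_ n)) @ \oo --> Ex f.
Proof.
move=> bf_ bf cf.
apply/subr_cvg0/norm_cvg0P; apply: (squeeze_cvgr _ (cvg_cst 0) cf).
near=> n; rewrite normr_ge0 /=.
by rewrite -ExB// Ex_abs//; exact: bmfB.
Unshelve. all: by end_near. Qed.

Lemma Ex_cvg (f_ : nat -> T -> R) f (M : R) :
  (forall n, bmf (f_ n)) -> bmf f ->
  {ae Pr, forall x, (fun n => f_ n x) @ \oo --> f x} ->
  {ae Pr, forall x n, `|f_ n x| <= M} ->
  (fun n => Ex (f_ n)) @ \oo --> Ex f.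
Proof.
by move=> bf_ bf cf fM; apply: L1_cvg_Ex => //; exact: Ex_cvg_L1 fM.
Qed.

End Expectation.

(** * Statistics coupled through their moments *)

Section Threshold.
Context (R : realType).

Lemma bernoulli_ge (y : R) n : 0 <= y <= 1 -> 1 - y *+ n <= (1 - y) ^+ n.
Proof.
move=> /andP[y0 y1]; elim: n => [|n IH]; first by rewrite mulr0n subr0 expr0.
rewrite exprS mulrS.
have : 0 <= y *+ n by rewrite mulrn_wge0.
move: IH; set A := _ ^+ n; set B := _ *+ n => IH B0.
nra.
Qed.

(** The induction rests on (1 - y)(1 + (n + 1) y) <= 1 + n y. With [bernoulli_ge] it shows that (1 -
    x^n)^K is close to 1 when K x^n is small and to 0 when K x^n is large. *)
Lemma bernoulli_le (y : R) n : 0 <= y <= 1 -> (1 - y) ^+ n <= (1 + y *+ n)^-1.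
Proof.
move=> /andP[y0 y1].
have B0 : 0 <= y *+ n by rewrite mulrn_wge0.
rewrite -[leRHS]mul1r ler_pdivlMr ?ltr_pwDl//.
elim: n B0 => [|n IH] _; first by rewrite expr0 mulr0n addr0 mul1r.
have B0 : 0 <= y *+ n by rewrite mulrn_wge0.
have A0 : 0 <= (1 - y) ^+ n by rewrite exprn_ge0// subr_ge0.
move: (IH B0) A0; move: B0; rewrite exprS mulrS.
set A := _ ^+ n; set B := _ *+ n => B0 AB A0.
have : 0 <= y * y * A by rewrite !mulr_ge0.
have : 0 <= y * B * A by rewrite !mulr_ge0.
by nra.
Qed.

(** Write z = y^2: by [bernoulli_le], n y^n is at most 1 / (1 - y), and the remaining factor y^n
    tends to 0. *)
Lemma cvg_natM_expr (z : R) : 0 <= z < 1 ->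
  (fun n => n%:R * z ^+ n) @ \oo --> (0 : R).
Proof.
move=> /andP[z0 z1]; pose y := Num.sqrt z.
have y0 : 0 <= y by exact: sqrtr_ge0.
have yy : y ^+ 2 = z by rewrite sqr_sqrtr.
have y1 : y < 1 by rewrite -sqrtr1 ltr_sqrt.
have b n : n%:R * y ^+ n <= (1 - y)^-1.
  have := @bernoulli_le (1 - y) n; rewrite subKr => /(_ _)/wrap[]; first lra.
  set h := 1 - y => Hn.
  have h0 : 0 < h by rewrite /h; lra.
  rewrite -[leRHS]mul1r ler_pdivlMr// mulrAC [_ * h]mulr_natl.
  have B0 : 0 <= h *+ n by rewrite mulrn_wge0// ltW.
  rewrite -[leRHS](@mulfV _ (1 + h *+ n)); last by rewrite gt_eqF// ltr_pwDl.
  by apply: ler_pM => //; [exact: exprn_ge0|rewrite lerDr].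
have : (fun n => (1 - y)^-1 * y ^+ n) @ \oo --> (0 : R).
  by rewrite -[X in _ --> X](mulr0 (1 - y)^-1); apply: cvgMr; apply: cvg_expr; rewrite ger0_norm.
apply: (squeeze_cvgr _ (cvg_cst 0)); near=> n.
rewrite mulr_ge0 ?exprn_ge0//=.
by rewrite -yy -exprM mulnC muln2 -addnn exprD mulrA ler_wpM2r ?exprn_ge0.
Unshelve. all: by end_near. Qed.

(* K = n * floor (a ^- n): then K x^n is about n (x / a)^n, which tends to 0 or
   to infinity according to whether x < a or x >= a. *)
Definition step_approx (a : R) (n : nat) (x : R) : R :=
  (1 - x ^+ n) ^+ (n * Num.truncn (a ^- n)).

Lemma step_approx_cvg (a x : R) : 0 < a < 1 -> 0 <= x <= 1 ->
  step_approx a ^~ x @ \oo --> ((x < a)%R%:R : R).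
Proof.
move=> /andP[a0 a1] /andP[x0 x1].
have xn n : 0 <= x ^+ n <= 1 by rewrite exprn_ge0//= exprn_ile1.
have K n : (Num.truncn (a ^- n))%:R <= a ^- n < (Num.truncn (a ^- n))%:R + 1.
  by rewrite natr1 truncn_itv// invr_ge0 exprn_ge0// ltW.
have [xa|ax] := ltP x a; [rewrite -[true%:R]/(1 : R)|rewrite -[false%:R]/(0 : R)].
  have z : 0 <= x / a < 1.
    by rewrite (divr_ge0 x0 (ltW a0))/= ltr_pdivrMr// mul1r.
  (* Here K x^n <= n (x / a)^n, since K <= n a^-n. *)
  have : (fun n => 1 - n%:R * (x / a) ^+ n) @ \oo --> (1 : R).
    by rewrite -[X in _ --> X]subr0; apply: cvgB; [exact: cvg_cst|exact: cvg_natM_expr].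
  move=> cv; apply: (squeeze_cvgr _ cv); last exact: cvg_cst.
  near=> n.
  have /andP[xn0 xn1] := xn n.
  rewrite /step_approx; apply/andP; split; last first.
    by rewrite exprn_ile1 ?subr_ge0// lerBlDr lerDl.
  apply: le_trans (bernoulli_ge _ (xn n)).
  rewrite lerD2l lerN2 -[leLHS]mulr_natl natrM -mulrA ler_wpM2l//.
  by rewrite expr_div_n mulrC ler_wpM2l//; case/andP : (K n).
(* Here K x^n >= n (a^-n - 1) a^n = n (1 - a^n) >= n (1 - a): rounding a^-n down costs at most 1, so
   the case x = a is covered as well. *)
have : (fun n => (1 + n%:R * (1 - a))^-1) @ \oo --> (0 : R).
  apply/gtr0_cvgV0.
    by near=> n; rewrite ltr_pwDl// mulr_ge0// subr_ge0 ltW.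
  apply/cvgryPge => A; near=> n.
  rewrite (@le_trans _ _ (n%:R * (1 - a)))// ?lerDr// -ler_pdivrMr ?subr_gt0//.
  by near: n; exact: nbhs_infty_ger.
apply: (squeeze_cvgr _ (cvg_cst 0)); near=> n.
have /andP[xn0 xn1] := xn n.
rewrite /step_approx exprn_ge0 ?subr_ge0//=.
apply: le_trans (bernoulli_le _ (xn n)) _.
rewrite lef_pV2 ?posrE ?ltr_pwDl ?mulr_ge0 ?mulrn_wge0 ?subr_ge0 ?(ltW a1)//.
rewrite lerD2l -[leRHS]mulr_natl natrM -mulrA ler_wpM2l//.
have an : a ^+ n <= x ^+ n by rewrite lerXn2r// nnegrE ltW.
have an0 : 0 < a ^+ n by rewrite exprn_gt0.
have n0 : (0 < n)%N by near: n; exact: nbhs_infty_gt.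
have an1 : a ^+ n <= a by rewrite -[leRHS]expr1 ler_wiXn2l// ltW.
apply: (@le_trans _ _ ((a ^- n - 1) * a ^+ n)).
  by rewrite mulrBl mulVf ?gt_eqF// mul1r lerD2l lerN2.
apply: ler_pM => //; last by case/andP : (K n); lra.
  by rewrite subr_ge0 invf_ge1 ?(le_trans an1)// ltW.
by rewrite ltW.
Unshelve. all: by end_near. Qed.

Lemma step_approx_bd (a x : R) n : 0 <= x <= 1 -> `|step_approx a n x| <= 1.
Proof.
move=> /andP[x0 x1].
have /andP[xn0 xn1] : 0 <= x ^+ n <= 1 by rewrite exprn_ge0//= exprn_ile1.
rewrite /step_approx ger0_norm ?exprn_ge0 ?subr_ge0// exprn_ile1 ?subr_ge0//.
by rewrite lerBlDr lerDl.
Qed.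

End Threshold.

(** * Closure properties of the coupling and equality of laws *)

Section Coupling.
Context (R : realType) (d1 d2 : measure_display)
  (T1 : measurableType d1) (T2 : measurableType d2)
  (Pr1 : probability T1 R) (Pr2 : probability T2 R)
  (I : Type) (f0 : I -> T1 -> R) (g0 : I -> T2 -> R).

(* If the base statistics [f0] and [g0] have the same joint moments, then all
   coupled pairs have the same expectation ([coupled_Ex]). *)
Inductive coupled : (T1 -> R) -> (T2 -> R) -> Prop :=
| coupled_base i : coupled (f0 i) (g0 i)
| coupled_cst c : coupled (fun=> c) (fun=> c)
| coupledD f g f' g' : coupled f g -> coupled f' g' ->
    coupled (fun x => f x + f' x) (fun x => g x + g' x)
| coupledM f g f' g' : coupled f g -> coupled f' g' ->
    coupled (fun x => f x * f' x) (fun x => g x * g' x)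
| coupled_L1 (f_ : nat -> T1 -> R) (g_ : nat -> T2 -> R) f g :
    bmf f -> bmf g -> (forall n, coupled (f_ n) (g_ n)) ->
    (fun n => Ex Pr1 (fun x => `|f_ n x - f x|)) @ \oo --> (0 : R) ->
    (fun n => Ex Pr2 (fun x => `|g_ n x - g x|)) @ \oo --> (0 : R) ->
    coupled f g.

Hypothesis bf0 : forall i, bmf (f0 i).
Hypothesis bg0 : forall i, bmf (g0 i).

Lemma coupled_bmf f g : coupled f g -> bmf f /\ bmf g.
Proof.
elim=> //.
- by move=> c; split; exact: bmf_cst.
- by move=> {}f {}g f' g' _ [? ?] _ [? ?]; split; exact: bmfD.
- by move=> {}f {}g f' g' _ [? ?] _ [? ?]; split; exact: bmfM.
Qed.

Lemma L1_cvgM d (T : measurableType d) (Pr : probability T R)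
    (f_ : nat -> T -> R) f h : (forall n, bmf (f_ n)) -> bmf f -> bmf h ->
  (fun n => Ex Pr (fun x => `|f_ n x - f x|)) @ \oo --> (0 : R) ->
  (fun n => Ex Pr (fun x => f_ n x * h x)) @ \oo --> Ex Pr (fun x => f x * h x).
Proof.
move=> bf_ bf bh cf; apply: L1_cvg_Ex => [n||]; try exact: bmfM.
have [_ [M hM]] := bh.
have : (fun n => M * Ex Pr (fun x => `|f_ n x - f x|)) @ \oo --> (0 : R).
  by rewrite -[X in _ --> X](mulr0 M); exact: cvgMr.
apply: (squeeze_cvgr _ (cvg_cst 0)); near=> n.
have bd : bmf (fun x => `|f_ n x - f x|) by apply/bmf_abs/bmfB.
rewrite Ex_ge0//= -ExZ//; apply: Ex_le.
- by apply/bmf_abs/bmfB; exact: bmfM.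
- exact: bmfZ.
- by move=> x; rewrite -mulrBl normrM mulrC ler_wpM2r.
Unshelve. all: by end_near. Qed.

Hypothesis moments : forall s : seq I,
  Ex Pr1 (fun x => \prod_(i <- s) f0 i x) =
  Ex Pr2 (fun x => \prod_(i <- s) g0 i x).

(* The quantification over the test pair [(h, k)] makes the induction go
   through products; a limit is handled because [h] and [k] are bounded. *)
Lemma coupled_test f g : coupled f g -> forall h k, bmf h -> bmf k ->
  (forall s : seq I, Ex Pr1 (fun x => h x * \prod_(i <- s) f0 i x) =
                     Ex Pr2 (fun x => k x * \prod_(i <- s) g0 i x)) ->
  forall s : seq I, Ex Pr1 (fun x => f x * h x * \prod_(i <- s) f0 i x) =
                    Ex Pr2 (fun x => g x * k x * \prod_(i <- s) g0 i x).
Proof.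
have bp1 s : bmf (fun x => \prod_(i <- s) f0 i x) by exact: bmf_prod.
have bp2 s : bmf (fun x => \prod_(i <- s) g0 i x) by exact: bmf_prod.
elim=> {f g}.
- move=> i h k bh bk hk s; have := hk (i :: s).
  rewrite (eq_Ex _ (g := fun x => f0 i x * h x * \prod_(i <- s) f0 i x)) => [->|x].
    by apply: eq_Ex => x; rewrite big_cons mulrCA mulrA.
  by rewrite big_cons mulrCA mulrA.
- move=> c h k bh bk hk s.
  rewrite (eq_Ex _ (g := fun x => c * (h x * \prod_(i <- s) f0 i x))) => [|x].
    rewrite ExZ ?hk -?ExZ; try exact: bmfM.
    by apply: eq_Ex => x; rewrite mulrA.
  by rewrite mulrA.
- move=> f g f' g' /coupled_bmf[bf bg] IH /coupled_bmf[bf' bg'] IH' h k bh bk hk s.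
  have b1 := bmfM (bmfM bf bh) (bp1 s); have b1' := bmfM (bmfM bf' bh) (bp1 s).
  have b2 := bmfM (bmfM bg bk) (bp2 s); have b2' := bmfM (bmfM bg' bk) (bp2 s).
  rewrite (eq_Ex _ (g := fun x => f x * h x * \prod_(i <- s) f0 i x +
      f' x * h x * \prod_(i <- s) f0 i x)) => [|x]; last by rewrite !mulrDl.
  rewrite ExD// (IH h k)// (IH' h k)// -ExD//.
  by apply: eq_Ex => x; rewrite !mulrDl.
(* The induction hypothesis for [(f', g')] says that [(f' h, g' k)] is an admissible test pair, to
   which the one for [(f, g)] is applied. *)
- move=> f g f' g' cf IH /coupled_bmf[? ?] IH' h k bh bk hk s.
  have := IH (fun x => f' x * h x) (fun x => g' x * k x) (bmfM _ bh) (bmfM _ bk).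
  move=> /(_ _ _ (IH' _ _ bh bk hk) s) IHs.
  rewrite (eq_Ex _ (g := fun x => f x * (f' x * h x) * \prod_(i <- s) f0 i x)) => [|x].
    by rewrite IHs//; apply: eq_Ex => x; rewrite !mulrA.
  by rewrite !mulrA.
- move=> f_ g_ f g bf bg cfg IH cf cg h k bh bk hk s.
  have bf_ n : bmf (f_ n) by case: (coupled_bmf (cfg n)).
  have bg_ n : bmf (g_ n) by case: (coupled_bmf (cfg n)).
  have bhs : bmf (fun x => h x * \prod_(i <- s) f0 i x) by exact: bmfM.
  have bks : bmf (fun x => k x * \prod_(i <- s) g0 i x) by exact: bmfM.
  have c1 := L1_cvgM bf_ bf bhs cf; have c2 := L1_cvgM bg_ bg bks cg.
  rewrite (eq_Ex _ (g := fun x => f x * (h x * \prod_(i <- s) f0 i x))) => [|x].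
    rewrite (cvg_unique _ c1 (y := Ex Pr2 (fun x => g x * (k x * \prod_(i <- s) g0 i x))))//.
      by apply: eq_Ex => x; rewrite mulrA.
    apply: cvg_trans c2; apply: near_eq_cvg; apply: nearW => n.
    transitivity (Ex Pr2 (fun x => g_ n x * k x * \prod_(i <- s) g0 i x)).
      by apply: eq_Ex => x; rewrite mulrA.
    by rewrite -(IH _ h k)//; apply: eq_Ex => x; rewrite mulrA.
  by rewrite mulrA.
Qed.

Theorem coupled_Ex f g : coupled f g -> Ex Pr1 f = Ex Pr2 g.
Proof.
move=> cfg; have [bf bg] := coupled_bmf cfg.
have := @coupled_test _ _ cfg (fun=> 1) (fun=> 1) (bmf_cst _ _) (bmf_cst _ _) _ [::].
rewrite (eq_Ex _ (g := f)) => [|x]; last by rewrite big_nil !mulr1.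
rewrite (eq_Ex Pr2 (g := g)) => [|x]; last by rewrite big_nil !mulr1.
apply => s; rewrite -[RHS](eq_Ex _ (f := fun x => \prod_(i <- s) g0 i x)) => [|x].
  by rewrite -moments; apply: eq_Ex => x; rewrite mul1r.
by rewrite mul1r.
Qed.

Lemma eq_coupled f f' g g' : f =1 f' -> g =1 g' -> coupled f g -> coupled f' g'.
Proof. by move=> /funext -> /funext ->. Qed.

Lemma coupledN f g : coupled f g -> coupled (fun x => - f x) (fun x => - g x).
Proof.
by move=> /(coupledM (coupled_cst (-1))); apply: eq_coupled => x; rewrite mulN1r.
Qed.

Lemma coupledZ c f g : coupled f g -> coupled (fun x => c * f x) (fun x => c * g x).
Proof. by apply: coupledM; exact: coupled_cst. Qed.

Lemma coupledB f g f' g' : coupled f g -> coupled f' g' ->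
  coupled (fun x => f x - f' x) (fun x => g x - g' x).
Proof. by move=> fg /coupledN; exact: coupledD. Qed.

Lemma coupledX f g n : coupled f g -> coupled (fun x => f x ^+ n) (fun x => g x ^+ n).
Proof.
move=> fg; elim: n => [|n IH]; first exact: coupled_cst.
by have := coupledM fg IH; apply: eq_coupled => x; rewrite exprS.
Qed.

Lemma coupled_sum (J : Type) (s : seq J) (P : pred J) F G :
  (forall j, coupled (F j) (G j)) ->
  coupled (fun x => \sum_(j <- s | P j) F j x) (fun x => \sum_(j <- s | P j) G j x).
Proof.
move=> FG; elim: s => [|j s IH].
  by have := coupled_cst 0; apply: eq_coupled => x; rewrite big_nil.
have : coupled (fun x => if P j then F j x + \sum_(j <- s | P j) F j x
                         else \sum_(j <- s | P j) F j x)
               (fun x => if P j then G j x + \sum_(j <- s | P j) G j x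
                         else \sum_(j <- s | P j) G j x).
  by case: (P j) => //; exact: coupledD.
by apply: eq_coupled => x; rewrite big_cons.
Qed.

Lemma coupled_lim (f_ : nat -> T1 -> R) (g_ : nat -> T2 -> R) f g M :
  bmf f -> bmf g -> (forall n, coupled (f_ n) (g_ n)) ->
  {ae Pr1, forall x, f_ ^~ x @ \oo --> f x} ->
  {ae Pr2, forall x, g_ ^~ x @ \oo --> g x} ->
  {ae Pr1, forall x n, `|f_ n x| <= M} ->
  {ae Pr2, forall x n, `|g_ n x| <= M} -> coupled f g.
Proof.
move=> bf bg cfg cf cg fM gM; apply: (coupled_L1 bf bg cfg).
- by apply: Ex_cvg_L1 fM => // n; case: (coupled_bmf (cfg n)).
- by apply: Ex_cvg_L1 gM => // n; case: (coupled_bmf (cfg n)).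
Qed.

Lemma bmf_lt d (T : measurableType d) (f : T -> R) a :
  bmf f -> bmf (fun x => (f x < a)%R%:R : R).
Proof.
move=> [mf _].
have -> : (fun x => (f x < a)%R%:R : R) = \1_(f @^-1` `]-oo, a[%classic).
  apply/funext => x; rewrite indicE; congr (nat_of_bool _)%:R.
  by apply/idP/idP; rewrite inE /preimage /= in_itv.
by apply: bmf_indic; exact: (measurable_preimageT mf).
Qed.

Let coupled_lt01 f g a : coupled f g -> 0 < a < 1 ->
  (forall x, 0 <= f x <= 1) -> (forall x, 0 <= g x <= 1) ->
  coupled (fun x => (f x < a)%R%:R) (fun x => (g x < a)%R%:R).
Proof.
move=> cfg a01 f01 g01; have [bf bg] := coupled_bmf cfg.
apply: (@coupled_lim (fun n x => step_approx a n (f x))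
                     (fun n x => step_approx a n (g x)) _ _ 1).
- exact: bmf_lt.
- exact: bmf_lt.
- move=> n; rewrite /step_approx; apply: coupledX; apply: coupledB.
    exact: coupled_cst.
  exact: coupledX.
- by apply: aeW => x; exact: step_approx_cvg.
- by apply: aeW => x; exact: step_approx_cvg.
- by apply: aeW => x n; exact: step_approx_bd.
- by apply: aeW => x n; exact: step_approx_bd.
Qed.

(** A common increasing affine map takes [f], [g] and [a] into (0, 1), where [step_approx]
    applies. *)
Lemma coupled_lt f g a : coupled f g ->
  coupled (fun x => (f x < a)%R%:R) (fun x => (g x < a)%R%:R).
Proof.
move=> cfg; have [[_ [M fM]] [_ [N gN]]] := coupled_bmf cfg.
(* Strictly larger than the absolute values of [f], [g] and [a], so that the rescaled threshold is
   neither 0 nor 1. *)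
pose K := `|M| + `|N| + `|a| + 1.
have K0 : 0 < 2 * K.
  by rewrite /K; have := normr_ge0 M; have := normr_ge0 N; have := normr_ge0 a; lra.
have sc : forall x y, (x < y) = ((2 * K)^-1 * (x + K) < (2 * K)^-1 * (y + K)).
  by move=> x y; rewrite ltr_pM2l ?invr_gt0// ltrD2r.
have sc01 x : `|x| < K -> 0 < (2 * K)^-1 * (x + K) < 1.
  rewrite ltr_norml => /andP[x1 x2].
  rewrite mulr_gt0 ?invr_gt0//=; last by lra.
  by rewrite mulrC ltr_pdivrMr//; lra.
have fK x : `|f x| < K.
  rewrite /K; have := fM x; have := ler_norm M.
  by have := normr_ge0 N; have := normr_ge0 a; lra.
have gK x : `|g x| < K.
  rewrite /K; have := gN x; have := ler_norm N.
  by have := normr_ge0 M; have := normr_ge0 a; lra.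
have aK : `|a| < K.
  by rewrite /K; have := normr_ge0 N; have := normr_ge0 M; lra.
suff : coupled (fun x => ((2 * K)^-1 * (f x + K) < (2 * K)^-1 * (a + K))%R%:R)
               (fun x => ((2 * K)^-1 * (g x + K) < (2 * K)^-1 * (a + K))%R%:R).
  by apply: eq_coupled => x; rewrite -sc.
apply: coupled_lt01.
- by apply: coupledZ; apply: coupledD => //; exact: coupled_cst.
- exact: sc01.
- by move=> x; have /andP[? ?] := sc01 _ (fK x); rewrite !ltW.
- by move=> x; have /andP[? ?] := sc01 _ (gK x); rewrite !ltW.
Qed.

Lemma coupled_setC A B : coupled \1_A \1_B -> coupled \1_(~` A) \1_(~` B).
Proof.
move=> /(coupledB (coupled_cst 1)).
by apply: eq_coupled => x /=; rewrite !indicE in_setC; case: (x \in _); rewrite ?subrr ?subr0.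
Qed.

Lemma coupled_setI A B A' B' : coupled \1_A \1_B -> coupled \1_A' \1_B' ->
  coupled \1_(A `&` A') \1_(B `&` B').
Proof.
move=> AB /(coupledM AB); apply: eq_coupled => x; rewrite !indicE in_setI;
by do 2 case: (_ \in _); rewrite ?mulr1 ?mulr0.
Qed.

Lemma coupled_setU A B A' B' : coupled \1_A \1_B -> coupled \1_A' \1_B' ->
  coupled \1_(A `|` A') \1_(B `|` B').
Proof.
move=> /coupled_setC AB /coupled_setC/(coupled_setI AB)/coupled_setC.
by rewrite !setCI !setCK.
Qed.

Lemma cvg_indic_bigcup T (F : nat -> set T) x :
  (fun n => \1_(\big[setU/set0]_(i < n) F i) x) @ \oo -->
  (\1_(\bigcup_i F i) x : R).
Proof.
rewrite indicE; case: (boolP (x \in _)) => [|].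
  rewrite inE => -[k _ Fkx]; apply: cvg_near_cst; near=> n.
  have kn : (k < n)%N by near: n; exact: nbhs_infty_gt.
  by rewrite indicE mem_set// -bigcup_mkord; exists k.
rewrite notin_setE => nF; apply: cvg_near_cst; near=> n.
rewrite indicE memNset// -bigcup_mkord => -[k _ Fkx]; apply: nF; by exists k.
Unshelve. all: by end_near. Qed.

Lemma coupled_bigcup (A : nat -> set T1) (B : nat -> set T2) :
  (forall n, measurable (A n)) -> (forall n, measurable (B n)) ->
  (forall n, coupled \1_(A n) \1_(B n)) ->
  coupled \1_(\bigcup_n A n) \1_(\bigcup_n B n).
Proof.
move=> mA mB AB.
have b1 T (C : set T) x : `|\1_C x : R| <= 1.
  by rewrite indicE ger0_norm// lern1 leq_b1.
apply: (@coupled_lim (fun n => \1_(\big[setU/set0]_(i < n) A i))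
                     (fun n => \1_(\big[setU/set0]_(i < n) B i)) _ _ 1).
- by apply: bmf_indic; exact: bigcupT_measurable.
- by apply: bmf_indic; exact: bigcupT_measurable.
- elim=> [|n IH]; last by rewrite !big_ord_recr; exact: coupled_setU.
  by rewrite !big_ord0 !indic0; exact: coupled_cst.
- by apply: aeW => x; exact: cvg_indic_bigcup.
- by apply: aeW => x; exact: cvg_indic_bigcup.
- by apply: aeW.
- by apply: aeW.
Qed.

(** The sets whose two preimages have coupled indicators form a sigma-algebra, not merely a
    lambda-system, because coupling is closed under products. Any generating family [G] is therefore
    enough, with no stability under intersection. *)
Theorem coupled_law d (E : measurableType d) (X : T1 -> E) (Y : T2 -> E)
    (G : set (set E)) :
  @measurable _ E = <<s G>> ->
  measurable_fun setT X -> measurable_fun setT Y ->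
  (forall A, G A -> coupled \1_(X @^-1` A) \1_(Y @^-1` A)) ->
  forall A, measurable A ->
    coupled \1_(X @^-1` A) \1_(Y @^-1` A) /\ pushforward Pr1 X A = pushforward Pr2 Y A.
Proof.
move=> EG mX mY GXY A mA.
have mXA B : measurable B -> measurable (X @^-1` B).
  by move=> mB; exact: (measurable_preimageT mX).
have mYA B : measurable B -> measurable (Y @^-1` B).
  by move=> mB; exact: (measurable_preimageT mY).
suff cA : coupled \1_(X @^-1` A) \1_(Y @^-1` A).
  split => //; rewrite /pushforward -!Ex_indic; [|exact: mYA|exact: mXA].
  by rewrite (coupled_Ex cA).
suff [] : [set B | measurable B /\ coupled \1_(X @^-1` B) \1_(Y @^-1` B)] A by [].
move: mA; rewrite [in X in X -> _]EG; apply: smallest_sub.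
- split.
  + by split; [exact: measurable0|rewrite !preimage_set0 !indic0; exact: coupled_cst].
  + move=> B [mB cB]; rewrite setTD; split; first exact: measurableC.
    by rewrite -!preimage_setC; exact: coupled_setC.
  + move=> F mF; split; first by apply: bigcupT_measurable => n; case: (mF n).
    rewrite !preimage_bigcup; apply: coupled_bigcup => n; case: (mF n) => mFn cn //.
      exact: mXA.
    exact: mYA.
- move=> B GB /=; split; last exact: GXY.
  by rewrite EG; exact: sub_sigma_algebra.
Qed.

End Coupling.

(** * Sums over sequences of distinct indices *)

Section DistinctSums.
Context (R : comPzRingType).
Implicit Types (p : nat -> R) (a b c t s : seq nat) (N : nat).

Fixpoint alls N m : seq (seq nat) :=
  if m is m'.+1 then [seq j :: s | j <- iota 0 N, s <- alls N m'] else [:: [::]].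

Fixpoint uniqs N m : seq (seq nat) :=
  if m is m'.+1 then
    [seq rcons t j | t <- uniqs N m', j <- [seq j <- iota 0 N | j \notin t]]
  else [:: [::]].

Definition mon p a t : R := \prod_(z <- zip t a) p z.1 ^+ z.2.

(** The augmented monomial symmetric polynomial with exponents [a] in the first [N] variables. Its
    expectation is the EPPF restricted to indices below [N]. *)
Definition dsum N p a : R := \sum_(t <- uniqs N (size a)) mon p a t.

Definition psum N p n : R := \sum_(j <- iota 0 N) p j ^+ n.

(** The exponents after a further factor of exponent [n] turns out to carry the same index as the
    one at position [i]. *)
Definition inc b i n : seq nat := set_nth 0%N b i (nth 0%N b i + n).

Lemma mem_uniqs N m t : (t \in uniqs N m) =
  [&& size t == m, uniq t & all (fun j => j < N)%N t].
Proof.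
elim: m t => [|m IH] t; first by rewrite /= inE; case: t.
apply/allpairsPdep/idP => [[t' [j [t'N]]]|].
  rewrite mem_filter mem_iota add0n /= => /andP[jt' jN] ->.
  move: t'N; rewrite IH => /and3P[/eqP <- ut' at'].
  by rewrite size_rcons eqxx rcons_uniq jt' ut' all_rcons jN at'.
case/lastP: t => [//|t j]; rewrite size_rcons rcons_uniq all_rcons eqSS.
move=> /and3P[tm /andP[jt ut] /andP[jN tN]]; exists t, j; split => //.
  by rewrite IH tm ut.
by rewrite mem_filter jt mem_iota.
Qed.

Lemma uniq_uniqs N m : uniq (uniqs N m).
Proof.
elim: m => [//|m IH] /=; apply: allpairs_uniq_dep => //.
  by move=> t _; rewrite filter_uniq// iota_uniq.
by move=> [t j] [t' j'] _ _ /= /rcons_inj [-> ->].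
Qed.

Lemma mem_alls N m t : (t \in alls N m) = (size t == m) && all (fun j => j < N)%N t.
Proof.
elim: m t => [|m IH] t; first by rewrite /= inE; case: t.
apply/allpairsPdep/idP => [[j [t' [jN t'N]]] ->|].
  by move: jN t'N; rewrite mem_iota add0n IH /= eqSS => -> /andP[-> ->].
case: t => [//|j t]; rewrite /= eqSS => /and3P[tm jN tN].
by exists j, t; split => //; rewrite ?mem_iota// IH tm.
Qed.

Lemma uniq_alls N m : uniq (alls N m).
Proof.
elim: m => [//|m IH] /=; apply: allpairs_uniq_dep => //.
  by rewrite iota_uniq.
by move=> [j t] [j' t'] _ _ /= [-> ->].
Qed.

Lemma size_inc b i n : (i < size b)%N -> size (inc b i n) = size b.
Proof. by move=> ib; rewrite size_set_nth; apply/maxn_idPr. Qed.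

Lemma mon_rcons p a t n j : size t = size a ->
  mon p (rcons a n) (rcons t j) = mon p a t * p j ^+ n.
Proof. by move=> ta; rewrite /mon zip_rcons// big_rcons /= mulrC. Qed.

Lemma mon_cons p a t n j : mon p (n :: a) (j :: t) = p j ^+ n * mon p a t.
Proof. by rewrite /mon /= big_cons. Qed.

Lemma inc_cons0 x b n : inc (x :: b) 0 n = (x + n)%N :: b. Proof. by []. Qed.

Lemma inc_consS x b i n : inc (x :: b) i.+1 n = x :: inc b i n. Proof. by []. Qed.

Lemma mon_inc p b t i n : size t = size b -> (i < size b)%N ->
  mon p (inc b i n) t = mon p b t * p (nth 0%N t i) ^+ n.
Proof.
elim: b t i => [//|x b IH] [//|j t] [|i] /= [tb] ib.
  by rewrite inc_cons0 !mon_cons exprD mulrAC.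
by rewrite inc_consS !mon_cons IH// mulrA.
Qed.

Lemma sum_iota_split N t (F : nat -> R) : uniq t -> all (fun j => j < N)%N t ->
  \sum_(j <- iota 0 N) F j =
  \sum_(i <- iota 0 (size t)) F (nth 0%N t i) +
  \sum_(j <- [seq j <- iota 0 N | j \notin t]) F j.
Proof.
move=> ut tN; rewrite (bigID (mem t)) /= -big_filter -[X in _ + X]big_filter; congr (_ + _).
transitivity (\sum_(j <- t) F j).
  apply: perm_big; apply: uniq_perm => //; first by rewrite filter_uniq// iota_uniq.
  move=> j; rewrite mem_filter mem_iota /= add0n.
  by case: (boolP (j \in t)) => // /(allP tN).
by rewrite [LHS](big_nth 0%N) /index_iota subn0.
Qed.

(* The left-hand side of [sum_expand] splits according to whether the next
   index [j] is one of the [t_i] or a new one. *)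
Fixpoint expand (W : seq nat -> R) a b c : seq (R * seq nat) :=
  if a is n :: a' then
    flatten [seq expand W a' (inc b i n) (rcons c i) | i <- iota 0 (size b)] ++
    expand W a' (rcons b n) (rcons c (size b))
  else [:: (W c, b)].

(** Such a [W] sees only which entries coincide: two sequences with the same coincidences are images
    of each other under a map [f] of this kind. *)
Definition pattern_fun (V : Type) (W : seq nat -> V) := forall (f : nat -> nat) s,
  {in s &, injective f} -> W (map f s) = W s.

(** Invariant of the reading of [a]: [t] lists the distinct indices met so far, [b] their
    accumulated exponents, and [c] the position in [t] of the index of each factor already read.
    Thus [map (nth 0 t) c] is the sequence of indices read. *)
Lemma sum_expand (W : seq nat -> R) a b c N p :
  pattern_fun W -> all (fun i => i < size b)%N c ->
  \sum_(t <- uniqs N (size b)) mon p b t *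
     \sum_(s <- alls N (size a)) W (map (nth 0%N t) c ++ s) * mon p a s =
  \sum_(x <- expand W a b c) x.1 * dsum N p x.2.
Proof.
move=> Winv; elim: a b c => [|n a IH] b c cb /=.
  rewrite big_seq1 /= /dsum big_distrr /= 2!big_seq; apply: eq_bigr => t.
  rewrite mem_uniqs => /and3P[/eqP tb ut _].
  (* [t] has distinct entries, so [nth 0 t] is injective on the positions in [c], and [W] takes the
     same value at [c] itself. *)
  rewrite big_seq1 cats0 /mon big_nil mulr1 Winv 1?mulrC//.
  move=> i j /(allP cb) ib /(allP cb) jb /eqP.
  by rewrite nth_uniq ?tb// => /eqP.
have cbr : all (fun i => i < size (rcons b n))%N (rcons c (size b)).
  rewrite all_rcons size_rcons leqnn /=.
  by apply: sub_all cb => i; exact: leqW.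
rewrite big_cat big_flatten /= big_map -IH//.
have -> : \sum_(i <- iota 0 (size b))
    \sum_(x <- expand W a (inc b i n) (rcons c i)) x.1 * dsum N p x.2 =
  \sum_(i <- iota 0 (size b)) \sum_(t <- uniqs N (size b)) mon p (inc b i n) t *
     \sum_(s <- alls N (size a)) W (map (nth 0%N t) (rcons c i) ++ s) * mon p a s.
  rewrite 2!big_seq; apply: eq_bigr => i; rewrite mem_iota add0n /= => ib.
  rewrite -IH ?size_inc// all_rcons ib; apply: sub_all cb => //.
rewrite exchange_big size_rcons /= big_allpairs_dep /= -big_split /=.
rewrite 2!big_seq; apply: eq_bigr => t.
rewrite mem_uniqs => /and3P[/eqP tb ut tN].
rewrite big_allpairs_dep (sum_iota_split _ ut tN) mulrDr /= tb.
congr (_ + _); rewrite big_distrr /=.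
  rewrite 2!big_seq; apply: eq_bigr => i; rewrite mem_iota add0n /= => ib.
  rewrite mon_inc// -mulrA [in RHS]big_distrr /=; congr (_ * _); apply: eq_bigr => s _.
  by rewrite mon_cons map_rcons cat_rcons mulrCA.
rewrite 2!big_seq; apply: eq_bigr => j; rewrite mem_filter => /andP[jt _].
rewrite mon_rcons// -mulrA [in RHS]big_distrr /=; congr (_ * _); apply: eq_bigr => s _.
rewrite mon_cons mulrCA; congr (_ * (W _ * _)).
rewrite map_rcons cat_rcons nth_rcons tb ltnn eqxx; congr (_ ++ _).
apply/eq_in_map => i /(allP cb) ib.
by rewrite nth_rcons tb ib.
Qed.

Lemma sum_alls_expand (W : seq nat -> R) a N p : pattern_fun W ->
  \sum_(s <- alls N (size a)) W s * mon p a s =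
  \sum_(x <- expand W a [::] [::]) x.1 * dsum N p x.2.
Proof. by move=> Winv; rewrite -sum_expand//= big_seq1 /mon big_nil mul1r. Qed.

Lemma all_inc b i n : (i < size b)%N -> all (ltn 0) b -> all (ltn 0) (inc b i n).
Proof.
elim: b i => [//|x b IH] [|i] //= ib /andP[x0 b0].
  by rewrite b0 addn_gt0 x0.
by rewrite x0; exact: IH.
Qed.

(** Merging and appending keep exponents positive, as [same_dsums] requires of every term: a zero
    exponent would make the sums diverge with [N]. *)
Lemma expand_gt0 (W : seq nat -> R) a b c : all (ltn 0) a -> all (ltn 0) b ->
  all (fun x => all (ltn 0) x.2) (expand W a b c).
Proof.
elim: a b c => [|n a IH] b c /=; first by move=> _ ->.
move=> /andP[n0 a0] b0; rewrite all_cat; apply/andP; split; last first.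
  by apply: IH => //; rewrite all_rcons; apply/andP.
apply/allP => x /flatten_mapP[i]; rewrite mem_iota => /= ib.
by move=> xL; apply: (allP (IH _ _ a0 _) _ xL); exact: all_inc.
Qed.

Lemma prod_psum a N p :
  \prod_(n <- a) psum N p n = \sum_(s <- alls N (size a)) mon p a s.
Proof.
elim: a => [|n a IH] /=; first by rewrite big_nil big_seq1 /mon big_nil.
rewrite big_cons IH big_allpairs_dep big_distrl /=; apply: eq_bigr => j _.
by rewrite big_distrr; apply: eq_bigr => s _; rewrite mon_cons.
Qed.

(** In the product of [psum] and [dsum] the extra index either differs from all the others or equals
    exactly one of them. Solving for the first case trades a distinct sum for shorter ones. *)
Lemma dsum_rcons b n N p : dsum N p (rcons b n) =
  psum N p n * dsum N p b - \sum_(i <- iota 0 (size b)) dsum N p (inc b i n).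
Proof.
apply/eqP; rewrite eq_sym subr_eq eq_sym; apply/eqP.
have -> : \sum_(i <- iota 0 (size b)) dsum N p (inc b i n) =
    \sum_(i <- iota 0 (size b)) \sum_(t <- uniqs N (size b)) mon p (inc b i n) t.
  rewrite 2!big_seq; apply: eq_bigr => i; rewrite mem_iota add0n /= => ib.
  by rewrite /dsum size_inc.
rewrite exchange_big /dsum size_rcons /= big_allpairs_dep /= -big_split /=.
rewrite big_distrr /= 2!big_seq; apply: eq_bigr => t.
rewrite mem_uniqs => /and3P[/eqP tb ut tN].
rewrite /psum (sum_iota_split _ ut tN) tb addrC mulrDl; congr (_ + _).
  rewrite big_distrl 2!big_seq; apply: eq_bigr => i; rewrite mem_iota add0n /= => ib.
  by rewrite mon_inc// mulrC.
by rewrite big_distrl; apply: eq_bigr => j _; rewrite mon_rcons// mulrC.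
Qed.

(** Induction on the length by [dsum_rcons]. The coefficients depend neither on [N] nor on [p], so
    the identity passes to expectations on both spaces with the same [L]. *)
Lemma dsum_psum_expand b : all (ltn 0) b -> exists L : seq (R * seq nat),
  all (fun x => all (ltn 0) x.2) L /\
  forall N p, dsum N p b = \sum_(x <- L) x.1 * \prod_(n <- x.2) psum N p n.
Proof.
move: {2}(size b) (erefl (size b)) => m; elim: m b => [|m IH] b.
  move=> /size0nil -> _; exists [:: (1, [::])]; split => // N p.
  by rewrite big_seq1 /dsum /= big_seq1 /mon big_nil big_nil mulr1.
case/lastP: b => [//|b n]; rewrite size_rcons all_rcons => -[bm] /andP[n0 b0].
have [L [L0 LE]] := IH _ bm b0.
have /choice[f fP] : forall i, exists L : seq (R * seq nat), (i < size b)%N ->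
    all (fun x => all (ltn 0) x.2) L /\
    forall N p, dsum N p (inc b i n) = \sum_(x <- L) x.1 * \prod_(n <- x.2) psum N p n.
  move=> i; have [ib|ib] := ltnP i (size b); last by exists [::].
  have [|L' L'P] := IH (inc b i n) _ (all_inc _ ib b0); first by rewrite size_inc.
  by exists L'.
exists ([seq (x.1, n :: x.2) | x <- L] ++
        flatten [seq [seq (- x.1, x.2) | x <- f i] | i <- iota 0 (size b)]).
split.
  rewrite all_cat; apply/andP; split.
    by apply/allP => _ /mapP[x xL ->] /=; apply/andP; split => //; exact: (allP L0).
  apply/allP => x /flatten_mapP[i]; rewrite mem_iota add0n /= => ib /mapP[y yf ->] /=.
  by have [/allP fi _] := fP _ ib; exact: fi.
move=> N p; rewrite dsum_rcons LE big_cat big_flatten /= !big_map; congr (_ + _).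
  by rewrite big_distrr; apply: eq_bigr => x _; rewrite big_cons mulrCA.
rewrite -sumrN 2!big_seq; apply: eq_bigr => i; rewrite mem_iota add0n /= => ib.
have [_ ->] := fP _ ib.
by rewrite big_map -sumrN; apply: eq_bigr => x _; rewrite mulNr.
Qed.

End DistinctSums.

(** * Power sums and the EPPF *)

Lemma eq_cvgn (R : realType) (u v : nat -> R) (l : R) : u =1 v ->
  u @ \oo --> l -> v @ \oo --> l.
Proof. by move=> /funext ->. Qed.

Lemma cvgr_EFin (R : realType) (u : nat -> R) (l : R) :
  u @ \oo --> l -> (fun n => (u n)%:E) @ \oo --> l%:E.
Proof. by move=> ul; apply: cvg_EFin => //; exact: nearW. Qed.

(** An unordered sum of nonnegative terms is the limit along any increasing exhaustion by finite
    lists. [eppf] is such a sum, exhausted by the lists [uniqs N k]. *)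
Lemma esum_exhaust (R : realType) (T : choiceType) (S : set T) (f : T -> R)
    (r : nat -> seq T) : (forall x, 0 <= f x) -> (forall N, uniq (r N)) ->
    (forall N, {subset r N <= r N.+1}) ->
    (forall x, S x <-> exists N, x \in r N) ->
  (fun N => (\sum_(x <- r N) f x)%:E) @ \oo --> \esum_(x in S) (f x)%:E.
Proof.
move=> f0 ur rS Sr.
have rmono m n : (m <= n)%N -> {subset r m <= r n}.
  move=> /subnK <-; elim: (n - m)%N => [//|k IH] x /IH; exact: rS.
have sumE N : (\sum_(x <- r N) f x)%:E = (\sum_(x \in [set` r N]) (f x)%:E)%E.
  by rewrite -fsbig_seq// sumEFin.
suff -> : \esum_(x in S) (f x)%:E = ereal_sup (range (fun N => (\sum_(x <- r N) f x)%:E)).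
  apply: ereal_nondecreasing_cvgn => m n mn.
  rewrite !sumE; apply: lee_fsum_nneg_subset; try exact: finite_seq.
    by move=> x; rewrite !inE /=; exact: rmono.
  by move=> x _; rewrite lee_fin.
apply/eqP; rewrite eq_le; apply/andP; split; apply: ge_ereal_sup.
- move=> _ [A [fA AS] <-].
  suff [N AN] : exists N, A `<=` [set` r N].
    apply: (@le_trans _ _ (\sum_(x <- r N) f x)%:E); last first.
      by apply: ereal_sup_ubound; exists N.
    rewrite sumE; apply: lee_fsum_nneg_subset => //; try exact: finite_seq.
      by move=> x; rewrite !inE /=; exact: AN.
    by move=> x _; rewrite lee_fin.
  have /finite_seqP[s As] := fA; subst A => {fA}.
  elim: s AS => [|x s IH] AS.
    by exists 0%N.
  have [|N sN] := IH _; first by move=> y ys; apply: AS; rewrite /= inE ys orbT.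
  have [|M xM] := (Sr x).1 _; first by apply: AS; rewrite /= inE eqxx.
  exists (maxn M N) => y; rewrite /= inE => /predU1P[->|ys].
    by apply: rmono xM; exact: leq_maxl.
  by apply: rmono (sN _ ys); exact: leq_maxr.
- move=> _ [N _ <-]; rewrite sumE; apply: esum_ge.
  exists [set` r N] => //; split; first exact: finite_seq.
  by move=> x xN; apply/Sr; exists N.
Qed.

(** * Probability sequences and their power sums *)

Section DistSeq.
Context (R : realType).
Implicit Types (p : nat -> R).

Definition dist_seq p := (forall j, 0 <= p j) /\ series p @ \oo --> (1 : R).

(* Truncation makes the statistics below bounded everywhere; it changes nothing
   on the almost sure range [0, 1]. *)
Definition clip (x : R) : R := Num.max 0 (Num.min x 1).

Lemma clip01 x : 0 <= clip x <= 1.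
Proof. by rewrite /clip le_max lexx /= ge_max ler01 ge_min lexx orbT. Qed.

Lemma clip_id x : 0 <= x <= 1 -> clip x = x.
Proof. by move=> /andP[x0 x1]; rewrite /clip (min_idPl x1) (max_idPr x0). Qed.

Lemma measurable_clip : measurable_fun setT clip.
Proof. by apply: measurable_maxr => //; exact: measurable_minr. Qed.

Lemma bmf_clip d (T : measurableType d) (f : T -> R) :
  measurable_fun setT f -> bmf (fun x => clip (f x)).
Proof.
move=> mf; split; first exact: (measurableT_comp measurable_clip).
by exists 1 => x; have /andP[c0 c1] := clip01 (f x); rewrite ger0_norm.
Qed.

Lemma psum1E p N : psum N p 1 = series p N.
Proof.
by rewrite /series /= /psum /index_iota subn0; apply: eq_bigr => j _; rewrite expr1.
Qed.

Lemma psumS p N n : psum N.+1 p n = psum N p n + p N ^+ n.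
Proof. by rewrite /psum -addn1 iotaD big_cat big_seq1. Qed.

Lemma psum_ge0 p N n : (forall j, 0 <= p j) -> 0 <= psum N p n.
Proof. by move=> p0; apply: sumr_ge0 => j _; rewrite exprn_ge0. Qed.

Lemma psum_nd p n : (forall j, 0 <= p j) -> nondecreasing_seq (fun N => psum N p n).
Proof.
by move=> p0; apply/nondecreasing_seqP => N; rewrite psumS lerDl exprn_ge0.
Qed.

Lemma dist_psum1 p N : dist_seq p -> psum N p 1 <= 1.
Proof.
move=> [p0 ps]; rewrite -(cvg_lim _ ps)//.
have -> : series p = fun N => psum N p 1 by apply/funext => ?; rewrite psum1E.
apply: (@nondecreasing_cvgn_le _ (fun N => psum N p 1)); first exact: psum_nd.
by apply/cvg_ex; exists 1; under eq_fun do rewrite psum1E.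
Qed.

Lemma dist_le1 p j : dist_seq p -> 0 <= p j <= 1.
Proof.
move=> dp; have [p0 _] := dp; rewrite p0 /=.
apply: le_trans (dist_psum1 j.+1 dp).
by rewrite psumS expr1 lerDr psum_ge0.
Qed.

Lemma dist_psum p N n : (0 < n)%N -> dist_seq p -> 0 <= psum N p n <= 1.
Proof.
move=> n0 dp; have [p0 _] := dp; rewrite psum_ge0//=.
apply: le_trans (dist_psum1 N dp); apply: ler_sum => j _.
have /andP[pj0 pj1] := dist_le1 j dp.
by rewrite expr1 -[leRHS]expr1 ler_wiXn2l.
Qed.

Lemma mon_ge0 p b t : (forall j, 0 <= p j) -> 0 <= mon p b t.
Proof. by move=> p0; apply: prodr_ge0 => z _; rewrite exprn_ge0. Qed.

Lemma dsum_ge0 p N b : (forall j, 0 <= p j) -> 0 <= dsum N p b.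
Proof. by move=> p0; apply: sumr_ge0 => t _; exact: mon_ge0. Qed.

(** Sequences of distinct indices are among all sequences, whose monomials add up to a product of
    power sums, each at most 1. *)
Lemma dist_dsum p N b : all (ltn 0) b -> dist_seq p -> 0 <= dsum N p b <= 1.
Proof.
move=> b0 dp; have [p0 _] := dp; rewrite dsum_ge0//=.
apply: (@le_trans _ _ (\prod_(n <- b) psum N p n)); last first.
  elim: b b0 => [|n b IH] /=; first by rewrite big_nil.
  move=> /andP[n0 /IH {}IH]; rewrite big_cons.
  have /andP[s0 s1] := dist_psum N n0 dp.
  by rewrite mulr_ile1// prodr_ge0// => i _; exact: psum_ge0.
rewrite prod_psum [leRHS](bigID (mem (uniqs N (size b)))) /= ler_wpDr//.
  by apply: sumr_ge0 => t _; exact: mon_ge0.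
rewrite -big_filter le_eqVlt; apply/orP; left; apply/eqP; apply: perm_big.
apply: uniq_perm; rewrite ?uniq_uniqs ?filter_uniq ?uniq_alls// => t.
rewrite mem_filter mem_uniqs mem_alls.
by case: (size t == _) => //=; case: (uniq t) => //=; case: (all _ t).
Qed.

Lemma dist_clip p : dist_seq p -> (fun j => clip (p j)) = p.
Proof. by move=> dp; apply/funext => j; rewrite clip_id//; exact: dist_le1. Qed.

(** An extended real series followed by [fine] and [clip] is measurable in [p] unconditionally. On
    [dist_seq], for positive [n], it is the sum of the p_j^n. *)
Definition powersum (n : nat) p : R :=
  clip (fine (\sum_(0 <= j <oo) (clip (p j) ^+ n)%:E)).

Lemma eseries_clip n p (l : R) : dist_seq p -> (fun N => psum N p n) @ \oo --> l ->
  (\sum_(0 <= j <oo) (clip (p j) ^+ n)%:E)%E = l%:E.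
Proof.
move=> dp pl; apply: cvg_lim => //; apply: cvg_trans (cvgr_EFin pl).
apply: near_eq_cvg; apply: nearW => N.
rewrite /= sumEFin /psum /index_iota subn0; congr _%:E.
by apply: eq_bigr => j _; rewrite clip_id//; exact: dist_le1.
Qed.

Lemma dist_psum_cvg n p : (0 < n)%N -> dist_seq p ->
  (fun N => psum N p n) @ \oo --> powersum n p.
Proof.
move=> n0 dp; have [p0 _] := dp.
have cv : cvgn (fun N => psum N p n).
  apply: nondecreasing_is_cvgn; first exact: psum_nd.
  by exists 1 => _ [N _ <-]; case/andP : (dist_psum N n0 dp).
have le1 : 0 <= limn (fun N => psum N p n) <= 1.
  apply/andP; split; [apply: limr_ge|apply: limr_le] => //; apply: nearW => N;
  by case/andP : (dist_psum N n0 dp).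
by rewrite /powersum (eseries_clip dp cv) /= clip_id.
Qed.

End DistSeq.

(** * Expected distinct sums and their convergence to the EPPF *)

Section Moments.
Context d (T : measurableType d) (R : realType) (Pr : probability T R).
Implicit Types (P : nat -> {RV Pr >-> R}).

Definition cpath P (w : T) : nat -> R := fun j => clip (P j w).

Lemma bmf_cpath P j : bmf (fun w => cpath P w j).
Proof. by apply: bmf_clip; exact: measurable_funPT. Qed.

Lemma bmf_mon P b t : bmf (fun w => mon (cpath P w) b t).
Proof. by apply: bmf_prod => z; apply: bmfX; exact: bmf_cpath. Qed.

Lemma bmf_dsum P N b : bmf (fun w => dsum N (cpath P w) b).
Proof. by apply: bmf_sum => t; exact: bmf_mon. Qed.

Lemma bmf_psum P N n : bmf (fun w => psum N (cpath P w) n).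
Proof. by apply: bmf_sum => t; apply: bmfX; exact: bmf_cpath. Qed.

Lemma bmf_powersum P n : bmf (fun w => powersum n (P ^~ w)).
Proof.
apply: bmf_clip; apply: measurableT_comp => //.
apply: ge0_emeasurable_sum => [j x _ _|j _].
  by rewrite lee_fin exprn_ge0//; case/andP : (clip01 (P j x)).
by apply/measurable_EFinP; case: (bmfX n (bmf_cpath P j)).
Qed.

Lemma dist_ae P : random_discrete_distribution P ->
  {ae Pr, forall w, dist_seq (P ^~ w) /\ cpath P w = P ^~ w}.
Proof.
move=> hP; apply: filterS hP => w dP; split => //.
exact: (@dist_clip _ (P ^~ w)).
Qed.

Lemma cvg_Ex_prod_psum P a : all (ltn 0) a -> random_discrete_distribution P ->
  (fun N => Ex Pr (fun w => \prod_(n <- a) psum N (cpath P w) n)) @ \oo -->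
  Ex Pr (fun w => \prod_(n <- a) powersum n (P ^~ w)).
Proof.
move=> a0 hP; apply: (@Ex_cvg _ _ _ _ _ _ 1).
- by move=> N; apply: bmf_prod => n; exact: bmf_psum.
- by apply: bmf_prod => n; exact: bmf_powersum.
- apply: filterS (dist_ae hP) => w [dw ->].
  elim: a a0 => [_|n a IH /= /andP[n0 a0]].
    rewrite big_nil; under eq_fun do rewrite big_nil; exact: cvg_cst.
  rewrite big_cons; under eq_fun do rewrite big_cons.
  by apply: cvgM; [exact: dist_psum_cvg|exact: IH].
- apply: filterS (dist_ae hP) => w [dw ->] N.
  elim: a a0 => [_|n a IH /= /andP[n0 a0]]; first by rewrite big_nil normr1.
  rewrite big_cons normrM mulr_ile1 ?IH//.
  by have /andP[s0 s1] := dist_psum N n0 dw; rewrite ger0_norm.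
Qed.

Definition Edsum P N b := Ex Pr (fun w => dsum N (cpath P w) b).

Lemma EdsumE P N b :
  Edsum P N b = \sum_(t <- uniqs N (size b)) Ex Pr (fun w => mon (cpath P w) b t).
Proof. by rewrite -Ex_sum// => t; exact: bmf_mon. Qed.

Lemma cpath_ge0 P w j : 0 <= cpath P w j.
Proof. by case/andP : (clip01 (P j w)). Qed.

Lemma Edsum01 P N b : all (ltn 0) b -> random_discrete_distribution P ->
  0 <= Edsum P N b <= 1.
Proof.
move=> b0 hP; apply/andP; split.
  by apply: Ex_ge0 => w; apply: dsum_ge0; exact: cpath_ge0.
rewrite -[leRHS](Ex_cst Pr); apply: Ex_le_ae; [exact: bmf_dsum|exact: bmf_cst|].
apply: filterS (dist_ae hP) => w [dw ->].
by case/andP : (dist_dsum N b0 dw).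
Qed.

(** [eppf] runs over tuples of arbitrary indices, [Edsum] over those below [N]. The expectations are
    nonnegative, so the truncations exhaust the sum. *)
Lemma eppf_cvg P ns : random_discrete_distribution P ->
  (fun N => (Edsum P N ns)%:E) @ \oo --> eppf P ns.
Proof.
move=> hP; pose f t := Ex Pr (fun w => mon (cpath P w) ns t).
have -> : eppf P ns =
    \esum_(t in [set t : seq nat | size t = size ns /\ uniq t]) (f t)%:E.
  rewrite (@reindex_esum _ _ _ [set j : (size ns).-tuple nat | uniq j] _
      (fun j : (size ns).-tuple nat => tval j)).
    apply: eq_esum => j _; rewrite /f -ExE; last exact: bmf_mon.
    rewrite unlock; apply: ae_eq_integral => //.
    - apply/measurable_EFinP; apply: measurable_prod => i _.
      by apply: measurable_funX; exact: measurable_funPT.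
    - by apply/measurable_EFinP; case: (bmf_mon P ns j).
    - apply: filterS (dist_ae hP) => w [_ ->] _; congr _%:E.
      rewrite /mon (big_nth (0%N, 0%N)) size_zip size_tuple minnn big_mkord.
      by apply: eq_bigr => i _; rewrite nth_zip ?size_tuple// (tnth_nth 0%N).
  split.
  - by move=> j uj; split => //; exact: size_tuple.
  - by move=> i j _ _ /val_inj.
  - by move=> t [st ut]; exists (tcast st (in_tuple t)); rewrite /= val_tcast.
have -> : (fun N => (Edsum P N ns)%:E) =
    (fun N => (\sum_(t <- uniqs N (size ns)) f t)%:E).
  by apply/funext => N; rewrite EdsumE.
apply: esum_exhaust.
- by move=> t; apply: Ex_ge0 => w; apply: mon_ge0; exact: cpath_ge0.
- by move=> N; exact: uniq_uniqs.
- move=> N t; rewrite !mem_uniqs => /and3P[-> -> tN] /=.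
  by apply: sub_all tN => j; exact: leqW.
- move=> t; split=> [[st ut]|[N]].
    exists (\max_(j <- t) j).+1; rewrite mem_uniqs st ut eqxx /=.
    by apply/allP => j jt; rewrite ltnS; exact: leq_bigmax_seq.
  by rewrite mem_uniqs => /and3P[/eqP].
Qed.

End Moments.

(** * Three equivalent forms of equality of the moments *)

Section Hub.
Context (R : realType) (d1 d2 : measure_display)
  (T1 : measurableType d1) (T2 : measurableType d2)
  (Pr1 : probability T1 R) (Pr2 : probability T2 R)
  (P : nat -> {RV Pr1 >-> R}) (Q : nat -> {RV Pr2 >-> R})
  (hP : random_discrete_distribution P)
  (hQ : random_discrete_distribution Q).

(* Differences of partial sums avoid the extended real values of [eppf]. *)
Definition same_dsums := forall b, all (ltn 0) b ->
  (fun N => Edsum P N b - Edsum Q N b) @ \oo --> (0 : R).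

Definition same_powersums := forall a, all (ltn 0) a ->
  Ex Pr1 (fun w => \prod_(n <- a) powersum n (P ^~ w)) =
  Ex Pr2 (fun w => \prod_(n <- a) powersum n (Q ^~ w)).

Lemma eppf_same_dsums :
  (forall ns : seq nat, ns != [::] -> all (fun n => 0 < n)%N ns ->
      eppf P ns = eppf Q ns) -> same_dsums.
Proof.
move=> c b b0; have [->|bn] := eqVneq b [::].
  apply: cvg_near_cst; apply: nearW => N.
  by rewrite !EdsumE !big_seq1 /mon !(eq_Ex _ (g := fun=> 1)) ?Ex_cst ?subrr// => w;
    rewrite big_nil.
have cP := eppf_cvg (ns := b) hP; have cQ := eppf_cvg (ns := b) hQ.
rewrite -(c b bn b0) in cQ.
(* The bounds of [Edsum01] survive in the limit; finiteness is what allows the two limits to be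
   subtracted. *)
have fP : eppf P b \is a fin_num.
  apply/fin_numPlt/andP; split.
    apply: (@lt_le_trans _ _ 0%E) => //; apply: cvge_ge cP.
    by apply: nearW => N; rewrite lee_fin; case/andP : (Edsum01 N b0 hP).
  apply: (@le_lt_trans _ _ 1%E); last exact: ltry.
  apply: cvge_le cP.
  by apply: nearW => N; rewrite lee_fin; case/andP : (Edsum01 N b0 hP).
move: cP cQ; rewrite -(fineK fP) => /fine_cvgP[_ cP] /fine_cvgP[_ cQ].
by rewrite -(subrr (fine (eppf P b))); exact: cvgB.
Qed.

Lemma same_dsums_eppf : same_dsums ->
  forall ns : seq nat, ns != [::] -> all (fun n => 0 < n)%N ns ->
    eppf P ns = eppf Q ns.
Proof.
move=> D b _ b0; have cP := eppf_cvg (ns := b) hP; have cQ := eppf_cvg (ns := b) hQ.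
apply: (cvg_unique _ cP) => //.
rewrite /= -[X in _ --> X]add0e.
apply: cvg_trans (cvgeD _ (cvgr_EFin (D b b0)) cQ); last exact: fin_num_adde_defr.
apply: near_eq_cvg; apply: nearW => N /=.
by rewrite -EFinD subrK.
Qed.

Lemma cvg_lin_comb (L : seq (R * seq nat)) (F : seq nat -> nat -> R) :
  (forall x, x \in L -> F x.2 @ \oo --> (0 : R)) ->
  (fun N => \sum_(x <- L) x.1 * F x.2 N : R) @ \oo --> (0 : R).
Proof.
elim: L => [|x L IH] cF.
  by under eq_fun do rewrite big_nil; exact: cvg_cst.
have c1 : (fun N => x.1 * F x.2 N : R) @ \oo --> (x.1 * 0 : R).
  by apply: cvgMr; apply: cF; rewrite inE eqxx.
have c2 : (fun N => \sum_(x <- L) x.1 * F x.2 N : R) @ \oo --> (0 : R).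
  by apply: IH => y yL; apply: cF; rewrite inE yL orbT.
have cD : (fun N => x.1 * F x.2 N + \sum_(x <- L) x.1 * F x.2 N : R) @ \oo --> (x.1 * 0 + 0 : R).
  exact: cvgD.
by rewrite mulr0 addr0 in cD; apply: eq_cvgn cD => N; rewrite big_cons.
Qed.

(** By [sum_alls_expand] both sums are the same linear combination of values of [Edsum], and [expand
    W a [::] [::]] does not involve [N]; the difference is a fixed combination of null sequences. *)
Lemma same_dsums_pattern (W : seq nat -> R) a : same_dsums -> pattern_fun W ->
  all (ltn 0) a ->
  (fun N => \sum_(s <- alls N (size a)) W s * Ex Pr1 (fun w => mon (cpath P w) a s) -
            \sum_(s <- alls N (size a)) W s * Ex Pr2 (fun w => mon (cpath Q w) a s) : R)
  @ \oo --> (0 : R).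
Proof.
move=> D Winv a0.
have E d (T : measurableType d) (Pr : probability T R) (X : nat -> {RV Pr >-> R}) N :
    \sum_(s <- alls N (size a)) W s * Ex Pr (fun w => mon (cpath X w) a s) =
    \sum_(x <- expand W a [::] [::]) x.1 * Edsum X N x.2.
  transitivity (Ex Pr (fun w => \sum_(s <- alls N (size a)) W s * mon (cpath X w) a s)).
    rewrite Ex_sum => [|s]; last by apply: bmfZ; exact: bmf_mon.
    by apply: eq_bigr => s _; rewrite ExZ//; exact: bmf_mon.
  rewrite (eq_Ex _ (g := fun w =>
    \sum_(x <- expand W a [::] [::]) x.1 * dsum N (cpath X w) x.2)) => [|w].
    rewrite Ex_sum => [|s]; last by apply: bmfZ; exact: bmf_dsum.
    by apply: eq_bigr => s _; rewrite ExZ//; exact: bmf_dsum.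
  exact: sum_alls_expand.
have c := @cvg_lin_comb (expand W a [::] [::]) (fun b N => Edsum P N b - Edsum Q N b).
apply: eq_cvgn (c _) => [N|x xL]; last first.
  by apply: D; apply: (allP (expand_gt0 W [::] a0 _)) xL.
by rewrite !E -sumrB; apply: eq_bigr => x _; rewrite mulrBr.
Qed.

Lemma same_powersums_dsums : same_powersums -> same_dsums.
Proof.
move=> S b b0; have [L [L0 LE]] := @dsum_psum_expand R b b0.
have E d (T : measurableType d) (Pr : probability T R) (X : nat -> {RV Pr >-> R}) N :
    Edsum X N b =
    \sum_(x <- L) x.1 * Ex Pr (fun w => \prod_(n <- x.2) psum N (cpath X w) n).
  rewrite /Edsum (eq_Ex _ (g := fun w =>
      \sum_(x <- L) x.1 * \prod_(n <- x.2) psum N (cpath X w) n)) => [|w].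
    have bp (x : R * seq nat) : bmf (fun w => \prod_(n <- x.2) psum N (cpath X w) n).
      by apply: bmf_prod => n; exact: bmf_psum.
    by rewrite Ex_sum => [|x]; [apply: eq_bigr => x _; rewrite ExZ|exact: bmfZ].
  exact: LE.
have c := @cvg_lin_comb L (fun a N =>
   Ex Pr1 (fun w => \prod_(n <- a) psum N (cpath P w) n) -
   Ex Pr2 (fun w => \prod_(n <- a) psum N (cpath Q w) n)).
apply: eq_cvgn (c _) => [N|x xL]; last first.
  have x0 := allP L0 _ xL; rewrite -(subrr (Ex Pr2 (fun w => \prod_(n <- x.2) powersum n (Q ^~ w)))).
  by rewrite -[X in X - _]S//; apply: cvgB; exact: cvg_Ex_prod_psum.
by rewrite !E -sumrB; apply: eq_bigr => x _; rewrite mulrBr.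
Qed.

End Hub.

(** * Transfer of laws *)

(** The sum is the integer part of [y]. Divided by [n], it writes a function with values in [0, 1]
    as a combination of indicators of its upper level sets, up to 1/n. *)
Lemma staircase (R : realType) n (y : R) : 0 <= y <= n%:R ->
  `|\sum_(t < n) (t.+1%:R <= y)%R%:R - y| <= 1.
Proof.
suff H : 0 <= y -> (y <= n%:R -> \sum_(t < n) (t.+1%:R <= y)%R%:R <= y <=
      \sum_(t < n) (t.+1%:R <= y)%R%:R + 1) /\
    (n%:R <= y -> \sum_(t < n) (t.+1%:R <= y)%R%:R = n%:R :> R).
  move=> /andP[/H[+ _]] => /[apply] /andP[a b].
  by rewrite ler_norml; apply/andP; split; lra.
move=> y0; elim: n => [|n [IH1 IH2]].
  rewrite big_ord0; split => // yn; rewrite y0 add0r.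
  by rewrite (le_trans yn).
rewrite big_ord_recr /=; split => [yn|yn]; last first.
  by rewrite IH2 ?yn ?natr1// (le_trans _ yn)// ler_nat.
have [yn'|yn'] := leP y n%:R.
  have /negbTE -> : ~~ (n.+1%:R <= y) by rewrite -ltNge (le_lt_trans yn')// ltr_nat.
  by rewrite addr0; exact: IH1.
rewrite IH2; last exact: ltW.
have [e|lt] := leP n.+1%:R y; rewrite ?natr1 -?natr1.
  by rewrite natr1 e /= (le_trans yn)// lerDl.
by rewrite addr0 (ltW yn') natr1 ltW.
Qed.

Section Transfer.
Context (R : realType) (d1 d2 d : measure_display)
  (T1 : measurableType d1) (T2 : measurableType d2) (E : measurableType d)
  (Pr1 : probability T1 R) (Pr2 : probability T2 R) (X : T1 -> E) (Y : T2 -> E).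
Hypotheses (mX : measurable_fun setT X) (mY : measurable_fun setT Y).

Let I := {A : set E | measurable A}.
Let f0 (i : I) : T1 -> R := \1_(X @^-1` sval i).
Let g0 (i : I) : T2 -> R := \1_(Y @^-1` sval i).

Let bf0 i : bmf (f0 i).
Proof.
by apply: bmf_indic; exact: (measurable_preimageT mX (svalP i)).
Qed.

Let bg0 i : bmf (g0 i).
Proof.
by apply: bmf_indic; exact: (measurable_preimageT mY (svalP i)).
Qed.

Let cpl := coupled Pr1 Pr2 f0 g0.

(** Uniform approximation by the level sets of [staircase], after an affine map into [0, 1]. *)
Let coupled_comp (phi : E -> R) : bmf phi -> cpl (phi \o X) (phi \o Y).
Proof.
have comp (phi' : E -> R) : bmf phi' -> bmf (phi' \o X) /\ bmf (phi' \o Y).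
  move=> [mphi [M phiM]]; split; split; try exact: measurableT_comp.
    by exists M => x; exact: phiM.
  by exists M => x; exact: phiM.
suff H01 (psi : E -> R) : bmf psi -> (forall x, 0 <= psi x <= 1) ->
    cpl (psi \o X) (psi \o Y).
  move=> bphi; have [_ [M phiM]] := bphi; pose K := `|M| + 1.
  have K0 : 0 < K by rewrite /K ltr_pwDr.
  have phiK x : - K <= phi x <= K.
    by rewrite -ler_norml (le_trans (phiM x))// /K (le_trans (ler_norm M))// lerDl.
  pose psi x := (2 * K)^-1 * (phi x + K).
  have : cpl (psi \o X) (psi \o Y).
    apply: H01 => [|x]; first by apply: bmfZ; apply: bmfD => //; exact: bmf_cst.
    rewrite /psi mulr_ge0 ?invr_ge0 ?mulr_ge0 ?(ltW K0)//=; last by have := phiK x; lra.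
    by rewrite mulrC ler_pdivrMr ?mul1r ?mulr_gt0//; have := phiK x; lra.
  move=> /(coupledZ (2 * K))/(coupledD (coupled_cst _ _ _ _ (- K))).
  by apply: eq_coupled => x /=; rewrite /psi mulrA mulfV ?mul1r ?mulf_neq0 ?gt_eqF//; ring.
move=> bpsi psi01; have [bX bY] := comp psi bpsi.
pose A n t : set E := [set x | t.+1%:R <= n.+1%:R * psi x].
have mA n t : measurable (A n t).
  rewrite (_ : A n t = (fun x => n.+1%:R * psi x) @^-1` `[t.+1%:R, +oo[%classic); last first.
    by apply/seteqP; split => x /=; rewrite /A in_itv /= andbT.
  rewrite -[X in measurable X]setTI.
  by have [+ _] := bmfZ n.+1%:R bpsi; apply.
have cl : (fun n => n.+1%:R^-1 : R) @ \oo --> (0 : R) by exact: cvg_harmonic.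
pose g_ n x : R := n.+1%:R^-1 * \sum_(t < n.+1) \1_(A n t) x.
have gE n x : `|g_ n x - psi x| <= n.+1%:R^-1.
  have /staircase : 0 <= n.+1%:R * psi x <= n.+1%:R.
    have /andP[p0 p1] := psi01 x.
    by rewrite mulr_ge0//= -[leRHS]mulr1 ler_wpM2l.
  have n0 : (n.+1%:R : R) != 0 by rewrite pnatr_eq0.
  move=> H; rewrite -[psi x](mulKf n0) /g_ -mulrBr normrM gtr0_norm ?invr_gt0//.
  rewrite -[leRHS]mulr1 ler_wpM2l ?invr_ge0//.
  have -> : \sum_(t < n.+1) \1_(A n t) x =
            \sum_(t < n.+1) (t.+1%:R <= n.+1%:R * psi x)%R%:R :> R.
    by apply: eq_bigr => t _; rewrite indicE; congr (nat_of_bool _)%:R;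
      apply/idP/idP; rewrite inE.
  exact: H.
have bg n : bmf (g_ n).
  by apply: bmfZ; apply: bmf_sum => t; exact: bmf_indic.
(* The bound 2 holds because [psi] is at most 1 and the error is at most 1 / (n + 1) <= 1. *)
apply: (@coupled_lim _ _ _ _ _ _ _ _ f0 g0 bf0 bg0
   (fun n => g_ n \o X) (fun n => g_ n \o Y) _ _ 2) => //.
- move=> n; apply: coupledZ; apply: coupled_sum => t.
  exact: (coupled_base _ _ _ _ (exist _ _ (mA n t))).
- apply: aeW => x; apply/subr_cvg0/norm_cvg0P.
  by apply: (squeeze_cvgr _ (cvg_cst 0) cl); near=> n; rewrite normr_ge0 gE.
- apply: aeW => x; apply/subr_cvg0/norm_cvg0P.
  by apply: (squeeze_cvgr _ (cvg_cst 0) cl); near=> n; rewrite normr_ge0 gE.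
- move=> /=; apply: aeW => x n; have := gE n (X x); have := psi01 (X x).
  have : (n.+1%:R^-1 : R) <= 1 by rewrite invf_le1// ler1n.
  rewrite !ler_norml; move: (_^-1) => c; lra.
- move=> /=; apply: aeW => x n; have := gE n (Y x); have := psi01 (Y x).
  have : (n.+1%:R^-1 : R) <= 1 by rewrite invf_le1// ler1n.
  rewrite !ler_norml; move: (_^-1) => c; lra.
Unshelve. all: by end_near. Qed.

(** An identity known for events extends to bounded functions, with [(k1, k2)] in the role of the
    test pair of [coupled_test]. Typically [k1] is the indicator of an event of the auxiliary
    variables and [k2] its conditional probability, so this replaces conditional expectations
    throughout. *)
Lemma transfer (k1 : T1 -> R) (k2 : T2 -> R) : bmf k1 -> bmf k2 ->
  (forall A, measurable A -> Ex Pr1 (fun x => k1 x * \1_(X @^-1` A) x) =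
                             Ex Pr2 (fun x => k2 x * \1_(Y @^-1` A) x)) ->
  forall g : E -> R, bmf g ->
  Ex Pr1 (fun x => g (X x) * k1 x) = Ex Pr2 (fun x => g (Y x) * k2 x).
Proof.
move=> bk1 bk2 H g bg.
have := @coupled_test _ _ _ _ _ Pr1 Pr2 _ f0 g0 bf0 bg0 _ _
  (coupled_comp bg) k1 k2 bk1 bk2 _ [::].
rewrite (eq_Ex _ (g := fun x => g (X x) * k1 x)) => [|x]; last by rewrite big_nil mulr1.
rewrite (eq_Ex Pr2 (g := fun x => g (Y x) * k2 x)) => [|x]; last by rewrite big_nil mulr1.
apply => s.
have [A mA [AX AY]] : exists2 A : set E, measurable A &
    (forall x, \prod_(i <- s) f0 i x = \1_(X @^-1` A) x) /\
    (forall x, \prod_(i <- s) g0 i x = \1_(Y @^-1` A) x).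
  elim: s => [|i s [A mA [AX AY]]].
    by exists setT => //; split => x; rewrite big_nil preimage_setT indicT.
  exists (sval i `&` A); first by apply: measurableI => //; exact: (svalP i).
  by split => x; rewrite big_cons ?AX ?AY preimage_setI indicI.
rewrite (eq_Ex _ (g := fun x => k1 x * \1_(X @^-1` A) x)) => [|x]; last by rewrite AX.
by rewrite H//; apply: eq_Ex => x; rewrite AY.
Qed.

End Transfer.

(** * The sequence space: measurability and laws of paths *)

Section SeqSpace.
Context (R : realType).

Lemma measurable_coord j : measurable_fun setT (fun x : seqspace R => x j : R).
Proof.
move=> _ A mA; rewrite setTI; apply: sub_sigma_algebra.
by exists j, A.
Qed.

Lemma measurable_to_seqspace d (T : measurableType d) (X : T -> seqspace R) :
  (forall j, measurable_fun setT (fun w => X w j : R)) -> measurable_fun setT X.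
Proof.
move=> mX; apply: (@measurability _ _ T (seqspace R) setT X (@cylinders R) erefl).
move=> _ [_ [j [B [mB ->]]] <-]; exact: mX.
Qed.

Lemma measurable_path_of d (T : measurableType d) (Pr : probability T R)
  (P : nat -> {RV Pr >-> R}) : measurable_fun setT (path_of P).
Proof. by apply: measurable_to_seqspace => j; exact: measurable_funPT. Qed.

Lemma measurable_clip_coord j : measurable_fun setT (fun x : seqspace R => clip (x j)).
Proof. by apply: measurableT_comp (@measurable_clip R) _; exact: measurable_coord. Qed.

(** Once the coordinates lie in [0, 1], convergence to 1 becomes an equation for the series of
    clipped terms, a measurable extended real function. *)
Lemma measurable_dist : measurable [set x : seqspace R | dist_seq x].
Proof.
have -> : [set x : seqspace R | dist_seq x] =
   (\bigcap_j (fun x : seqspace R => x j : R) @^-1` `[0, 1]%classic) `&`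
   (fun x : seqspace R => \sum_(0 <= j <oo) (clip (x j))%:E)%E @^-1` [set 1%E].
  apply/seteqP; split => [x dx|x [x01 x1]].
    split; first by move=> j _ /=; rewrite in_itv /=; exact: dist_le1.
    have := @eseries_clip R 1 x 1 dx.
    rewrite /=; under eq_eseriesr do rewrite expr1; apply.
    by case: dx => _ ; apply: eq_cvgn => N; rewrite psum1E.
  have x0 j : 0 <= (x j : R) <= 1 by have := x01 j I; rewrite /= in_itv.
  split; first by move=> j; case/andP : (x0 j).
  have cv : (fun N => \sum_(0 <= j < N) (clip (x j))%:E)%E @ \oo --> 1%E.
    rewrite -x1; apply: is_cvg_nneseries => j _ _.
    by rewrite lee_fin; case/andP : (clip01 (x j : R)).
  have /fine_cvgP[_] := cv; apply: eq_cvgn => N.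
  by rewrite /= sumEFin /= /series; apply: eq_bigr => j _; rewrite clip_id.
apply: measurableI.
  apply: bigcapT_measurable => j; rewrite -[X in measurable X]setTI.
  by apply: measurable_coord.
rewrite -[X in measurable X]setTI.
suff : measurable_fun setT (fun x : seqspace R => \sum_(0 <= j <oo) (clip (x j))%:E)%E.
  by apply => //; exact: emeasurable_set1.
apply: ge0_emeasurable_sum => [j x _ _|j _].
  by rewrite lee_fin; case/andP : (clip01 (x j : R)).
by apply/measurable_EFinP; exact: measurable_clip_coord.
Qed.

(** Almost sure properties of the path are properties of its law, hence pass to copies. *)
Lemma ae_path d (T : measurableType d) (Pr : probability T R)
    (P : nat -> {RV Pr >-> R}) (A : set (seqspace R)) : measurable A ->
  {ae Pr, forall w, A (path_of P w)} <-> pushforward Pr (path_of P) A = 1%E.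
Proof.
move=> mA; have mPA : measurable (path_of P @^-1` A).
  exact: (measurable_preimageT (measurable_path_of _)).
set B := path_of P @^-1` A in mPA *.
have E : Pr (~` B) = (1 - Pr B)%E by exact: probability_setC.
split=> h.
  have : Pr (~` B) = 0%E by apply/negligibleP => //; exact: measurableC.
  rewrite E /pushforward -/B; move: (fin_num_measure Pr B mPA); case: (Pr B) => //= r _.
  by rewrite -EFinB => -[] /eqP; rewrite subr_eq0 => /eqP <-.
have E0 : Pr (~` B) = 0%E by rewrite E -[Pr B]/(pushforward Pr (path_of P) A) h subee.
by apply/negligibleP => //; exact: measurableC.
Qed.

Lemma same_law_dist (d1 d2 : measure_display)
    (T1 : measurableType d1) (T2 : measurableType d2)
    (Pr1 : probability T1 R) (Pr2 : probability T2 R)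
    (P : nat -> {RV Pr1 >-> R}) (Q : nat -> {RV Pr2 >-> R}) :
  same_law_seq P Q -> random_discrete_distribution Q -> random_discrete_distribution P.
Proof.
move=> PQ hQ; apply/(ae_path P measurable_dist); rewrite PQ; last exact: measurable_dist.
exact/(ae_path Q measurable_dist).
Qed.

Lemma same_law_Ex (d1 d2 d : measure_display)
    (T1 : measurableType d1) (T2 : measurableType d2) (E : measurableType d)
    (Pr1 : probability T1 R) (Pr2 : probability T2 R)
    (X : T1 -> E) (Y : T2 -> E) (g : E -> R) :
  measurable_fun setT X -> measurable_fun setT Y -> same_law Pr1 Pr2 X Y -> bmf g ->
  Ex Pr1 (fun w => g (X w)) = Ex Pr2 (fun w => g (Y w)).
Proof.
move=> mX mY XY bg.
have H A : measurable A -> Ex Pr1 (fun x => 1 * \1_(X @^-1` A) x) =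
                           Ex Pr2 (fun x => 1 * \1_(Y @^-1` A) x).
  move=> mA; rewrite (ExZ _ 1 (f := \1_(X @^-1` A))) ?(ExZ _ 1 (f := \1_(Y @^-1` A)));
    try (apply: bmf_indic; by [exact: (measurable_preimageT mX)|exact: (measurable_preimageT mY)]).
  congr (_ * _); apply: EFin_inj; rewrite !Ex_indic; first exact: XY.
    exact: (measurable_preimageT mY).
  exact: (measurable_preimageT mX).
have := transfer mX mY (bmf_cst _ _) (bmf_cst _ _) H bg.
have e1 d' (T : measurableType d') (Pr : probability T R) (f : T -> R) :
  Ex Pr (fun x => f x * 1) = Ex Pr f by apply: eq_Ex => x; rewrite mulr1.
by rewrite !e1.
Qed.

Lemma bmf_coord_clip j : bmf (fun x : seqspace R => clip (x j)).
Proof. by apply: bmf_clip; exact: measurable_coord. Qed.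

Lemma bmf_mon_seq b t : bmf (fun x : seqspace R => mon (fun j => clip (x j)) b t).
Proof. by apply: bmf_prod => z; apply: bmfX; exact: bmf_coord_clip. Qed.

Lemma same_law_Edsum (d1 d2 : measure_display)
    (T1 : measurableType d1) (T2 : measurableType d2)
    (Pr1 : probability T1 R) (Pr2 : probability T2 R)
    (P : nat -> {RV Pr1 >-> R}) (Q : nat -> {RV Pr2 >-> R}) N b :
  same_law_seq P Q -> Edsum P N b = Edsum Q N b.
Proof.
move=> PQ; apply: (same_law_Ex (g := fun x : seqspace R => dsum N (fun j => clip (x j)) b)
   (measurable_path_of P) (measurable_path_of Q) PQ).
by apply: bmf_sum => t; exact: bmf_mon_seq.
Qed.

End SeqSpace.

(** * Equality of laws of coupled variables and sequences *)

Section CoupledLaw.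
Context (R : realType) (d1 d2 : measure_display)
  (T1 : measurableType d1) (T2 : measurableType d2)
  (Pr1 : probability T1 R) (Pr2 : probability T2 R)
  (I : Type) (f0 : I -> T1 -> R) (g0 : I -> T2 -> R).
Hypotheses (bf0 : forall i, bmf (f0 i)) (bg0 : forall i, bmf (g0 i)).
Hypothesis moments : forall s : seq I,
  Ex Pr1 (fun x => \prod_(i <- s) f0 i x) = Ex Pr2 (fun x => \prod_(i <- s) g0 i x).
Let cpl := coupled Pr1 Pr2 f0 g0.

Lemma coupled_preimage f g (B : set R) : cpl f g -> measurable B ->
  cpl \1_(f @^-1` B) \1_(g @^-1` B) /\ pushforward Pr1 f B = pushforward Pr2 g B.
Proof.
move=> fg mB; have [[mf _] [mg _]] := coupled_bmf bf0 bg0 fg.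
apply: (coupled_law bf0 bg0 moments (G := @RGenInftyO.G R)) => //.
  exact: RGenInftyO.measurableE.
move=> _ [x ->].
have E T (h : T -> R) : (fun w => (h w < x)%R%:R) = \1_(h @^-1` `]-oo, x[%classic) :> (T -> R).
  apply/funext => w; rewrite indicE; congr (nat_of_bool _)%:R.
  by apply/idP/idP; rewrite inE /= in_itv.
by rewrite -!E; exact: coupled_lt.
Qed.

Lemma coupled_seqspace (X : T1 -> seqspace R) (Y : T2 -> seqspace R) :
  (forall j, cpl (fun w => X w j) (fun w => Y w j)) -> same_law Pr1 Pr2 X Y.
Proof.
move=> XY A mA; have bXY j := coupled_bmf bf0 bg0 (XY j).
suff [] : cpl \1_(X @^-1` A) \1_(Y @^-1` A) /\ pushforward Pr1 X A = pushforward Pr2 Y A by [].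
apply: (coupled_law bf0 bg0 moments (G := @cylinders R : set (set (seqspace R)))) => //.
- by apply: measurable_to_seqspace => j; case: (bXY j) => -[].
- by apply: measurable_to_seqspace => j; case: (bXY j) => _ [].
- by move=> _ [j [B [mB ->]]]; case: (coupled_preimage (XY j) mB).
Qed.

End CoupledLaw.

Lemma same_law_ae (R : realType) (d1 d2 d : measure_display)
    (T1 : measurableType d1) (T2 : measurableType d2) (E : measurableType d)
    (Pr1 : probability T1 R) (Pr2 : probability T2 R)
    (X X' : T1 -> E) (Y Y' : T2 -> E) :
  measurable_fun setT X -> measurable_fun setT X' ->
  measurable_fun setT Y -> measurable_fun setT Y' ->
  {ae Pr1, forall w, X w = X' w} -> {ae Pr2, forall w, Y w = Y' w} ->
  same_law Pr1 Pr2 X Y -> same_law Pr1 Pr2 X' Y'.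
Proof.
move=> mX mX' mY mY' XX' YY' XY A mA.
have H d' (T : measurableType d') (Pr : probability T R) (Z Z' : T -> E) :
    measurable_fun setT Z -> measurable_fun setT Z' ->
    {ae Pr, forall w, Z w = Z' w} -> pushforward Pr Z A = pushforward Pr Z' A.
  move=> mZ mZ' ZZ'.
  have m1 : measurable (Z @^-1` A) by exact: (measurable_preimageT mZ).
  have m2 : measurable (Z' @^-1` A) by exact: (measurable_preimageT mZ').
  rewrite /pushforward -!Ex_indic//; congr _%:E; apply: Ex_ae; try exact: bmf_indic.
  by apply: filterS ZZ' => w; rewrite !indicE => e; congr (nat_of_bool _)%:R;
    apply/idP/idP; rewrite !inE /= e.
by rewrite -(H _ _ _ _ _ mX mX' XX') XY// (H _ _ _ _ _ mY mY' YY').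
Qed.

(** * Size-biased sampling *)

Section Records.
Context (R : realType).
Implicit Types (p : nat -> R) (j : nat -> nat).

Definition prefix_of j i : seq nat := [seq j l | l <- iota 0 i].

Lemma prefixS j i : prefix_of j i.+1 = rcons (prefix_of j i) (j i).
Proof. by rewrite /prefix_of -addn1 iotaD map_cat /= add0n cats1. Qed.

Lemma size_prefix j i : size (prefix_of j i) = i.
Proof. by rewrite size_map size_iota. Qed.

Definition ndist j i := size (undup (prefix_of j i)).

Lemma ndistS j i : ndist j i.+1 = (ndist j i + (j i \notin prefix_of j i))%N.
Proof.
rewrite /ndist prefixS.
rewrite (@perm_size _ _ (undup (j i :: prefix_of j i))); last first.
  by apply: perm_undup => x; rewrite mem_rcons.
by rewrite /=; case: (j i \in _); rewrite ?addn0 ?addn1.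
Qed.

Lemma new_value_atE j k i :
  new_value_at j k i = (j i \notin prefix_of j i) && (ndist j i == k).
Proof. by []. Qed.

(** A new value raises the count [ndist], which never decreases, so the count [k] cannot be met by
    two new values. *)
Lemma new_value_at_inj j k i i' : new_value_at j k i -> new_value_at j k i' -> i = i'.
Proof.
wlog ii' : i i' / (i < i')%N => [wl|].
  by have [/wl H ? ?|/wl H ? ?|//] := ltngtP i i'; [exact: H|exact/esym/H].
rewrite !new_value_atE => /andP[ji /eqP ki] /andP[_ /eqP ki'].
have : (ndist j i.+1 <= ndist j i')%N.
  move: ii' => /subnK <-; elim: (i' - i.+1)%N => [//|n IH].
  by rewrite addSn; apply: leq_trans IH _; rewrite [leqRHS]ndistS leq_addr.
by rewrite ndistS ji ki ki' addn1 ltnn.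
Qed.

(** At most one term of the sum is nonzero. In this form the size-biased term is a limit of
    statistics built from the sampled masses and the indicators that two draws coincide. *)
Lemma size_biased_cvg p j k :
  (fun n => \sum_(i <- iota 0 n) (new_value_at j k i)%:R * p (j i)) @ \oo -->
  size_biased_term p j k.
Proof.
apply: cvg_near_cst; rewrite /size_biased_term.
case: pselect => [h|h]; last first.
  apply: nearW => n; apply: big1 => i _.
  by case: (boolP (new_value_at j k i)) => [ki|_]; [case: h; exists i|rewrite mul0r].
case: ex_minnP => i0 ki0 _; near=> n.
have in0 : (i0 < n)%N by near: n; exact: nbhs_infty_gt.
rewrite (bigD1_seq i0) ?iota_uniq ?mem_iota//= ki0 mul1r big1 ?addr0// => i ii0.
case: (boolP (new_value_at j k i)) => [ki|_]; last by rewrite mul0r.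
by rewrite (new_value_at_inj ki ki0) eqxx in ii0.
Unshelve. all: by end_near. Qed.

Lemma size_biased_partial_bd p j k n : (forall i, 0 <= p i <= 1) ->
  0 <= \sum_(i <- iota 0 n) (new_value_at j k i)%:R * p (j i) <= 1.
Proof.
move=> p01; apply/andP; split.
  by apply: sumr_ge0 => i _; rewrite mulr_ge0//; case/andP : (p01 (j i)).
have [[i0 i0n ki0]|no] := pselect (exists2 i, i \in iota 0 n & new_value_at j k i).
  rewrite (bigD1_seq i0) ?iota_uniq//= ki0 mul1r big1 ?addr0 => [|i ii0].
    by case/andP : (p01 (j i0)).
  case: (boolP (new_value_at j k i)) => [ki|_]; last by rewrite mul0r.
  by rewrite (new_value_at_inj ki ki0) eqxx in ii0.
rewrite big_seq big1// => i iN.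
by case: (boolP (new_value_at j k i)) => [ki|_]; [case: no; exists i|rewrite mul0r].
Qed.

Lemma notin_prefix_prod j i : (j i \notin prefix_of j i)%:R =
  \prod_(l <- iota 0 i) (1 - (j i == j l)%:R) :> R.
Proof.
rewrite /prefix_of; elim: (iota 0 i) => [|l s IH]; first by rewrite big_nil.
rewrite big_cons -IH /= inE; case: (j i == j l) => /=; first by rewrite subrr mul0r.
by rewrite subr0 mul1r.
Qed.

Lemma ndist_sum j i :
  (ndist j i)%:R = \sum_(l <- iota 0 i) (j l \notin prefix_of j l)%:R :> R.
Proof.
elim: i => [|i IH]; first by rewrite big_nil.
by rewrite ndistS natrD IH -[in RHS]addn1 iotaD big_cat big_seq1 add0n.
Qed.

(** Equality as a difference of two strict thresholds, the form that [coupled_lt] handles. *)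
Lemma eqn_lt (n k : nat) : (n == k)%:R = ((n%:R : R) < k.+1%:R)%R%:R - ((n%:R : R) < k%:R)%R%:R :> R.
Proof.
by rewrite !ltr_nat ltnS; case: (ltngtP n k); rewrite ?subrr ?subr0.
Qed.

End Records.

(** * Moments of a sample *)

Section Sampling.
Context d (T : measurableType d) (R : realType) (Pr : probability T R)
  (P : nat -> {RV Pr >-> R}) (J : nat -> {RV Pr >-> nat})
  (hP : random_discrete_distribution P) (hJ : sample_from P J).

Let pre k w := prefix_of (J ^~ w) k.

Lemma measurable_pre k t : measurable [set w | pre k w = t].
Proof.
have [<-|tk] := eqVneq (size t) k; last first.
  rewrite (_ : [set _ | _] = set0)//; apply/seteqP; split => // w /= tE.
  by rewrite -tE size_prefix eqxx in tk.
rewrite (_ : [set _ | _] = \big[setI/setT]_(i <- iota 0 (size t))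
    (J i @^-1` [set nth 0%N t i])).
  apply: big_ind => [//||i _]; first exact: measurableI.
  exact: (measurable_preimageT (measurable_funPT _)).
rewrite -bigcap_seq; apply/seteqP; split => w /=.
  move=> <- i; rewrite /= mem_iota size_prefix add0n => /= ik.
  by rewrite (nth_map 0%N) ?size_iota// nth_iota.
move=> H; apply: (@eq_from_nth _ 0%N); rewrite size_prefix// => i ik.
rewrite (nth_map 0%N) ?size_iota// nth_iota// add0n; apply: H.
by rewrite /= mem_iota.
Qed.

(** [sample_from] extended from events to bounded functions of [P]: the event that the sample starts
    with [t] is replaced by its conditional probability, which is the monomial with all exponents
    1. *)
Lemma sample_transfer t (g : seqspace R -> R) : bmf g ->
  Ex Pr (fun w => g (path_of P w) * \1_[set w | pre (size t) w = t] w) =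
  Ex Pr (fun w => g (path_of P w) * mon (cpath P w) (nseq (size t) 1%N) t).
Proof.
move=> bg; have mp := measurable_path_of P.
apply: (transfer mp mp) => //.
- by apply: bmf_indic; exact: measurable_pre.
- exact: bmf_mon.
- move=> A mA; have mPA : measurable (path_of P @^-1` A).
    exact: (measurable_preimageT mp).
  have mE := measurable_pre (size t) t.
  have -> : (fun x => \1_[set w | pre (size t) w = t] x * \1_(path_of P @^-1` A) x) =
      \1_(path_of P @^-1` A `&` [set w | pre (size t) w = t]) :> (T -> R).
    by apply/funext => w; rewrite indicI mulrC.
  apply: EFin_inj; rewrite Ex_indic; last exact: measurableI.
  have -> : [set w | pre (size t) w = t] =
      [set w | forall i : 'I_(size t), J i w = tnth (in_tuple t) i].
    apply/seteqP; split => w /=.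
      move=> tE i; rewrite (tnth_nth 0%N) /=.
      have := congr1 (nth 0%N ^~ i) tE.
      by rewrite (nth_map 0%N) ?size_iota// nth_iota// add0n.
    move=> H; apply: (@eq_from_nth _ 0%N); rewrite size_prefix// => i ik.
    rewrite (nth_map 0%N) ?size_iota// nth_iota// add0n.
    by have := H (Ordinal ik); rewrite (tnth_nth 0%N).
  rewrite hJ// -ExE; last by apply: bmfM; [exact: bmf_mon|exact: bmf_indic].
  rewrite integral_mkcond; apply: ae_eq_integral => //.
  + apply/(measurable_restrictT _ mPA)/measurable_EFinP.
    by apply: measurable_funTS; apply: measurable_prod => i _; exact: measurable_funPT.
  + by apply/measurable_EFinP; case: (bmfM (bmf_mon P (nseq (size t) 1%N) t) (bmf_indic R mPA)).
  + apply: filterS (dist_ae hP) => w [_ Pw] _.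
    rewrite /patch indicE; case: ifPn => _; last by rewrite mulr0.
    rewrite mulr1; congr _%:E; rewrite /mon (big_nth (0%N, 0%N)) size_zip size_nseq minnn.
    rewrite big_mkord; apply: eq_bigr => i _; rewrite nth_zip ?size_nseq//=.
    by rewrite nth_nseq ltn_ord expr1 Pw (tnth_nth 0%N).
Qed.

(** The conditional probability of the prefix [t] raises every exponent by one. The exponents
    [map S m] are therefore positive even where [m] vanishes. *)
Lemma sample_mon m t : size t = size m ->
  Ex Pr (fun w => mon (cpath P w) m t * \1_[set w | pre (size t) w = t] w) =
  Ex Pr (fun w => mon (cpath P w) (map S m) t).
Proof.
move=> tm; rewrite (sample_transfer t (bmf_mon_seq R m t)); apply: eq_Ex => w.
rewrite -[mon _ m t]/(mon (cpath P w) m t).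
elim: m t tm => [|n m IH] [|i t]//= => [_|[tm]].
  by rewrite /mon big_nil mulr1.
by rewrite !mon_cons mulrACA IH// expr1 exprSr.
Qed.

Variables (W : seq nat -> R) (m : seq nat).
Hypothesis W1 : forall t, `|W t| <= 1.

Let phi w := W (pre (size m) w) * mon (cpath P w) m (pre (size m) w).

Let phiN N w := \sum_(t <- alls N (size m))
  W t * (mon (cpath P w) m t * \1_[set w | pre (size t) w = t] w).

Lemma mon_le1 (p : nat -> R) b t : (forall j, 0 <= p j <= 1) -> 0 <= mon p b t <= 1.
Proof.
move=> p01; apply/andP; split; first by apply: mon_ge0 => j; case/andP : (p01 j).
rewrite /mon; elim: (zip t b) => [|z s IH]; first by rewrite big_nil.
have /andP[? ?] := p01 z.1.
rewrite big_cons mulr_ile1 ?exprn_ge0 ?exprn_ile1// prodr_ge0// => y _.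
by rewrite exprn_ge0//; case/andP : (p01 y.1).
Qed.

Lemma cpath01 w j : 0 <= cpath P w j <= 1. Proof. exact: clip01. Qed.

Let phi_le1 w : `|phi w| <= 1.
Proof.
have /andP[m0 m1] := mon_le1 m (pre (size m) w) (cpath01 w).
by rewrite /phi normrM mulr_ile1// ger0_norm.
Qed.

Let bphiN N : bmf (phiN N).
Proof.
apply: bmf_sum => t; apply: bmfZ; apply: bmfM; first exact: bmf_mon.
by apply: bmf_indic; exact: measurable_pre.
Qed.

Let phiNE N w : phiN N w = if pre (size m) w \in alls N (size m) then phi w else 0.
Proof.
rewrite /phiN; case: ifPn => h.
  rewrite (bigD1_seq (pre (size m) w)) ?uniq_alls//= big1_seq ?addr0.
    by rewrite indicE mem_set ?mulr1//= size_prefix.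
  move=> t /andP[tn]; rewrite mem_alls => /andP[/eqP ts _].
  rewrite indicE memNset ?mulr0//= ts => e; by rewrite -e eqxx in tn.
rewrite big1_seq// => t /andP[_ tN]; have := tN; rewrite mem_alls => /andP[/eqP ts _].
rewrite indicE memNset ?mulr0//= ts => e; by rewrite e tN in h.
Qed.

Let phiN_cvg w : phiN ^~ w @ \oo --> phi w.
Proof.
apply: cvg_near_cst; near=> N; rewrite phiNE ifT//.
rewrite mem_alls size_prefix eqxx /=; apply/allP => j jp.
suff : (\max_(j <- pre (size m) w) j < N)%N.
  by apply: leq_ltn_trans; exact: leq_bigmax_seq.
by near: N; exact: nbhs_infty_gt.
Unshelve. all: by end_near. Qed.

Lemma bmf_sample : bmf phi.
Proof.
split; last by exists 1.
apply: (measurable_fun_cvg (h := phiN)); first by move=> N; case: (bphiN N).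
by move=> w _; exact: phiN_cvg.
Qed.

Lemma cvg_sample :
  (fun N => \sum_(t <- alls N (size m)) W t * Ex Pr (fun w => mon (cpath P w) (map S m) t) : R)
  @ \oo --> Ex Pr phi.
Proof.
have bt t : bmf (fun w => mon (cpath P w) m t * \1_[set w | pre (size t) w = t] w).
  by apply: bmfM; [exact: bmf_mon|apply: bmf_indic; exact: measurable_pre].
apply: eq_cvgn (Ex_cvg (M := 1) bphiN bmf_sample _ _) => [N||].
- rewrite /phiN Ex_sum => [|t]; last exact: bmfZ.
  rewrite 2!big_seq; apply: eq_bigr => t; rewrite mem_alls => /andP[/eqP ts _].
  by rewrite ExZ// sample_mon.
- by apply: aeW => w; exact: phiN_cvg.
- by apply: aeW => w N; rewrite phiNE; case: ifP => _ //; rewrite normr0.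
Qed.

End Sampling.

(** * Products of sampled masses and coincidence indicators *)

Section SampleBase.
Context (R : realType).
Implicit Types (s : seq (nat * nat + nat)) (t : seq nat).

Definition sample_stat d (T : measurableType d) (Pr : probability T R)
    (P : nat -> {RV Pr >-> R}) (J : nat -> {RV Pr >-> nat})
    (e : nat * nat + nat) (w : T) : R :=
  match e with
  | inl il => (J il.1 w == J il.2 w)%:R
  | inr i => cpath P w (J i w)
  end.

(** [onth] instead of [nth]: a default index could be confused with an actual one, and the weight
    would no longer be invariant under relabelling. *)
Definition eq_pattern s t : R :=
  \prod_(e <- s) if e is inl il then (onth t il.1 == onth t il.2)%:R else 1.

Definition exponents k s : seq nat :=
  foldr (fun e m => if e is inr i then inc m i 1 else m) (nseq k 0%N) s.

Definition stat_bound s : nat := \max_(e <- s) (match e with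
  | inl il => maxn il.1 il.2 | inr i => i end).+1.

Lemma eq_pattern_fun s : pattern_fun (eq_pattern s).
Proof.
move=> f t finj; apply: eq_bigr => -[[i l]|//] _ /=.
rewrite !onth_map; congr (nat_of_bool _)%:R.
case Ei : (onth t i) => [x|]; case El : (onth t l) => [y|] //=.
apply/eqP/eqP => [[]|[->]//].
by move/finj => ->//; apply/onthP; [exists i|exists l].
Qed.

Lemma eq_pattern_le1 s t : `|eq_pattern s t| <= 1.
Proof.
rewrite /eq_pattern; elim: s => [|e s IH]; first by rewrite big_nil normr1.
rewrite big_cons normrM mulr_ile1//.
by case: e => [il|_]; rewrite ?normr1// ger0_norm// lern1 leq_b1.
Qed.

Lemma size_exponents k s : (stat_bound s <= k)%N -> size (exponents k s) = k.
Proof.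
rewrite /stat_bound; elim: s => [|e s IH]; first by rewrite size_nseq.
rewrite big_cons geq_max => /andP[ek /IH {}IH] /=.
by case: e ek => // i ik; rewrite size_inc IH.
Qed.

Lemma mon_nseq0 (p : nat -> R) k t : mon p (nseq k 0%N) t = 1.
Proof.
elim: k t => [|k IH] [|x t]; rewrite /mon ?big_nil//= big_cons expr0 mul1r.
exact: IH.
Qed.

Lemma prod_sample_stat d (T : measurableType d) (Pr : probability T R)
    (P : nat -> {RV Pr >-> R}) (J : nat -> {RV Pr >-> nat}) k s w :
  (stat_bound s <= k)%N ->
  \prod_(e <- s) sample_stat P J e w =
  eq_pattern s (prefix_of (J ^~ w) k) *
  mon (cpath P w) (exponents k s) (prefix_of (J ^~ w) k).
Proof.
have np i : (i < k)%N -> onth (prefix_of (J ^~ w) k) i = Some (J i w).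
  move=> ik; rewrite onthE (nth_map 0%N) ?size_prefix//.
  by rewrite (nth_map 0%N) ?size_iota// nth_iota// add0n.
rewrite /stat_bound; elim: s => [|e s IH].
  by move=> _; rewrite /eq_pattern !big_nil mul1r mon_nseq0.
rewrite !big_cons geq_max => /andP[ek sk]; rewrite IH//.
rewrite /eq_pattern big_cons -/(eq_pattern s _).
case: e ek => [[i l]|i] /= ek; last first.
  rewrite mul1r mon_inc ?size_exponents// ?size_prefix//.
  rewrite (onth_nth 0%N _ _ _ (np _ ek)); last by rewrite expr1 mulrCA [cpath _ _ _ * _]mulrC.
have ik := leq_ltn_trans (leq_maxl i l) ek.
have lk := leq_ltn_trans (leq_maxr i l) ek.
by rewrite !np// mulrA.
Qed.

End SampleBase.

(** * Law of the size-biased sequence *)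

Section SampleLaw.
Context (R : realType) (d1 d2 : measure_display)
  (T1 : measurableType d1) (T2 : measurableType d2)
  (Pr1 : probability T1 R) (Pr2 : probability T2 R)
  (P : nat -> {RV Pr1 >-> R}) (J : nat -> {RV Pr1 >-> nat})
  (Q : nat -> {RV Pr2 >-> R}) (K : nat -> {RV Pr2 >-> nat})
  (hP : random_discrete_distribution P) (hQ : random_discrete_distribution Q)
  (hJ : sample_from P J) (hK : sample_from Q K) (D : same_dsums P Q).

Let f0 := sample_stat P J.
Let g0 := sample_stat Q K.

(** Here a path is evaluated at a random index; the measurability is that of [bmf_sample], applied
    to a product of one factor. *)
Lemma bmf_sample_stat d (T : measurableType d) (Pr : probability T R)
  (X : nat -> {RV Pr >-> R}) (L : nat -> {RV Pr >-> nat}) e :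
  bmf (sample_stat X L e).
Proof.
have := bmf_sample X L (exponents (stat_bound [:: e]) [:: e]) (eq_pattern_le1 R [:: e]).
apply: eq_bmf => w; rewrite size_exponents//.
by rewrite -prod_sample_stat// big_seq1.
Qed.

Lemma sample_moments s : Ex Pr1 (fun w => \prod_(e <- s) f0 e w) =
                         Ex Pr2 (fun w => \prod_(e <- s) g0 e w).
Proof.
set k := stat_bound s; set m := exponents k s.
have mk : size m = k by exact: size_exponents.
have c1 := cvg_sample hP hJ (m := m) (eq_pattern_le1 R s).
have c2 := cvg_sample hQ hK (m := m) (eq_pattern_le1 R s).
rewrite !mk in c1 c2.
have e1 : Ex Pr1 (fun w => \prod_(e <- s) f0 e w) = Ex Pr1 (fun w =>
    eq_pattern R s (prefix_of (J ^~ w) k) * mon (cpath P w) m (prefix_of (J ^~ w) k)).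
  by apply: eq_Ex => w; exact: prod_sample_stat.
have e2 : Ex Pr2 (fun w => \prod_(e <- s) g0 e w) = Ex Pr2 (fun w =>
    eq_pattern R s (prefix_of (K ^~ w) k) * mon (cpath Q w) m (prefix_of (K ^~ w) k)).
  by apply: eq_Ex => w; exact: prod_sample_stat.
rewrite e1 e2; apply/eqP; rewrite -subr_eq0; apply/eqP.
have m0 : all (ltn 0) (map S m) by rewrite all_map; apply/allP.
have := same_dsums_pattern D (eq_pattern_fun R s) m0; rewrite size_map mk.
apply: cvg_unique => //; rewrite /=.
by apply: cvgB.
Qed.

Let bf0 := bmf_sample_stat P J.
Let bg0 := bmf_sample_stat Q K.
Let cpl := coupled Pr1 Pr2 f0 g0.

Let coupled_eq i l : cpl (fun w => (J i w == J l w)%:R) (fun w => (K i w == K l w)%:R).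
Proof. exact: (coupled_base _ _ f0 g0 (inl (i, l))). Qed.

Let coupled_new i : cpl (fun w => (J i w \notin prefix_of (J ^~ w) i)%:R)
                        (fun w => (K i w \notin prefix_of (K ^~ w) i)%:R).
Proof.
suff H : cpl (fun w => \prod_(l <- iota 0 i) (1 - (J i w == J l w)%:R))
             (fun w => \prod_(l <- iota 0 i) (1 - (K i w == K l w)%:R)).
  apply: eq_coupled H => w; first by rewrite -(notin_prefix_prod R (J ^~ w)).
  by rewrite -(notin_prefix_prod R (K ^~ w)).
elim: (iota 0 i) => [|l s IH].
  have := coupled_cst Pr1 Pr2 f0 g0 1.
  by apply: eq_coupled => w; rewrite big_nil.
have := coupledM (coupledB (coupled_cst Pr1 Pr2 f0 g0 1) (coupled_eq i l)) IH.
by apply: eq_coupled => w; rewrite big_cons.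
Qed.

Let coupled_ndist i : cpl (fun w => (ndist (J ^~ w) i)%:R) (fun w => (ndist (K ^~ w) i)%:R).
Proof.
have := coupled_sum (iota 0 i) xpredT coupled_new.
by apply: eq_coupled => w; rewrite ndist_sum.
Qed.

Let coupled_new_value k i : cpl (fun w => (new_value_at (J ^~ w) k i)%:R)
                                (fun w => (new_value_at (K ^~ w) k i)%:R).
Proof.
have c := coupled_ndist i.
have c1 := coupled_lt bf0 bg0 k.+1%:R c; have c2 := coupled_lt bf0 bg0 k%:R c.
have := coupledM (coupled_new i) (coupledB c1 c2).
by apply: eq_coupled => w; rewrite new_value_atE -eqn_lt -natrM mulnb.
Qed.

Lemma coupled_size_biased k :
  cpl (fun w => size_biased_term (cpath P w) (J ^~ w) k)
      (fun w => size_biased_term (cpath Q w) (K ^~ w) k).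
Proof.
pose X n w := \sum_(i <- iota 0 n) (new_value_at (J ^~ w) k i)%:R * cpath P w (J i w).
pose Y n w := \sum_(i <- iota 0 n) (new_value_at (K ^~ w) k i)%:R * cpath Q w (K i w).
have XY n : cpl (X n) (Y n).
  apply: coupled_sum => i; apply: coupledM; first exact: coupled_new_value.
  exact: (coupled_base _ _ f0 g0 (inr i)).
have bXY n := coupled_bmf bf0 bg0 (XY n).
have cX w : X ^~ w @ \oo --> size_biased_term (cpath P w) (J ^~ w) k by exact: size_biased_cvg.
have cY w : Y ^~ w @ \oo --> size_biased_term (cpath Q w) (K ^~ w) k by exact: size_biased_cvg.
have X1 w n : `|X n w| <= 1.
  have /andP[? ?] := @size_biased_partial_bd _ (cpath P w) (J ^~ w) k n (fun i => clip01 _).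
  by rewrite ger0_norm.
have Y1 w n : `|Y n w| <= 1.
  have /andP[? ?] := @size_biased_partial_bd _ (cpath Q w) (K ^~ w) k n (fun i => clip01 _).
  by rewrite ger0_norm.
have b1 d (T : measurableType d) (Z_ : nat -> T -> R) (Z : T -> R) :
    (forall n, bmf (Z_ n)) -> (forall w, Z_ ^~ w @ \oo --> Z w) ->
    (forall w n, `|Z_ n w| <= 1) -> bmf Z.
  move=> bZ_ cZ Z1; split.
    by apply: (measurable_fun_cvg (h := Z_)) => [n|w _]; [case: (bZ_ n)|exact: cZ].
  exists 1 => w; have cn : (fun n => `|Z_ n w| : R) @ \oo --> (`|Z w| : R) by exact: cvg_norm.
  rewrite -(cvg_lim _ cn)//; apply: limr_le; first by apply/cvg_ex; exists `|Z w|.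
  exact: nearW.
apply: (coupled_lim (M := 1) bf0 bg0 _ _ XY).
- by apply: b1 cX _ => [n|]//; case: (bXY n).
- by apply: b1 cY _ => [n|]//; case: (bXY n).
- exact: aeW.
- exact: aeW.
- exact: aeW.
- exact: aeW.
Qed.

Theorem size_biased_law :
  same_law Pr1 Pr2
    (fun w => (fun k => size_biased_term (cpath P w) (J ^~ w) k) : seqspace R)
    (fun w => (fun k => size_biased_term (cpath Q w) (K ^~ w) k) : seqspace R).
Proof.
apply: (coupled_seqspace bf0 bg0 sample_moments) => k.
exact: coupled_size_biased.
Qed.

End SampleLaw.

(** The sequence is coupled with itself, and [coupled_bmf] gives the measurability. *)
Lemma measurable_size_biased (R : realType) (d : measure_display)
    (T : measurableType d) (Pr : probability T R)
    (P : nat -> {RV Pr >-> R}) (J : nat -> {RV Pr >-> nat}) :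
  measurable_fun setT
    (fun w => (fun k => size_biased_term (cpath P w) (J ^~ w) k) : seqspace R).
Proof.
apply: measurable_to_seqspace => k.
by have [[]] := coupled_bmf (bmf_sample_stat P J) (bmf_sample_stat P J)
  (coupled_size_biased P J P J k).
Qed.

Lemma same_dsums_size_biased (R : realType) (d1 d2 : measure_display)
    (T1 : measurableType d1) (T2 : measurableType d2)
    (Pr1 : probability T1 R) (Pr2 : probability T2 R)
    (P : nat -> {RV Pr1 >-> R}) (Q : nat -> {RV Pr2 >-> R})
    (hP : random_discrete_distribution P) (hQ : random_discrete_distribution Q)
    (d3 d4 : measure_display) (T3 : measurableType d3) (T4 : measurableType d4)
    (Pr3 : probability T3 R) (Pr4 : probability T4 R)
    (SP : nat -> {RV Pr3 >-> R}) (SQ : nat -> {RV Pr4 >-> R}) :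
  same_dsums P Q -> is_size_biased P SP -> is_size_biased Q SQ -> same_law_seq SP SQ.
Proof.
move=> D [P' [J [PP' hJ SPE]]] [Q' [K [QQ' hK SQE]]].
have hP' := same_law_dist PP' hP; have hQ' := same_law_dist QQ' hQ.
have D' : same_dsums P' Q'.
  move=> b b0; apply: eq_cvgn (D b b0) => N.
  by rewrite (same_law_Edsum _ _ PP') (same_law_Edsum _ _ QQ').
have sb d (T : measurableType d) (Pr : probability T R) (X S : nat -> {RV Pr >-> R})
    (L : nat -> {RV Pr >-> nat}) : random_discrete_distribution X ->
    {ae Pr, forall w k, S k w = size_biased_term (X ^~ w) (L ^~ w) k} ->
    {ae Pr, forall w, (fun k => size_biased_term (cpath X w) (L ^~ w) k) = path_of S w}.
  move=> hX SE; move: SE (dist_ae hX); apply: filterS2 => w SE [_ cX].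
  by apply/funext => k; rewrite /path_of SE cX.
apply: (@same_law_ae _ _ _ _ _ _ (seqspace R) _ _ _ _ _ _ _ _ _ _
  (sb _ _ _ _ _ _ hP' SPE) (sb _ _ _ _ _ _ hQ' SQE)
  (size_biased_law hP' hQ' hJ hK D'));
  by [exact: measurable_path_of|exact: measurable_size_biased].
Qed.

(** * The random measure with atoms of mass P_j *)

Lemma mem_zip (A B : eqType) (t : seq A) (s : seq B) z :
  z \in zip t s -> z.1 \in t /\ z.2 \in s.
Proof.
elim: t s => [|x t IH] [|y s] //=; rewrite !inE => /predU1P[->|/IH[-> ->]].
  by rewrite !eqxx.
by rewrite !orbT.
Qed.

Section Cells.
Context (R : realType) (nu : set R -> R).
Implicit Types (s : seq (set R)) (t : seq nat).

Definition cell t s (v : nat) : set R :=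
  \big[setI/setT]_(z <- zip t s | z.1 == v) z.2.

(** The probability that V_(t_i) lies in s_i for every i, for independent V_j of law [nu]: equal
    indices intersect their sets, distinct ones multiply. *)
Definition cells_prob s t : R := \prod_(v <- undup t) nu (cell t s v).

Lemma cells_prob_pattern s : pattern_fun (cells_prob s).
Proof.
move=> f t finj; rewrite /cells_prob.
have -> : undup (map f t) = map f (undup t).
  elim: t finj => [//|x t IH] finj /=.
  have finj' : {in t &, injective f}.
    by move=> y z yt zt; apply: finj; rewrite inE ?yt ?zt orbT.
  have -> : (f x \in map f t) = (x \in t).
    apply/mapP/idP => [[y yt /finj] ->//|xt]; rewrite ?inE ?eqxx ?yt ?orbT//.
    by exists x.
  by case: ifP => _; rewrite IH.
rewrite big_map 2!big_seq; apply: eq_bigr => v; rewrite mem_undup => vt; congr nu.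
rewrite /cell.
have -> : zip (map f t) s = [seq (f z.1, z.2) | z <- zip t s].
  elim: t s {finj vt} => [|x t IH] [|B s] //=; by rewrite IH.
rewrite big_map big_seq_cond [RHS]big_seq_cond; apply: eq_bigl => z /=.
apply: andb_id2l => /mem_zip[z1t _].
by apply/eqP/eqP => [/finj ->//|->].
Qed.

End Cells.

(** * Moments of the random measure *)

Section RandomMeasure.
Context d (T : measurableType d) (R : realType) (Pr : probability T R)
  (P V : nat -> {RV Pr >-> R}).
Implicit Types (t : seq nat) (s : seq (set R)).

Definition atom_sum (N : nat) (B : set R) (w : T) : R :=
  \sum_(j <- iota 0 N) cpath P w j * \1_B (V j w).

Definition rand_meas (B : set R) (w : T) : R :=
  clip (fine (\sum_(0 <= j <oo) (cpath P w j * \1_B (V j w))%:E)).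

Lemma bmf_atom B j : measurable B -> bmf (fun w => cpath P w j * \1_B (V j w)).
Proof.
move=> mB; apply: bmfM; first exact: bmf_cpath.
have := bmf_indic R (measurable_funPTI (V j) mB); apply: eq_bmf => w.
by rewrite !indicE; congr (nat_of_bool _)%:R; apply/idP/idP; rewrite !inE.
Qed.

Lemma bmf_atom_sum B N : measurable B -> bmf (atom_sum N B).
Proof. by move=> mB; apply: bmf_sum => j; exact: bmf_atom. Qed.

Lemma atom_ge0 B j w : 0 <= cpath P w j * \1_B (V j w).
Proof. by rewrite mulr_ge0 ?cpath_ge0// indicE ler0n. Qed.

Lemma bmf_rand_meas B : measurable B -> bmf (rand_meas B).
Proof.
move=> mB; apply: bmf_clip; apply: measurableT_comp => //.
apply: ge0_emeasurable_sum => [j x _ _|j _]; first by rewrite lee_fin atom_ge0.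
by apply/measurable_EFinP; case: (bmf_atom j mB).
Qed.

Hypothesis hP : random_discrete_distribution P.

Lemma atom_sum01 B N w : dist_seq (P ^~ w) -> 0 <= atom_sum N B w <= 1.
Proof.
move=> dw; apply/andP; split; first by apply: sumr_ge0 => j _; exact: atom_ge0.
apply: le_trans (dist_psum1 N dw); apply: ler_sum => j _.
rewrite expr1 /cpath clip_id; last exact: (@dist_le1 _ (P ^~ w)).
by rewrite indicE ler_piMr ?lern1 ?leq_b1//; case: dw.
Qed.

Lemma atom_sum_cvg B w : dist_seq (P ^~ w) ->
  (fun N => atom_sum N B w) @ \oo --> rand_meas B w.
Proof.
move=> dw.
have nd : nondecreasing_seq (fun N => atom_sum N B w).
  apply/nondecreasing_seqP => N; rewrite /atom_sum -[N.+1]addn1 iotaD big_cat big_seq1.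
  by rewrite lerDl atom_ge0.
have cv : cvgn (fun N => atom_sum N B w).
  apply: nondecreasing_is_cvgn => //.
  by exists 1 => _ [N _ <-]; case/andP : (atom_sum01 B N dw).
have le1 : 0 <= limn (fun N => atom_sum N B w) <= 1.
  apply/andP; split; [apply: limr_ge|apply: limr_le] => //; apply: nearW => N;
  by case/andP : (atom_sum01 B N dw).
rewrite /rand_meas.
rewrite (_ : (\sum_(0 <= j <oo) _)%E = (limn (fun N => atom_sum N B w))%:E).
  by rewrite /= clip_id.
apply: cvg_lim => //; apply: cvg_trans (cvgr_EFin cv).
by apply: near_eq_cvg; apply: nearW => N; rewrite /= sumEFin /atom_sum /index_iota subn0.
Qed.

Variable nu : set R -> R.
Hypothesis Vnu : forall j (B : set R), measurable B -> Pr (V j @^-1` B) = (nu B)%:E.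
Hypothesis Vind : mutually_independent V.
Hypothesis PVind : independent_seqs P V.

Let ev (t : seq nat) (s : seq (set R)) : set T :=
  [set w | forall z : nat * set R, z \in zip t s -> z.2 (V z.1 w)].

Lemma measurable_cell t s v : (forall B : set R, B \in s -> measurable B) ->
  measurable (cell t s v).
Proof.
move=> ms; rewrite /cell big_seq_cond; apply: big_ind => //.
  exact: measurableI.
by move=> z /andP[/mem_zip[_ zs] _]; exact: ms.
Qed.

(** [mutually_independent] speaks of an initial segment of the variables: it is taken beyond all
    entries of [t], and an index absent from [t] contributes an empty intersection, of probability
    1. *)
Lemma prob_ev t s : (forall B : set R, B \in s -> measurable B) -> size t = size s ->
  Pr (ev t s) = (cells_prob nu s t)%:E.
Proof.
move=> ms ts; have [N tN] : exists N, forall v, v \in t -> (v < N)%N.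
  by exists (\max_(v <- t) v).+1 => v vt; rewrite ltnS; exact: leq_bigmax_seq.
have nuT : nu setT = 1.
  have := Vnu 0 measurableT; rewrite preimage_setT probability_setT => -[]//.
have := Vind (fun i : 'I_N => measurable_cell t i ms).
have -> : [set w | forall i : 'I_N, cell t s i (V i w)] = ev t s.
  apply/seteqP; split => w /= H.
    move=> z zt; have [z1 _] := mem_zip zt.
    have := H (Ordinal (tN _ z1)); rewrite /cell -bigcap_seq_cond /=; apply.
    by rewrite /= zt /=.
  move=> i; rewrite /cell -bigcap_seq_cond => z /= /andP[zt /eqP zi].
  by rewrite -zi; exact: H.
move=> ->; rewrite /cells_prob.
rewrite (eq_bigr (fun i : 'I_N => (nu (cell t s i))%:E)); last first.
  by move=> i _; rewrite Vnu//; exact: measurable_cell.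
rewrite prodEFin; congr _%:E.
rewrite -(big_mkord xpredT (fun i => nu (cell t s i))) /index_iota subn0.
rewrite (bigID (mem t)) /= [X in _ * X]big1 ?mulr1 => [|v vt]; last first.
  rewrite /cell big_seq_cond big_pred0 ?nuT// => z.
  apply/negP => /andP[/mem_zip[z1 _] /eqP zv].
  by move: vt; rewrite -zv z1.
rewrite -[LHS]big_filter; apply: perm_big; apply: uniq_perm.
- by rewrite filter_uniq// iota_uniq.
- exact: undup_uniq.
- move=> v; rewrite mem_filter mem_iota mem_undup /= add0n.
  by case: (boolP (v \in t)) => // /tN.
Qed.

Lemma measurable_ev t s : (forall B : set R, B \in s -> measurable B) ->
  measurable [set x : seqspace R | forall z : nat * set R, z \in zip t s -> z.2 (x z.1 : R)].
Proof.
move=> ms; have -> : [set x : seqspace R | forall z : nat * set R, z \in zip t s -> z.2 (x z.1 : R)] =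
    \big[setI/setT]_(z <- zip t s) ((fun x : seqspace R => x z.1 : R) @^-1` z.2).
  by rewrite -bigcap_seq.
rewrite big_seq; apply: big_ind => //; first exact: measurableI.
move=> z zt; apply: (measurable_preimageT (measurable_coord _)).
by apply: ms; case: (mem_zip zt).
Qed.

(** Independence of [P] and [V], in integrated form: the event on [V] is replaced by its
    probability. *)
Lemma Ex_atoms t s : (forall B : set R, B \in s -> measurable B) -> size t = size s ->
  Ex Pr (fun w => mon (cpath P w) (nseq (size s) 1%N) t * \1_(ev t s) w) =
  cells_prob nu s t * Ex Pr (fun w => mon (cpath P w) (nseq (size s) 1%N) t).
Proof.
move=> ms ts; have mp := measurable_path_of P; have mV := measurable_path_of V.
have mE : measurable (ev t s).
  exact: (measurable_preimageT mV (measurable_ev t ms)).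
rewrite -ExZ; last exact: bmf_mon.
transitivity (Ex Pr (fun w => mon (cpath P w) (nseq (size s) 1%N) t * cells_prob nu s t)).
  apply: (@transfer _ _ _ _ _ _ _ _ _ _ _ mp mp _ _ _ _ _
    (fun x : seqspace R => mon (fun j => clip (x j)) (nseq (size s) 1%N) t)).
  - exact: bmf_indic.
  - exact: bmf_cst.
  - move=> A mA; have mPA : measurable (path_of P @^-1` A).
      exact: (measurable_preimageT mp).
    rewrite ExZ; last exact: bmf_indic.
    have -> : (fun x => \1_(ev t s) x * \1_(path_of P @^-1` A) x) =
        \1_(path_of P @^-1` A `&` ev t s) :> (T -> R).
      by apply/funext => w; rewrite indicI mulrC.
    apply: EFin_inj; rewrite EFinM !Ex_indic//; last exact: measurableI.
    rewrite -prob_ev// muleC.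
    exact: (PVind mA (measurable_ev t ms)).
  - exact: bmf_mon_seq.
by apply: eq_Ex => w; rewrite mulrC.
Qed.

Lemma prod_atom_sum s N w : \prod_(B <- s) atom_sum N B w =
  \sum_(t <- alls N (size s)) mon (cpath P w) (nseq (size s) 1%N) t * \1_(ev t s) w.
Proof.
elim: s => [|B s IH].
  rewrite big_nil big_seq1 /mon big_nil mul1r indicE mem_set//=.
rewrite big_cons IH /= big_allpairs_dep big_distrl /=; apply: eq_bigr => j _.
rewrite big_distrr; apply: eq_bigr => t _ /=.
rewrite mon_cons expr1 mulrACA; congr (_ * _).
rewrite !indicE -natrM mulnb; congr (nat_of_bool _)%:R.
apply/andP/idP; rewrite !inE /=.
  by move=> [Bj H] z; rewrite inE => /predU1P[->//|]; exact: H.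
move=> H; split; first by apply: (H (j, B)); rewrite inE eqxx.
by move=> z zt; apply: H; rewrite inE zt orbT.
Qed.

(** The joint moment takes the shape required by [same_dsums_pattern], with [cells_prob] as weight
    and all exponents equal to 1. *)
Lemma cvg_rand_meas s : (forall B : set R, B \in s -> measurable B) ->
  (fun N => \sum_(t <- alls N (size s)) cells_prob nu s t *
     Ex Pr (fun w => mon (cpath P w) (nseq (size s) 1%N) t) : R) @ \oo -->
  Ex Pr (fun w => \prod_(B <- s) rand_meas B w).
Proof.
move=> ms.
have mE t : measurable (ev t s).
  have mV := measurable_path_of V.
  exact: (measurable_preimageT mV (measurable_ev t ms)).
have bp (F : set R -> T -> R) : (forall B, measurable B -> bmf (F B)) ->
    bmf (fun w => \prod_(B <- s) F B w).
  move=> bF; elim: s ms {mE} => [|B s IH] ms.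
    by apply: (eq_bmf _ (bmf_cst T 1)) => w; rewrite big_nil.
  have b1 := bF B (ms B (mem_head _ _)).
  apply: (eq_bmf _ (bmfM b1 (IH _))) => [w|]; first by rewrite big_cons.
  by move=> C Cs; apply: ms; rewrite inE Cs orbT.
apply: eq_cvgn (@Ex_cvg _ _ _ Pr (fun N w => \prod_(B <- s) atom_sum N B w) _ 1 _ _ _ _).
- move=> N; rewrite (eq_Ex _ (g := fun w => \sum_(t <- alls N (size s))
    mon (cpath P w) (nseq (size s) 1%N) t * \1_(ev t s) w)) => [|w]; last first.
    by rewrite prod_atom_sum.
  rewrite Ex_sum => [|t]; last by apply: bmfM; [exact: bmf_mon|exact: bmf_indic].
  rewrite 2!big_seq; apply: eq_bigr => t; rewrite mem_alls => /andP[/eqP ts _].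
  exact: Ex_atoms.
- by move=> N; apply: bp => B; exact: bmf_atom_sum.
- by apply: bp; exact: bmf_rand_meas.
- apply: filterS (dist_ae hP) => w [dw _]; elim: s {ms mE bp} => [|B s IH].
    by under eq_fun do rewrite big_nil; rewrite big_nil; exact: cvg_cst.
  by under eq_fun do rewrite big_cons; rewrite big_cons; apply: cvgM => //; exact: atom_sum_cvg.
- apply: filterS (dist_ae hP) => w [dw _] N; elim: s {ms mE bp} => [|B s IH].
    by rewrite big_nil normr1.
  have /andP[? ?] := atom_sum01 B N dw.
  by rewrite big_cons normrM mulr_ile1// ger0_norm.
Qed.

End RandomMeasure.

(** * Equality of the moments of two random measures *)

Section RandomMeasureLaw.
Context (R : realType) (d1 d2 : measure_display)
  (T1 : measurableType d1) (T2 : measurableType d2)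
  (Pr1 : probability T1 R) (Pr2 : probability T2 R)
  (P V : nat -> {RV Pr1 >-> R}) (Q U : nat -> {RV Pr2 >-> R})
  (hP : random_discrete_distribution P) (hQ : random_discrete_distribution Q)
  (nu : set R -> R)
  (Vnu : forall j (B : set R), measurable B -> Pr1 (V j @^-1` B) = (nu B)%:E)
  (Unu : forall j (B : set R), measurable B -> Pr2 (U j @^-1` B) = (nu B)%:E)
  (Vind : mutually_independent V) (Uind : mutually_independent U)
  (PVind : independent_seqs P V) (QUind : independent_seqs Q U)
  (D : same_dsums P Q).

Definition rand_meas_stat d (T : measurableType d) (Pr : probability T R)
  (X Y : nat -> {RV Pr >-> R}) (B : {B : set R | measurable B}) : T -> R :=
  rand_meas X Y (sval B).

Lemma bmf_rand_meas_stat d (T : measurableType d) (Pr : probability T R)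
  (X Y : nat -> {RV Pr >-> R}) B : bmf (rand_meas_stat X Y B).
Proof. by apply: bmf_rand_meas; exact: (svalP B). Qed.

Lemma rand_meas_moments s :
  Ex Pr1 (fun w => \prod_(B <- s) rand_meas_stat P V B w) =
  Ex Pr2 (fun w => \prod_(B <- s) rand_meas_stat Q U B w).
Proof.
have ms B : B \in map sval s -> measurable B.
  by elim: s => [//|[C mC] s IH] /=; rewrite inE => /predU1P[->|].
have c1 := cvg_rand_meas hP Vnu Vind PVind ms.
have c2 := cvg_rand_meas hQ Unu Uind QUind ms.
have E d (T : measurableType d) (Pr : probability T R) (X Y : nat -> {RV Pr >-> R}) :
    Ex Pr (fun w => \prod_(B <- s) rand_meas_stat X Y B w) =
    Ex Pr (fun w => \prod_(B <- map sval s) rand_meas X Y B w).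
  by apply: eq_Ex => w; rewrite big_map.
rewrite !E; apply/eqP; rewrite -subr_eq0; apply/eqP.
have m0 : all (ltn 0) (nseq (size (map sval s)) 1%N) by rewrite all_nseq orbT.
have := same_dsums_pattern D (cells_prob_pattern nu (map sval s)) m0.
rewrite size_nseq; apply: cvg_unique => //; rewrite /=.
exact: cvgB.
Qed.

End RandomMeasureLaw.

Lemma coupled_tuple (R : realType) (d1 d2 : measure_display)
    (T1 : measurableType d1) (T2 : measurableType d2)
    (Pr1 : probability T1 R) (Pr2 : probability T2 R)
    (I : Type) (f0 : I -> T1 -> R) (g0 : I -> T2 -> R)
    (bf0 : forall i, bmf (f0 i)) (bg0 : forall i, bmf (g0 i))
    (moments : forall s : seq I,
      Ex Pr1 (fun x => \prod_(i <- s) f0 i x) = Ex Pr2 (fun x => \prod_(i <- s) g0 i x))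
    n (X : T1 -> n.-tuple R) (Y : T2 -> n.-tuple R) :
  (forall i, coupled Pr1 Pr2 f0 g0 (fun w => tnth (X w) i) (fun w => tnth (Y w) i)) ->
  same_law Pr1 Pr2 X Y.
Proof.
move=> XY A mA; have bXY i := coupled_bmf bf0 bg0 (XY i).
pose G : set (set (n.-tuple R)) := \big[setU/set0]_(i < n)
  preimage_set_system setT (fun x : n.-tuple R => tnth x i) measurable.
suff [] : coupled Pr1 Pr2 f0 g0 \1_(X @^-1` A) \1_(Y @^-1` A) /\
  pushforward Pr1 X A = pushforward Pr2 Y A by [].
apply: (coupled_law bf0 bg0 moments (G := G)) => //.
- by apply/measurable_fun_tnthP => i; case: (bXY i) => -[].
- by apply/measurable_fun_tnthP => i; case: (bXY i) => _ [].
- move=> B; rewrite /G -bigcup_seq => -[i _ [C mC <-]]; rewrite setTI.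
  by case: (coupled_preimage bf0 bg0 moments (XY i) mC).
Qed.

Lemma rand_meas_series d (T : measurableType d) (R : realType) (Pr : probability T R)
    (P V : nat -> {RV Pr >-> R}) (B : set R) w : dist_seq (P ^~ w) ->
  series (fun j => P j w * \1_B (V j w) : R) @ \oo --> rand_meas P V B w.
Proof.
move=> dw; apply: eq_cvgn (atom_sum_cvg (V := V) (B := B) dw) => N.
rewrite /atom_sum /series /= /index_iota subn0; apply: eq_bigr => j _.
by rewrite /cpath clip_id//; exact: (@dist_le1 _ (P ^~ w)).
Qed.

(** * Laws of the random cdf and of the means *)

Section Consequences.
Context (R : realType) (d1 d2 : measure_display)
  (T1 : measurableType d1) (T2 : measurableType d2)
  (Pr1 : probability T1 R) (Pr2 : probability T2 R)
  (P : nat -> {RV Pr1 >-> R}) (Q : nat -> {RV Pr2 >-> R})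
  (hP : random_discrete_distribution P) (hQ : random_discrete_distribution Q)
  (D : same_dsums P Q)
  (d3 d4 : measure_display) (T3 : measurableType d3) (T4 : measurableType d4)
  (Pr3 : probability T3 R) (Pr4 : probability T4 R).

Let same_dsums_copies (P' : nat -> {RV Pr3 >-> R}) (Q' : nat -> {RV Pr4 >-> R}) :
  same_law_seq P' P -> same_law_seq Q' Q -> same_dsums P' Q'.
Proof.
move=> PP' QQ' b b0; apply: eq_cvgn (D b0) => N.
by rewrite (same_law_Edsum _ _ PP') (same_law_Edsum _ _ QQ').
Qed.

Lemma same_dsums_fdd (FP : R -> {RV Pr3 >-> R}) (FQ : R -> {RV Pr4 >-> R}) :
  is_random_cdf P FP -> is_random_cdf Q FQ -> same_fdd01 FP FQ.
Proof.
move=> [P' [V [PP' Vu Vi PVi FE]]] [Q' [U [QQ' Uu Ui QUi GE]]] n v v01.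
have hP' := same_law_dist PP' hP; have hQ' := same_law_dist QQ' hQ.
pose nu (B : set R) := fine (uniform_prob (@ltr01 R) B).
have law d (T : measurableType d) (Pr : probability T R) (W : nat -> {RV Pr >-> R}) :
    (forall j B, measurable B -> distribution Pr (W j) B = uniform_prob (@ltr01 R) B) ->
    forall j B, measurable B -> Pr (W j @^-1` B) = (nu B)%:E.
  move=> H j B mB; rewrite /nu -(H j)// fineK//.
  by rewrite fin_num_measure//; exact: measurable_funPTI.
have mom := rand_meas_moments hP' hQ' (law _ _ _ _ Vu) (law _ _ _ _ Uu) Vi Ui PVi QUi
  (same_dsums_copies PP' QQ').
pose B i : set R := `]-oo, tnth v i]%classic.
have mB i : measurable (B i) by exact: measurable_itv.
have sl : same_law Pr3 Pr4 (fun w => [tuple rand_meas P' V (B i) w | i < n])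
                           (fun w => [tuple rand_meas Q' U (B i) w | i < n]).
  apply: (coupled_tuple (@bmf_rand_meas_stat _ _ _ _ _ _) (@bmf_rand_meas_stat _ _ _ _ _ _) mom) => i.
  have := coupled_base Pr3 Pr4 (rand_meas_stat P' V) (rand_meas_stat Q' U) (exist _ _ (mB i)).
  by apply: eq_coupled => w; rewrite tnth_mktuple.
have ae d (T : measurableType d) (Pr : probability T R) (X W : nat -> {RV Pr >-> R})
    (F : R -> {RV Pr >-> R}) : random_discrete_distribution X ->
    (forall u, 0 <= u <= 1 -> {ae Pr, forall w,
            series (fun j => X j w * (W j w <= u)%R%:R) @ \oo --> F u w}) ->
    {ae Pr, forall w, [tuple rand_meas X W (B i) w | i < n] =
                      [tuple F (tnth v i) w | i < n]}.
  move=> hX FE'.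
  (* Each value of [F] is prescribed outside a null set that may depend on the time; only the
     finitely many times v_i matter. *)
  have : {ae Pr, forall w, forall i : nat, forall ni : (i < n)%N,
      rand_meas X W (B (Ordinal ni)) w = F (tnth v (Ordinal ni)) w}.
    apply: ae_foralln => i; have [ni|ni] := pselect (i < n)%N; last first.
      by apply: aeW => w ni'; case: (ni ni').
    move: (FE' _ (v01 (Ordinal ni))) (dist_ae hX); apply: filterS2 => w Fw [dw _] ni'.
    rewrite (bool_irrelevance ni' ni).
    apply: cvg_unique Fw => //=.
    apply: eq_cvgn (rand_meas_series (V := W) (B := B (Ordinal ni)) dw) => N.
    apply: eq_bigr => j _; congr (_ * _); rewrite indicE; congr (nat_of_bool _)%:R.
    by apply/idP/idP; rewrite inE /B /= in_itv.
  apply: filterS => w H; apply/eq_from_tnth => i; rewrite !tnth_mktuple.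
  by have := H i (ltn_ord i); rewrite (_ : Ordinal _ = i)//; exact: val_inj.
apply: (@same_law_ae _ _ _ _ _ _ _ _ _ _ _ _ _ _ _ _ _ (ae _ _ _ _ _ _ hP' FE) (ae _ _ _ _ _ _ hQ' GE) sl).
all: apply/measurable_fun_tnthP => i.
- have [m _] := bmf_rand_meas P' V (mB i).
  by apply: eq_measurable_fun m => w _ /=; rewrite tnth_mktuple.
- apply: eq_measurable_fun (measurable_funPT (FP (tnth v i))) => w _ /=.
  by rewrite tnth_mktuple.
- have [m _] := bmf_rand_meas Q' U (mB i).
  by apply: eq_measurable_fun m => w _ /=; rewrite tnth_mktuple.
- apply: eq_measurable_fun (measurable_funPT (FQ (tnth v i))) => w _ /=.
  by rewrite tnth_mktuple.
Qed.

(** The mean of a simple variable is the combination, over its values [a], of [a] times the random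
    measure of the singleton of [a]. *)
Lemma same_dsums_mean (dX : measure_display) (TX : measurableType dX)
    (PrX : probability TX R) (X : {RV PrX >-> R})
    (MP : {RV Pr3 >-> R}) (MQ : {RV Pr4 >-> R}) :
  finite_set (range X) -> is_mean P X MP -> is_mean Q X MQ -> same_law Pr3 Pr4 MP MQ.
Proof.
move=> /finite_seqP[s sX] [P' [V [PP' Vu Vi PVi FE]]] [Q' [U [QQ' Uu Ui QUi GE]]].
have hP' := same_law_dist PP' hP; have hQ' := same_law_dist QQ' hQ.
pose nu (B : set R) := fine (PrX (X @^-1` B)).
have law d (T : measurableType d) (Pr : probability T R) (W : nat -> {RV Pr >-> R}) :
    (forall j, same_law Pr PrX (W j) X) ->
    forall j B, measurable B -> Pr (W j @^-1` B) = (nu B)%:E.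
  move=> H j B mB; rewrite /nu fineK; first exact: H.
  by rewrite fin_num_measure//; exact: measurable_funPTI.
have mom := rand_meas_moments hP' hQ' (law _ _ _ _ Vu) (law _ _ _ _ Uu) Vi Ui PVi QUi
  (same_dsums_copies PP' QQ').
have mB (a : R) : measurable [set a] by exact: measurable_set1.
pose r := undup s.
pose M d (T : measurableType d) (Pr : probability T R) (X' W : nat -> {RV Pr >-> R}) w :=
  \sum_(a <- r) a * rand_meas X' W [set a] w.
have cM : coupled Pr3 Pr4 (rand_meas_stat P' V) (rand_meas_stat Q' U) (M _ _ _ P' V) (M _ _ _ Q' U).
  apply: coupled_sum => a; apply: coupledZ.
  exact: (coupled_base _ _ _ _ (exist _ _ (mB a))).
have bP := @bmf_rand_meas_stat _ _ _ _ P' V; have bQ := @bmf_rand_meas_stat _ _ _ _ Q' U.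
have [[mM _] [mM' _]] := coupled_bmf bP bQ cM.
have sl : same_law Pr3 Pr4 (M _ _ _ P' V) (M _ _ _ Q' U).
  by move=> A mA; case: (coupled_preimage bP bQ mom cM mA).
have ae d (T : measurableType d) (Pr : probability T R) (X' W : nat -> {RV Pr >-> R})
    (F : {RV Pr >-> R}) : random_discrete_distribution X' ->
    (forall j, same_law Pr PrX (W j) X) ->
    {ae Pr, forall w, series (fun j => W j w * X' j w) @ \oo --> F w} ->
    {ae Pr, forall w, M _ _ _ X' W w = F w}.
  move=> hX' WX FE'.
  have mS : measurable [set` s] by apply: countable_measurable => //; exact/finite_set_countable/finite_seq.
  (* The copies of [X] agree with it in law only, so they take their values in [s] almost surely. *)
  have Ws : {ae Pr, forall w, forall j, W j w \in s}.
    apply: ae_foralln => j.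
    have mW : measurable (W j @^-1` [set` s]) by exact: measurable_funPTI.
    have p1 : Pr (W j @^-1` [set` s]) = 1%E.
      have := WX j _ mS; rewrite /pushforward => ->.
      rewrite (_ : X @^-1` [set` s] = setT) ?probability_setT//.
      by rewrite -sX; apply/seteqP; split => x // _; exists x.
    have p0 : Pr (~` (W j @^-1` [set` s])) = 0%E by rewrite probability_setC// p1 subee.
    by apply/negligibleP => //; exact: measurableC.
  move: (dist_ae hX') Ws FE'; apply: filterS3 => w [dw cw] Wws Fw.
  apply: cvg_unique Fw => //=.
  have cM' : (fun N => \sum_(a <- r) a * atom_sum X' W N [set a] w : R) @ \oo --> M _ _ _ X' W w.
    rewrite /M; move: (r) => r'; elim: r' => [|a r' IH].
      by under eq_fun do rewrite big_nil; rewrite big_nil; exact: cvg_cst.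
    under eq_fun do rewrite big_cons; rewrite big_cons.
    by apply: cvgD => //; apply: cvgMr; exact: atom_sum_cvg.
  apply: eq_cvgn cM' => N; rewrite /series /= /atom_sum.
  under eq_bigr do rewrite big_distrr.
  rewrite exchange_big /index_iota subn0; apply: eq_bigr => j _ /=.
  rewrite (bigD1_seq (W j w)) ?undup_uniq ?mem_undup ?Wws//= big1 ?addr0 => [|a aW].
    by rewrite indicE mem_set// mulr1 cw.
  by rewrite indicE memNset ?mulr0//= => Wa; rewrite Wa eqxx in aW.
exact: (same_law_ae mM _ mM' _ (ae _ _ _ _ _ _ hP' Vu FE) (ae _ _ _ _ _ _ hQ' Uu GE) sl).
Qed.

End Consequences.

(** * Ranking *)

Section Ranking.
Context (R : realType).
Implicit Types (p q : nat -> R).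

(** All that ranking needs of a probability sequence. Unlike [dist_seq], it is inherited by the
    size-biased sequence without a computation of its sum. *)
Definition vanishing p :=
  (forall j, 0 <= p j <= 1) /\ forall x, 0 < x -> exists N, forall i, (N <= i)%N -> p i < x.

Lemma dist_vanishing p : dist_seq p -> vanishing p.
Proof.
move=> dp; split => [j|x x0]; first exact: dist_le1.
have [_ sp] := dp; have p0 : p @ \oo --> (0 : R).
  by apply: cvg_series_cvg_0; apply/cvg_ex; exists 1.
have [N _ HN] : \forall i \near \oo, p i < x by exact: cvgr_lt p0 _ x0.
by exists N => i Ni; exact: HN.
Qed.

Definition before p i j : bool := (p j < p i) || ((p i == p j) && (i < j)%N).

Definition nbefore p j N : nat := size [seq i <- iota 0 N | before p i j].

(* When [p] tends to 0, [nbefore p j N] is eventually constant in [N] for every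
   [j] with [0 < p j]. *)
Definition has_rank p j k :=
  0 < p j /\ exists N0, forall N, (N0 <= N)%N -> nbefore p j N = k.

Lemma before_trans p : transitive (before p).
Proof.
move=> j i k /orP[ji|/andP[/eqP e ij]] /orP[kj|/andP[/eqP e' jk]]; rewrite /before.
- by rewrite (lt_trans kj ji).
- by rewrite -e' ji.
- by rewrite e kj.
- by rewrite e e' eqxx (ltn_trans ij jk) orbT.
Qed.

Lemma before_irr p j : before p j j = false.
Proof. by rewrite /before ltxx ltnn andbF. Qed.

Lemma before_total p i j : i != j -> before p i j || before p j i.
Proof.
rewrite /before; case: (ltgtP (p i) (p j)) => //= _.
by rewrite neq_ltn => /orP[] ->; rewrite ?orbT.
Qed.

Lemma before_le p i j : before p i j -> p j <= p i.
Proof. by move=> /orP[/ltW//|/andP[/eqP -> _]]. Qed.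

Lemma nbefore_stable p j N0 N : (forall i, (N0 <= i)%N -> p i < p j) -> (N0 <= N)%N ->
  nbefore p j N = nbefore p j N0.
Proof.
move=> pj /subnKC <-; rewrite /nbefore iotaD filter_cat size_cat add0n.
rewrite [X in (_ + size X)%N](_ : _ = [::]) ?addn0//.
rewrite -(filter_pred0 (iota N0 (N - N0))); apply: eq_in_filter => i.
rewrite mem_iota => /andP[/pj pij _]; apply/negbTE.
by rewrite /before negb_or -leNgt (ltW pij) negb_and lt_eqF.
Qed.

Lemma has_rankP p j N0 k : 0 < p j -> (forall i, (N0 <= i)%N -> p i < p j) ->
  has_rank p j k <-> nbefore p j N0 = k.
Proof.
move=> pj0 pj; split=> [[_ [N1 HN1]]|<-].
  rewrite -(nbefore_stable (N := maxn N0 N1) pj) ?leq_maxl//.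
  by apply: HN1; exact: leq_maxr.
by split => //; exists N0 => N NN; exact: nbefore_stable.
Qed.

Lemma has_rank_uniq p j k k' : has_rank p j k -> has_rank p j k' -> k = k'.
Proof.
move=> [_ [N HN]] [_ [N' HN']]; rewrite -(HN (maxn N N')) ?leq_maxl//.
by apply: HN'; exact: leq_maxr.
Qed.

Lemma has_rank_ex p j : vanishing p -> 0 < p j -> exists k, has_rank p j k.
Proof.
move=> [_ vp] pj0; have [N HN] := vp _ pj0.
by exists (nbefore p j N); apply/(has_rankP _ pj0 HN).
Qed.

Lemma nbefore_lt p i j N : (i < N)%N -> before p i j -> (nbefore p i N < nbefore p j N)%N.
Proof.
move=> iN ij; rewrite /nbefore -/(size (i :: [seq l <- iota 0 N | before p l i])).
apply: uniq_leq_size => [|l]; first by rewrite /= mem_filter before_irr filter_uniq// iota_uniq.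
rewrite inE !mem_filter => /predU1P[->|/andP[li ->]]; first by rewrite ij mem_iota.
by rewrite (before_trans li ij).
Qed.

Lemma has_rank_inj p j j' k : has_rank p j k -> has_rank p j' k -> j = j'.
Proof.
move=> [_ [N HN]] [_ [N' HN']]; apply/eqP/negPn/negP => jj'.
pose M := maxn (maxn N N') (maxn j j').+1.
have [NM N'M] : (N <= M)%N /\ (N' <= M)%N.
  by split; rewrite /M !leq_max leqnn ?orbT.
have [jM j'M] : (j < M)%N /\ (j' < M)%N.
  by split; rewrite /M leq_max; apply/orP; right; rewrite ltnS ?leq_maxl ?leq_maxr.
have /orP[b|b] := before_total p jj'.
  by have := nbefore_lt jM b; rewrite HN// HN'// ltnn.
by have := nbefore_lt j'M b; rewrite HN// HN'// ltnn.
Qed.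

(* The ranks of the elements ranked before [j] are distinct and less than
   that of [j], hence fill all the available values. *)
Lemma has_rank_pred p j k : vanishing p -> has_rank p j k.+1 ->
  exists2 i, has_rank p i k & p j <= p i.
Proof.
move=> [_ vp] rj; have [pj0 _] := rj; have [N HN] := vp _ pj0.
have := (has_rankP _ pj0 HN).1 rj; set A := [seq i <- iota 0 N | before p i j] => sA.
have AP i : i \in A -> [/\ (i < N)%N, before p i j, 0 < p i & forall l, (N <= l)%N -> p l < p i].
  rewrite mem_filter mem_iota add0n => /andP[ij /= iN].
  have pji := before_le ij; split => //; first exact: lt_le_trans pji.
  by move=> l /HN pl; exact: lt_le_trans pji.
have uA : uniq A by rewrite filter_uniq// iota_uniq.
pose B := [seq nbefore p i N | i <- A].
have uB : uniq B.
  rewrite map_inj_in_uniq// => i i' iA i'A e.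
  have [_ _ pi0 Hi] := AP _ iA; have [_ _ pi0' Hi'] := AP _ i'A.
  apply: (@has_rank_inj p i i' (nbefore p i N)); first exact/(has_rankP _ pi0 Hi).
  exact/(has_rankP _ pi0' Hi').
have BI : {subset B <= iota 0 k.+1}.
  move=> _ /mapP[i iA ->]; rewrite mem_iota add0n /=.
  have [iN ij _ _] := AP _ iA; exact: leq_trans (nbefore_lt iN ij) (eq_leq sA).
have [|_ BE] := uniq_min_size uB BI; first by rewrite size_map size_iota; exact: eq_leq (esym sA).
have : k \in B by rewrite BE mem_iota add0n /= ltnSn.
move=> /mapP[i iA kE]; have [_ ij pi0 Hi] := AP _ iA.
by exists i; [exact/(has_rankP _ pi0 Hi)|exact: before_le].
Qed.

(** A series with at most one nonzero term instead of a chosen index of rank [k], so as to be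
    measurable in [p]. *)
Definition ranked k p : R :=
  clip (fine (\sum_(0 <= j <oo) (clip (p j) * `[< has_rank p j k >]%:R)%:E)).

Lemma ranked_some p j k : 0 <= p j <= 1 -> has_rank p j k -> ranked k p = p j.
Proof.
move=> pj rj; rewrite /ranked.
rewrite (@nneseriesD1 _ _ j xpredT) => //=; last first.
  by move=> i _; rewrite lee_fin mulr_ge0//; case/andP : (clip01 (p i)).
rewrite eseries0 ?adde0 => [|i _ ij]; last first.
  rewrite asboolF ?mulr0// => ri.
  by rewrite (has_rank_inj ri rj) eqxx in ij.
by rewrite asboolT//= mulr1 !clip_id// clip_id.
Qed.

Lemma ranked_none p k : ~ (exists j, has_rank p j k) -> ranked k p = 0.
Proof.
move=> nr; rewrite /ranked eseries0 => [|j _ _]; first by rewrite /= clip_id// lexx ler01.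
by rewrite asboolF ?mulr0// => rj; apply: nr; exists j.
Qed.

Definition rank_of p j : nat := xget 0%N [set k | has_rank p j k].

Lemma rank_ofP p j : vanishing p -> 0 < p j -> has_rank p j (rank_of p j).
Proof.
move=> vp pj; rewrite /rank_of; case: xgetP => [k -> //|/(_ _)].
by have [k rk] := has_rank_ex vp pj; move=> /(_ k).
Qed.

(** Stated for any set of positive values: singletons give the multiplicities in [is_ranking], and
    the positive half-line gives the reindexing of power sums. *)
Lemma rank_of_bij p (A : set R) : vanishing p -> (forall x, A x -> 0 < x) ->
  set_bij [set j | A (p j)] [set k | A (ranked k p)] (rank_of p).
Proof.
move=> vp A0; have p01 := vp.1; split.
- move=> j Aj; have rj := rank_ofP vp (A0 _ Aj).
  by rewrite /= (ranked_some (p01 j) rj).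
- move=> j j'; rewrite !inE => Aj Aj' e.
  have rj := rank_ofP vp (A0 _ Aj); have rj' := rank_ofP vp (A0 _ Aj').
  by rewrite e in rj; exact: has_rank_inj rj rj'.
- move=> k /= Ak; have [[j rj]|nr] := pselect (exists j, has_rank p j k); last first.
    by have := A0 _ Ak; rewrite (ranked_none nr) ltxx.
  have [pj _] := rj; rewrite (ranked_some (p01 j) rj) in Ak.
  exists j => //; apply: has_rank_uniq rj; exact: rank_ofP.
Qed.

Lemma ranked01 k p : 0 <= ranked k p <= 1. Proof. exact: clip01. Qed.

Lemma is_ranking_ranked p : vanishing p -> is_ranking p (fun k => ranked k p).
Proof.
move=> vp; have p01 := vp.1; split.
- by move=> k; case/andP : (ranked01 k p).
- move=> k; have [[j rj]|nr] := pselect (exists j, has_rank p j k.+1); last first.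
    by rewrite (ranked_none nr); case/andP : (ranked01 k p).
  have [i ri pji] := has_rank_pred vp rj.
  by rewrite (ranked_some (p01 j) rj) (ranked_some (p01 i) ri).
- move=> x x0; rewrite card_eq_sym; apply/card_set_bijP; exists (rank_of p).
  by apply: (rank_of_bij vp (A := [set x])) => y ->.
Qed.

(** Suppose u_k < v_k at the first disagreement. By monotonicity [u] takes the value v_k only before
    [k], where the two sequences agree, so [v] takes this value at least once more than [u], namely
    at [k]. *)
Lemma ranking_unique p q q' : is_ranking p q -> is_ranking p q' -> q = q'.
Proof.
move=> [q0 qd qc] [q0' qd' qc'].
have mono (u : nat -> R) : (forall k, u k.+1 <= u k) -> forall k l, (k <= l)%N -> u l <= u k.
  by move=> ud k l /subnK <-; elim: (l - k)%N => [//|n IH]; rewrite addSn (le_trans (ud _)).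
have main (u v : nat -> R) k : (forall k, 0 <= u k) -> (forall k, u k.+1 <= u k) ->
    (forall x, 0 < x -> ([set j | u j = x] #= [set j | v j = x])%card) ->
    (forall i, (i < k)%N -> u i = v i) -> v k <= u k.
  move=> u0 ud uv uvk; rewrite leNgt; apply/negP => uvk'.
  have x0 : 0 < v k by exact: le_lt_trans uvk'.
  have uk i : u i = v k -> (i < k)%N.
    move=> ui; rewrite ltnNge; apply/negP => ki.
    by have := mono u ud _ _ ki; rewrite ui leNgt uvk'.
  have /finite_fsetP[X XE] : finite_set [set j | u j = v k].
    by apply: (sub_finite_set _ (finite_II k)) => i /= /uk.
  have := uv _ x0; rewrite XE => XV.
  have /finite_fsetP[Y YE] : finite_set [set j | v j = v k].
    by rewrite -(eq_finite_set XV); exact: finite_fset.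
  have iX i : (i \in X) = (u i == v k).
    by apply/idP/eqP => [iX|ui]; [have : [set` X] i by []|suff : [set` X] i by []]; rewrite -XE.
  have iY i : (i \in Y) = (v i == v k).
    by apply/idP/eqP => [iY|ui]; [have : [set` Y] i by []|suff : [set` Y] i by []]; rewrite -YE.
  have : #|` X| = #|` Y|.
    apply/card_eq_fsetP; apply: card_eq_trans XV _; rewrite YE.
    exact/card_eq_fsetP.
  apply/eqP; rewrite ltn_eqF//; apply: fproper_ltn_card.
  rewrite fproperE; apply/andP; split.
    apply/fsubsetP => i; rewrite iX iY => /eqP ui; by rewrite -(uvk _ (uk _ ui)) ui.
  by apply/negP => /fsubsetP/(_ k); rewrite iX iY eqxx lt_eqF// => /(_ isT).
apply/funext => k; have [n] := ubnP k; elim: n k => // n IH k; rewrite ltnS => kn.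
have qq i : (i < k)%N -> q i = q' i by move=> ik; apply: IH; exact: leq_trans kn.
apply/eqP; rewrite eq_le; apply/andP; split; apply: main => //.
- by move=> x x0; apply: card_eq_trans (qc' x x0) _; rewrite card_eq_sym; exact: qc.
- by move=> i /qq.
- by move=> x x0; apply: card_eq_trans (qc x x0) _; rewrite card_eq_sym; exact: qc'.
Qed.

(** Zero terms drop out because [n] is positive, and [rank_of] reindexes the others. *)
Lemma esum_ranked p n : vanishing p -> (0 < n)%N ->
  (\sum_(0 <= k <oo) (ranked k p ^+ n)%:E = \sum_(0 <= j <oo) (p j ^+ n)%:E)%E.
Proof.
move=> vp n0; have p01 := vp.1.
have E (u : nat -> R) : (forall i, 0 <= u i) ->
    (\sum_(0 <= j <oo) (u j ^+ n)%:E = \esum_(j in [set j | (0 < u j)%R]) (u j ^+ n)%:E)%E.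
  move=> u0; rewrite nneseries_esumT => [|j]; last by rewrite lee_fin exprn_ge0.
  rewrite [RHS]esum_mkcond; apply: eq_esum => j _; case: ifPn => //.
  rewrite notin_setE /= => /negP; rewrite -leNgt => uj.
  have -> : u j = 0 by apply/eqP; rewrite eq_le uj u0.
  by rewrite expr0n gtn_eqF.
rewrite !E; [|by move=> i; case/andP : (p01 i)|by move=> k; case/andP : (ranked01 k p)].
rewrite (@reindex_esum _ _ _ _ _ _ _ (rank_of_bij (A := [set x | 0 < x]) vp _))//.
apply: eq_esum => j pj; rewrite (ranked_some (p01 j))//.
exact: rank_ofP.
Qed.

Lemma powersum_ranked p n : dist_seq p -> (0 < n)%N ->
  powersum n (fun k => ranked k p) = powersum n p.
Proof.
move=> dp n0; rewrite /powersum; congr (clip (fine _)).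
under eq_eseriesr do rewrite clip_id ?ranked01//.
rewrite esum_ranked//; last exact: dist_vanishing.
by apply: eq_eseriesr => j _; rewrite clip_id//; exact: dist_le1.
Qed.

Lemma measurable_ranked k : measurable_fun setT (fun x : seqspace R => ranked k x).
Proof.
have mb i j : measurable_fun setT (fun x : seqspace R => before x i j).
  apply: measurable_or; first by apply: measurable_fun_ltr; exact: measurable_coord.
  apply: measurable_and; last exact: measurable_cst.
  by apply: measurable_fun_eqr; exact: measurable_coord.
have mn j N : measurable_fun setT (fun x : seqspace R => nbefore x j N).
  rewrite /nbefore; elim: (iota 0 N) => [|i s IH]; first exact: measurable_cst.
  rewrite (_ : (fun x => _) = (fun x : seqspace R => if before x i j
     then (size [seq i <- s | before x i j]).+1 else size [seq i <- s | before x i j])).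
    apply: (measurable_fun_ifT (mb i j) _ IH).
    exact: (@measurable_fun_addn _ _ setT (fun=> 1%N) _ (measurable_cst _) IH).
  by apply/funext => x /=; case: ifP.
apply: (measurableT_comp (@measurable_clip R)); apply: measurableT_comp => //.
apply: ge0_emeasurable_sum => [j x _ _|j _].
  by rewrite lee_fin mulr_ge0//; case/andP : (clip01 (x j : R)).
apply/measurable_EFinP; apply: measurable_funM; first exact: measurable_clip_coord.
have mset : measurable [set x : seqspace R | has_rank x j k].
  rewrite (_ : [set x | _] = (fun x : seqspace R => x j : R) @^-1` `]0, +oo[%classic `&`
      \bigcup_N0 \bigcap_(N in [set N | (N0 <= N)%N])
        (fun x : seqspace R => nbefore x j N) @^-1` [set k]).
    apply: measurableI.
      exact: (measurable_preimageT (measurable_coord _)).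
    apply: bigcupT_measurable => N0; apply: bigcap_measurable => [|N _].
      by exists N0; exact: leqnn.
    exact: (measurable_preimageT (mn _ _)).
  apply/seteqP; split => x /=.
    move=> [xj [N0 HN]]; split; first by rewrite in_itv /= xj.
    by exists N0 => // N /HN.
  rewrite in_itv /= andbT => -[xj [N0 _ HN]]; split => //.
  by exists N0 => N /HN.
have [+ _] := bmf_indic R mset; congr (measurable_fun _ _).
Qed.

End Ranking.

(** * The ranking recovered from the size-biased sequence *)

Section Rearrangement.
Context (R : realType) (p : nat -> R) (j : nat -> nat).
Hypothesis vp : vanishing p.
Hypothesis hit : forall v, 0 < p v -> exists i, j i = v.

Let S k := size_biased_term p j k.

Lemma size_biased_some k i : new_value_at j k i -> S k = p (j i).
Proof.
move=> ki; rewrite /S /size_biased_term; case: pselect => [h|[]]; last by exists i.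
by case: ex_minnP => i' ki' _; rewrite (new_value_at_inj ki' ki).
Qed.

Lemma size_biased_none k : ~ (exists i, new_value_at j k i) -> S k = 0.
Proof. by move=> nk; rewrite /S /size_biased_term; case: pselect. Qed.

Lemma first_occurrence v : (exists i, j i = v) ->
  exists i, j i = v /\ j i \notin prefix_of j i.
Proof.
move=> [i0 ji0]; have ex : exists i, j i == v by exists i0; apply/eqP.
case: (ex_minnP ex) => i /eqP ji mini; exists i; split => //.
apply/mapP => -[l]; rewrite mem_iota add0n /= => li jl.
by have := mini l; rewrite -jl ji eqxx leqNgt li => /(_ isT).
Qed.

(** An index [v] is sent to the number of distinct values drawn before its first occurrence, at draw
    [g v]. Surjectivity holds because a draw that shows a new value is the first occurrence of that
    value. *)
Lemma size_biased_bij (A : set R) : (forall x, A x -> 0 < x) ->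
  exists f, set_bij [set v | A (p v)] [set k | A (S k)] f.
Proof.
move=> A0; have /choice[g gP] : forall v, exists i, 0 < p v ->
    j i = v /\ j i \notin prefix_of j i.
  move=> v; have [pv|pv] := pselect (0 < p v); last by exists 0%N.
  by have [i iP] := first_occurrence (hit pv); exists i.
have gN v : A (p v) -> new_value_at j (ndist j (g v)) (g v).
  by move=> /A0/gP[_ jg]; rewrite new_value_atE jg eqxx.
exists (fun v => ndist j (g v)); split.
- move=> v /= Av; rewrite (size_biased_some (gN v Av)).
  by have [-> _] := gP v (A0 _ Av).
- move=> v v'; rewrite !inE => Av Av' e.
  have := gN v Av; rewrite e => /(new_value_at_inj (gN v' Av')) e'.
  by have [<- _] := gP v (A0 _ Av); have [<- _] := gP v' (A0 _ Av'); rewrite e'.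
- move=> k /= Ak; have [[i ki]|nk] := pselect (exists i, new_value_at j k i); last first.
    by have := A0 _ Ak; rewrite (size_biased_none nk) ltxx.
  rewrite (size_biased_some ki) in Ak; exists (j i) => //.
  have [jg ng] := gP _ (A0 _ Ak).
  have -> : g (j i) = i.
    move: (ki); rewrite new_value_atE => /andP[ni _].
    have [lt|lt|//] := ltngtP (g (j i)) i.
      by case/mapP : ni; exists (g (j i)); rewrite ?mem_iota.
    by case/mapP : ng; exists i; rewrite ?mem_iota.
  by move: ki; rewrite new_value_atE => /andP[_ /eqP].
Qed.

Lemma size_biased_card x : 0 < x -> ([set k | S k = x] #= [set v | p v = x])%card.
Proof.
move=> x0; rewrite card_eq_sym; apply/card_set_bijP.
by apply: (size_biased_bij (A := [set x])) => y ->.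
Qed.

(** The terms that are at least [x] are in bijection with those of [p], which are finite in
    number. *)
Lemma size_biased_vanishing : vanishing S.
Proof.
split=> [k|x x0].
  have [[i ki]|nk] := pselect (exists i, new_value_at j k i).
    by rewrite (size_biased_some ki); exact: vp.1.
  by rewrite (size_biased_none nk) lexx ler01.
have [N HN] := vp.2 x x0.
have c : ([set v | x <= p v] #= [set k | x <= S k])%card.
  apply/card_set_bijP; apply: (size_biased_bij (A := [set y | x <= y])) => y.
  exact: lt_le_trans.
have : finite_set [set k | x <= S k].
  rewrite -(eq_finite_set c); apply: (sub_finite_set _ (finite_II N)) => v /= xv.
  by rewrite ltnNge; apply/negP => /HN; rewrite ltNge xv.
move=> /finite_seqP[s sE]; exists (\max_(k <- s) k).+1 => k; rewrite ltnNge.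
apply: contraNlt => xk; have : [set k | x <= S k] k by [].
by rewrite sE => ks; exact: leq_bigmax_seq.
Qed.

Lemma ranked_size_biased q : is_ranking p q -> q = (fun k => ranked k S).
Proof.
move=> pq; apply: (ranking_unique pq).
have [S0 Sd Sc] := is_ranking_ranked size_biased_vanishing; split => // x x0.
by apply: card_eq_trans (Sc x x0) _; exact: size_biased_card.
Qed.

End Rearrangement.

(** * Independent uniform variables on the unit interval *)

Section ProductSpace.
Context (R : realType) (d1 d2 : measure_display)
  (T1 : measurableType d1) (T2 : measurableType d2)
  (Pr1 : probability T1 R) (Pr2 : probability T2 R).

Local Notation Pr12 := (Pr1 \x Pr2 : probability (T1 * T2)%type R)%E.

Lemma prod_rect A B : measurable A -> measurable B ->
  Pr12 (fst @^-1` A `&` snd @^-1` B) = (Pr1 A * Pr2 B)%E.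
Proof. by move=> mA mB; rewrite -product_measure1E//; congr (_ _); apply/seteqP; split. Qed.

Lemma prod_fst A : measurable A -> Pr12 (fst @^-1` A) = Pr1 A.
Proof.
move=> mA; have := prod_rect mA measurableT.
by rewrite preimage_setT setIT probability_setT mule1.
Qed.

Lemma prod_snd B : measurable B -> Pr12 (snd @^-1` B) = Pr2 B.
Proof.
move=> mB; have := prod_rect measurableT mB.
by rewrite preimage_setT setTI probability_setT mul1e.
Qed.

Lemma bmf_fst (f : T1 -> R) : bmf f -> bmf (fun z : T1 * T2 => f z.1).
Proof.
move=> [mf [M fM]]; split; last by exists M => z; exact: fM.
exact: (measurableT_comp mf measurable_fst).
Qed.

Lemma bmf_snd (f : T2 -> R) : bmf f -> bmf (fun z : T1 * T2 => f z.2).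
Proof.
move=> [mf [M fM]]; split; last by exists M => z; exact: fM.
exact: (measurableT_comp mf measurable_snd).
Qed.

(** [transfer] applied to one coordinate and then to the other, starting from rectangles. *)
Lemma Ex_prod (f : T1 -> R) (g : T2 -> R) : bmf f -> bmf g ->
  Ex Pr12 (fun z => f z.1 * g z.2) = Ex Pr1 f * Ex Pr2 g.
Proof.
move=> bf bg.
have ind A : measurable A -> Ex Pr12 (fun z => \1_A z.1 * g z.2) = Ex Pr1 \1_A * Ex Pr2 g.
  move=> mA; have bA := bmf_indic R mA; rewrite -ExZ//.
  transitivity (Ex Pr12 (fun z => g z.2 * \1_A z.1)).
    by apply: eq_Ex => z; rewrite mulrC.
  transitivity (Ex Pr2 (fun y => g y * Ex Pr1 \1_A)); last first.
    by apply: eq_Ex => y; rewrite mulrC.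
  apply: (transfer (X := snd) (Y := id)) => //.
  - exact: bmf_fst.
  - exact: bmf_cst.
  - move=> B mB; rewrite ExZ; last exact: bmf_indic.
    apply: EFin_inj; rewrite EFinM !Ex_indic// -prod_rect// -Ex_indic.
      by congr _%:E; apply: eq_Ex => z; rewrite indicI.
    apply: measurableI; rewrite -[X in measurable X]setTI; first exact: measurable_fst.
    exact: measurable_snd.
transitivity (Ex Pr1 (fun x => f x * Ex Pr2 g)); last first.
  by rewrite mulrC -ExZ//; apply: eq_Ex => x; rewrite mulrC.
apply: (transfer (X := fst) (Y := id)) => //.
- exact: bmf_snd.
- exact: bmf_cst.
- move=> A mA; rewrite ExZ; last exact: bmf_indic.
  rewrite mulrC -ind//; apply: eq_Ex => z; by rewrite mulrC.
Qed.

End ProductSpace.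

(** * Binary digits of a uniform variable *)

Section UniformBits.
Context (R : realType).
Let lam : probability (measurableTypeR R) R := uniform_prob (@ltr01 R).

Lemma uniform_rayo (x : R) : lam `]-oo, x[%classic = (clip x)%:E.
Proof.
rewrite /lam /= /uniform_prob integral_uniform_pdf.
rewrite (eq_integral (fun=> 1%E)) => [|y]; last first.
  by rewrite inE => -[_]; rewrite /= in_itv /= /uniform_pdf => ->; rewrite subr0 invr1.
rewrite integral_cst ?mul1e; last by apply: measurableI; exact: measurable_itv.
have [x0|x0] := leP x 0.
  rewrite (_ : _ `&` _ = set0) ?measure0.
    by rewrite /clip min_l ?max_l// (le_trans x0).
  apply/seteqP; split => y //= [] /[!in_itv] /= yx /andP[y0 _].
  by have := le_lt_trans y0 yx; rewrite ltNge x0.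
have [x1|x1] := leP x 1.
  rewrite clip_id ?x1 ?(ltW x0)//.
  rewrite (_ : _ `&` _ = `[0, x[%classic).
    by rewrite /= lebesgue_measure_itv /= lte_fin x0 oppr0 adde0.
  apply/seteqP; split => y /=; rewrite !in_itv /=.
    by move=> [yx /andP[-> _]].
  by move=> /andP[-> yx]; split => //; rewrite ltW// (lt_le_trans yx).
rewrite (_ : _ `&` _ = `[0, 1]%classic).
  rewrite /= lebesgue_measure_itv /= lte_fin ltr01 oppr0 adde0.
  by rewrite /clip min_r ?(ltW x1)// max_r.
apply/seteqP; split => y /=; rewrite !in_itv /=; first by case.
by move=> /[dup] /andP[_ y1] ->; split => //; exact: le_lt_trans x1.
Qed.

Lemma clip0 (x : R) : x <= 0 -> clip x = 0.
Proof. by move=> x0; rewrite /clip min_l ?max_l// (le_trans x0). Qed.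

Lemma clip1 (x : R) : 1 <= x -> clip x = 1.
Proof. by move=> x1; rewrite /clip min_r// max_r. Qed.

Lemma uniform_itvco (a b : R) : a <= b -> lam `[a, b[%classic = (clip b - clip a)%:E.
Proof.
move=> ab; have -> : `[a, b[%classic = `]-oo, b[%classic `\` `]-oo, a[%classic.
  apply/seteqP; split => x /=; rewrite !in_itv /=.
    by move=> /andP[ax ->]; split => //; apply/negP; rewrite -leNgt.
  by move=> [-> /negP]; rewrite -leNgt => ->.
rewrite measureD; try exact: measurable_itv.
- rewrite setIidr; first exact: (f_equal2 (fun u v : \bar R => (u - v)%E) (uniform_rayo b) (uniform_rayo a)).
  by move=> x /=; rewrite !in_itv /= => /lt_le_trans; exact.
- exact: (eq_ind _ (fun u => (u < +oo)%E) (ltry (clip b)) _ (esym (uniform_rayo b))).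
Qed.

Definition bit (x : R) : R := (2^-1 <= x)%R%:R.

(** The doubling map, except that 1 is fixed; [0, 1] is stable. *)
Definition tau (x : R) : R := 2 * x - bit x.

Lemma bit_indic : bit = \1_`[2^-1, +oo[%classic.
Proof.
apply/funext => x; rewrite indicE; congr (nat_of_bool _)%:R.
by apply/idP/idP; rewrite inE /= in_itv /= andbT.
Qed.

Lemma bmf_bit : bmf bit.
Proof. by rewrite bit_indic; apply: bmf_indic; exact: measurable_itv. Qed.

Lemma measurable_tau :
  measurable_fun [set: measurableTypeR R] (tau : measurableTypeR R -> measurableTypeR R).
Proof.
apply: measurable_funB; first exact: measurable_funM.
by case: bmf_bit.
Qed.

Lemma tau01 x : 0 <= x <= 1 -> 0 <= tau x <= 1.
Proof. by rewrite /tau /bit; case: (leP 2^-1 x) => /= h; lra. Qed.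

Let H (b : bool) : set R := if b then `[2^-1, +oo[%classic else `]-oo, 2^-1[%classic.

Let mH b : measurable (H b).
Proof. by rewrite /H; case: b; exact: measurable_itv. Qed.

Lemma uniform_half_ray b (x : R) :
  lam (tau @^-1` `]-oo, x[ `&` H b) = (2^-1 * clip x)%:E.
Proof.
case: b; rewrite /H.
  have [x0|x0] := leP x 0.
    rewrite (_ : _ `&` _ = set0) ?measure0 ?clip0 ?mulr0//.
    apply/seteqP; split => y //= []; rewrite /tau /bit !in_itv /= andbT => + y2.
    by rewrite y2 /=; lra.
  rewrite (_ : _ `&` _ = `[2^-1, (x + 1) / 2[%classic).
    rewrite uniform_itvco; last by lra.
    congr _%:E; rewrite (@clip_id _ 2^-1); last by lra.
    have [x1|x1] := leP x 1.
      by rewrite (@clip_id _ x) ?(@clip_id _ ((x + 1) / 2)); lra.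
    by rewrite (@clip1 x) ?(@clip1 ((x + 1) / 2)); lra.
  apply/seteqP; split => y /=; rewrite /tau /bit !in_itv /= ?andbT.
    by move=> [+ y2]; rewrite y2 /=; lra.
  by move=> /andP[y2 yx]; rewrite y2 /=; split => //; lra.
rewrite (_ : _ `&` _ = `]-oo, Num.min 2^-1 (x / 2)[%classic).
  rewrite uniform_rayo; congr _%:E; have [x0|x0] := leP x 0.
    by rewrite min_r ?(@clip0 x) ?(@clip0 (x / 2)); lra.
  have [x1|x1] := leP x 1.
    by rewrite min_r ?(@clip_id _ x) ?(@clip_id _ (x / 2)); lra.
  by rewrite min_l ?(@clip1 x) ?(@clip_id _ 2^-1); lra.
apply/seteqP; split => y /=; rewrite /tau /bit !in_itv /= lt_min.
  by move=> [+ y2]; rewrite (leNgt _ y) y2 /=; lra.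
by move=> /andP[y2 yx]; rewrite (leNgt _ y) y2 /=; split => //; lra.
Qed.

(** Given the first digit, the remainder [tau] is again uniform. Both sides are finite measures in
    [A] that agree on the rays []-oo, x[], a family stable under intersection. *)
Lemma uniform_half b A : measurable A ->
  lam (tau @^-1` A `&` H b) = ((2^-1 : R)%:E * lam A)%E.
Proof.
move=> mA; have [c cE] : exists c : {nonneg R}, c%:num = 2^-1 by exists (2^-1)%:nng.
pose taur : measurableTypeR R -> measurableTypeR R := tau.
pose m1 : {measure set (measurableTypeR R) -> \bar R} := pushforward (mrestr lam (mH b)) taur.
pose m2 : {measure set (measurableTypeR R) -> \bar R} := mscale c lam.
transitivity (m1 measurable_tau A) => //; transitivity (m2 A); last first.
  by rewrite /m2 /= /mscale /= cE.
apply: (@measure_unique _ R (measurableTypeR R) (@RGenInftyO.G R)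
  (fun k => `]-oo, k%:R[%classic) _ _ _ _ (m1 measurable_tau) m2 _ _ A mA).
- exact: RGenInftyO.measurableE.
- move=> _ _ [x ->] [y ->]; exists (Num.min x y).
  by apply/seteqP; split => z /=; rewrite !in_itv /= lt_min => /andP.
- by move=> k; exists k%:R.
- apply/seteqP; split => // x _; exists (Num.bound `|x|) => //=.
  by rewrite in_itv /= (le_lt_trans (ler_norm x))// archi_boundP.
- move=> _ [x ->]; transitivity ((2^-1 * clip x)%:E : \bar R); first exact: uniform_half_ray.
  by rewrite /m2 /= /mscale /= cE EFinM -uniform_rayo.
- move=> k; apply: (@le_lt_trans _ _ 1%E); last exact: ltry.
  apply: probability_le1; apply: measurableI; last exact: mH.
  exact: (measurable_preimageT measurable_tau (measurable_itv `]-oo, (k%:R : R)[)).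
Qed.

Lemma Ex_half (e : bool) (f : R -> R) : bmf (f : measurableTypeR R -> R) ->
  Ex lam (fun x => f (tau x) * \1_(H e) x) = 2^-1 * Ex lam f.
Proof.
move=> bf; transitivity (Ex lam (fun x => f x * 2^-1)); last first.
  by rewrite -ExZ//; apply: eq_Ex => x; rewrite mulrC.
apply: (transfer (X := tau : measurableTypeR R -> measurableTypeR R) (Y := id)) => //.
- exact: measurable_tau.
- by apply: bmf_indic; exact: mH.
- exact: bmf_cst.
- move=> A mA; rewrite ExZ; last exact: bmf_indic.
  have mt : measurable (tau @^-1` A).
    exact: (measurable_preimageT measurable_tau).
  apply: EFin_inj; rewrite EFinM Ex_indic// -(uniform_half e)// -(Ex_indic lam).
    by congr _%:E; apply: eq_Ex => x; rewrite indicI mulrC.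
  by apply: measurableI mt (mH e).
Qed.

(** A digit is 0 or 1, so all its positive powers coincide and the exponent matters only through
    being zero or not. *)
Lemma Ex_bit (n : nat) (f : R -> R) : bmf (f : measurableTypeR R -> R) ->
  Ex lam (fun x => bit x ^+ n * f (tau x)) = (if n is 0%N then 1 else 2^-1) * Ex lam f.
Proof.
move=> bf; have bt b : bmf (fun x : measurableTypeR R => f (tau x) * \1_(H b) x).
  apply: bmfM; last by apply: bmf_indic; exact: mH.
  have [mf [M fM]] := bf; split; last by exists M => x; exact: fM.
  exact: (measurableT_comp mf measurable_tau).
case: n => [|n].
  rewrite (eq_Ex _ (g := fun x : measurableTypeR R =>
      f (tau x) * \1_(H true) x + f (tau x) * \1_(H false) x)).
    by rewrite ExD// !Ex_half// -mulrDl; congr (_ * _); lra.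
  move=> x; rewrite expr0 mul1r -mulrDr (_ : _ + _ = 1) ?mulr1//.
  have e1 : (x \in H true) = (2^-1 <= x)%R by apply/idP/idP; rewrite inE /H /= in_itv /= andbT.
  have e2 : (x \in H false) = (x < 2^-1)%R by apply/idP/idP; rewrite inE /H /= in_itv.
  by rewrite !indicE e1 e2; case: leP; rewrite ?addr0 ?add0r.
rewrite -(@Ex_half true)//; apply: eq_Ex => x; rewrite mulrC; congr (_ * _).
by rewrite bit_indic indicE -natrX; case: (x \in _); rewrite ?exp1n ?exp0n.
Qed.

Definition bitn k x := bit (iter k tau x).

Lemma measurable_iter_tau k :
  measurable_fun [set: measurableTypeR R] (iter k tau : measurableTypeR R -> measurableTypeR R).
Proof.
elim: k => [|k IH]; first exact: measurable_id.
exact: (measurableT_comp measurable_tau IH).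
Qed.

Lemma bmf_bitn k : bmf (bitn k : measurableTypeR R -> R).
Proof.
have [mb [M bM]] := bmf_bit; split; last by exists M => x; exact: bM.
exact: (measurableT_comp mb (measurable_iter_tau k)).
Qed.

Lemma Ex_bits (m : nat -> nat) n : Ex lam (fun x => \prod_(k < n) bitn k x ^+ m k) =
  \prod_(k < n) (if m k is 0%N then 1 else 2^-1).
Proof.
elim: n m => [|n IH] m.
  rewrite big_ord0 (eq_Ex _ (g := fun _ : measurableTypeR R => 1)) ?Ex_cst// => x; by rewrite big_ord0.
rewrite big_ord_recl -(IH (fun k => m k.+1)) -Ex_bit.
  by apply: eq_Ex => x; rewrite big_ord_recl; congr (_ * _); apply: eq_bigr => k _;
    rewrite /bitn /= -iterSr.
by apply: bmf_prod => k; apply: bmfX; exact: bmf_bitn.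
Qed.

Lemma bits_expansion n x :
  \sum_(k < n) bitn k x / 2 ^+ k.+1 + iter n tau x / 2 ^+ n = x.
Proof.
elim: n => [|n IH]; first by rewrite big_ord0 add0r expr0 divr1.
rewrite big_ord_recr /= -[RHS]IH -addrA; congr (_ + _).
have -> : tau (iter n tau x) = 2 * iter n tau x - bitn n x by [].
rewrite exprS.
have e0 : (2 ^+ n : R) != 0 by rewrite expf_neq0// pnatr_eq0.
by field.
Qed.

End UniformBits.

(** * From one uniform variable to an i.i.d. sequence *)

Section IidUniform.
Context (R : realType).
Let lam : probability (measurableTypeR R) R := uniform_prob (@ltr01 R).
Let lam2 : probability (measurableTypeR R * measurableTypeR R)%type R := (lam \x lam)%E.

Lemma prod_count (F : nat -> R) (s : seq nat) n : all (fun l => l < n)%N s ->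
  \prod_(l <- s) F l = \prod_(l < n) F l ^+ count_mem (l : nat) s.
Proof.
elim: s => [|i s IH] /=; first by rewrite big_nil big1.
move=> /andP[ni sn]; rewrite big_cons IH//.
under [RHS]eq_bigr do rewrite exprD.
rewrite big_split /=; congr (_ * _).
rewrite (bigD1 (Ordinal ni)) //= eqxx expr1 big1 ?mulr1// => l.
by rewrite -val_eqE /= eq_sym => /negbTE ->.
Qed.

Lemma prod_even_odd (G : nat -> R) n : \prod_(l < n.*2) G l =
  \prod_(k < n) G k.*2 * \prod_(k < n) G k.*2.+1.
Proof.
elim: n => [|n IH]; first by rewrite !big_ord0 mul1r.
by rewrite doubleS !big_ord_recr /= IH; ring.
Qed.

Let f0 (l : nat) (x : measurableTypeR R) : R := bitn l x.
(** The digits of two independent uniform variables, interleaved; their joint moments are those of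
    the digits of a single one. *)
Let g0 (l : nat) (z : measurableTypeR R * measurableTypeR R) : R :=
  if odd l then bitn l./2 z.2 else bitn l./2 z.1.

Let bf0 l : bmf (f0 l). Proof. exact: bmf_bitn. Qed.

Let bg0 l : bmf (g0 l).
Proof.
by rewrite /g0; case: (odd l); [exact: bmf_snd (bmf_bitn R _)|exact: bmf_fst (bmf_bitn R _)].
Qed.

Let moments s : Ex lam (fun x => \prod_(l <- s) f0 l x) =
                Ex lam2 (fun z => \prod_(l <- s) g0 l z).
Proof.
have [n sn] : exists n, all (fun l => l < n.*2)%N s.
  exists (\max_(l <- s) l).+1; apply/allP => l ls.
  have lM : (l <= \max_(i <- s) i)%N by exact: (@leq_bigmax_seq _ s xpredT id l ls isT).
  by rewrite (leq_ltn_trans lM)// -addnn leq_addr.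
pose m l := count_mem l s.
rewrite (eq_Ex _ (g := fun x : measurableTypeR R => \prod_(l < n.*2) bitn l x ^+ m l)) => [|x].
  rewrite Ex_bits (prod_even_odd (fun l => if m l is 0%N then 1 else 2^-1)).
  rewrite -(Ex_bits _ (fun k => m k.*2)) -(Ex_bits _ (fun k => m k.*2.+1)) -Ex_prod.
  - apply: eq_Ex => z; rewrite (prod_count (g0 ^~ z) sn).
    rewrite (prod_even_odd (fun l => g0 l z ^+ m l)).
    by congr (_ * _); apply: eq_bigr => k _; rewrite /g0 /= odd_double ?uphalf_double ?doubleK.
  - by apply: bmf_prod => k; apply: bmfX; exact: bmf_bitn.
  - by apply: bmf_prod => k; apply: bmfX; exact: bmf_bitn.
exact: (prod_count (f0 ^~ x) sn).
Qed.

Lemma bitn01 k (x : R) : 0 <= bitn k x <= 1.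
Proof. by rewrite /bitn /bit ler0n lern1 leq_b1. Qed.

Lemma binary_partial01 (b : nat -> R) n : (forall k, 0 <= b k <= 1) ->
  0 <= \sum_(k < n) b k / 2 ^+ k.+1 <= 1.
Proof.
move=> b01; have e0 k : 0 < (2 ^+ k : R) by rewrite exprn_gt0.
rewrite sumr_ge0 => [|k _]; last by rewrite divr_ge0 ?(ltW (e0 _))//; case/andP : (b01 k).
apply: (@le_trans _ _ (1 - (2 ^+ n)^-1)); last by rewrite lerBlDr lerDl invr_ge0 ltW.
elim: n => [|n IH]; first by rewrite big_ord0 expr0 invr1 subrr.
rewrite big_ord_recr /=; have /andP[_ b1] := b01 n.
have h : b n / 2 ^+ n.+1 <= (2 ^+ n.+1)^-1.
  by rewrite ler_piMl// invr_ge0 ltW.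
apply: le_trans (lerD IH h) _; rewrite exprS invfM.
have := e0 n; rewrite -invr_gt0; set u := (2 ^+ n)^-1; lra.
Qed.

(** The number whose binary digits are those of [x] of even rank if [s] is false, of odd rank if [s]
    is true, ranks being counted from 0. *)
Definition half_bits (s : bool) (x : R) : R :=
  limn (fun n => \sum_(k < n) bitn (k.*2 + s)%N x / 2 ^+ k.+1).

Let half_cvg (s : bool) (x : R) :
  (fun n => \sum_(k < n) bitn (k.*2 + s)%N x / 2 ^+ k.+1 : R) @ \oo --> half_bits s x.
Proof.
apply: nondecreasing_is_cvgn.
  by apply/nondecreasing_seqP => m; rewrite big_ord_recr /= lerDl divr_ge0 ?exprn_ge0.
exists 1 => _ [n _ <-]; have := @binary_partial01 (fun k => bitn (k.*2 + s)%N x) n.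
by move=> /(_ (fun k => bitn01 _ _))/andP[].
Qed.

Let bhalfN (s : bool) n : bmf (fun x : measurableTypeR R => \sum_(k < n) bitn (k.*2 + s)%N x / 2 ^+ k.+1).
Proof.
apply: bmf_sum => k; apply: bmfM; last exact: bmf_cst.
exact: bmf_bitn.
Qed.

Lemma bmf_half s : bmf (half_bits s : measurableTypeR R -> R).
Proof.
split.
  apply: (measurable_fun_cvg (h := fun n x => \sum_(k < n) bitn (k.*2 + s)%N x / 2 ^+ k.+1)).
    by move=> n; case: (bhalfN s n).
  by move=> x _; exact: half_cvg.
exists 1 => x; have h0 n := @binary_partial01 (fun k => bitn (k.*2 + s)%N x) n (fun k => bitn01 _ _).
have h1 : half_bits s x <= 1.
  by apply: cvgn_le (@half_cvg s x) _; apply: nearW => n; case/andP : (h0 n).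
rewrite ger0_norm//.
rewrite /half_bits; apply: limr_ge; first exact: half_cvg.
by apply: nearW => n; case/andP : (h0 n).
Qed.

Let side (s : bool) (z : measurableTypeR R * measurableTypeR R) : R := if s then z.2 else z.1.

Let mside s : measurable_fun setT (side s).
Proof. by rewrite /side; case: s; [exact: measurable_snd|exact: measurable_fst]. Qed.

Let side01 s : {ae lam2, forall z, 0 <= side s z <= 1}.
Proof.
have h : lam `[0, 1]%classic = 1%E by rewrite /lam /= /uniform_prob integral_uniform_pdf1.
have mz : measurable (side s @^-1` `[0, 1]%classic).
  exact: (measurable_preimageT (mside s) (measurable_itv _)).
have h1 : lam2 (side s @^-1` `[0, 1]%classic) = 1%E.
  rewrite -[RHS]h /side; case: s {mz}.
    exact: (prod_snd lam lam (measurable_itv _)).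
  exact: (prod_fst lam lam (measurable_itv _)).
exists (~` (side s @^-1` `[0, 1]%classic)); split => //; first exact: measurableC.
  by rewrite probability_setC// h1 subee.
Qed.

(** On the product space the corresponding digit sums rebuild the coordinates themselves, up to a
    null set; [clip] makes the coordinate bounded everywhere. *)
Let coupled_half s : coupled lam lam2 f0 g0 (half_bits s) (fun z => clip (side s z)).
Proof.
apply: (coupled_lim (M := 1) bf0 bg0 (bmf_half s) (bmf_clip (mside s))
  (f_ := fun n x => \sum_(k < n) bitn (k.*2 + s)%N x / 2 ^+ k.+1)
  (g_ := fun n z => \sum_(k < n) bitn k (side s z) / 2 ^+ k.+1)).
- move=> n; apply: coupled_sum => k; apply: coupledM; last exact: coupled_cst.
  have := coupled_base lam lam2 f0 g0 (k.*2 + s)%N.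
  apply: eq_coupled => // z; rewrite /g0 /side oddD odd_double oddb /=.
  by case: s => /=; rewrite ?addn1 ?addn0 /= ?uphalf_double ?doubleK.
- by apply: aeW => x; exact: half_cvg.
- apply: filterS (side01 s) => z z01; rewrite clip_id//.
  apply/subr_cvg0/norm_cvg0P.
  have c0 : (fun n => (2^-1 : R) ^+ n) @ \oo --> (0 : R).
    by apply: cvg_expr; rewrite ger0_norm ?invf_lt1 ?ltr1n.
  apply: (squeeze_cvgr _ (cvg_cst 0) c0); near=> n; rewrite normr_ge0 /=.
  rewrite -[X in _ - X](bits_expansion n) opprD addrA subrr add0r normrN exprVn.
  have i01 : 0 <= iter n (@tau R) (side s z) <= 1.
    by elim: (n) => [//|m IH]; exact: tau01.
  have /andP[i0 i1] := i01; rewrite ger0_norm ?divr_ge0 ?exprn_ge0//.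
  by rewrite ler_piMl// invr_ge0 exprn_ge0.
- apply: aeW => x n.
  have /andP[h0 h1] := @binary_partial01 (fun k => bitn (k.*2 + s)%N x) n (fun k => bitn01 _ _).
  by rewrite ger0_norm.
- apply: aeW => z n.
  have /andP[h0 h1] := @binary_partial01 (fun k => bitn k (side s z)) n (fun k => bitn01 _ _).
  by rewrite ger0_norm.
Unshelve. all: by end_near. Qed.

(** Both halves are coupled through the same base statistics, so [coupled_setI] gives the joint law
    and not only the two marginals. *)
Lemma half_bits_indep (A B : set R) : measurable A -> measurable B ->
  lam (half_bits false @^-1` A `&` half_bits true @^-1` B) = (lam A * lam B)%E.
Proof.
move=> mA mB.
have [cA _] := coupled_preimage bf0 bg0 moments (coupled_half false) mA.
have [cB _] := coupled_preimage bf0 bg0 moments (coupled_half true) mB.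
have hE := coupled_Ex bf0 bg0 moments (coupled_setI cA cB).
have mh s C : measurable C -> measurable (half_bits s @^-1` C : set (measurableTypeR R)).
  by move=> mC; have [mh _] := bmf_half s; exact: (measurable_preimageT mh).
have mc s C : measurable C -> measurable ((fun z => clip (side s z)) @^-1` C).
  by move=> mC; have [mc _] := bmf_clip (mside s); exact: (measurable_preimageT mc).
have := congr1 EFin hE; rewrite !Ex_indic; last 2 first.
- by apply: measurableI; exact: mc.
- by apply: measurableI; exact: mh.
move=> ->; rewrite -(prod_rect lam lam mA mB).
have ms s C : measurable C -> measurable (side s @^-1` C).
  by move=> mC; exact: (measurable_preimageT (mside s)).
have m1 : measurable (fst @^-1` A `&` snd @^-1` B : set (measurableTypeR R * measurableTypeR R)).
  by apply: measurableI; [exact: (ms false)|exact: (ms true)].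
rewrite -(Ex_indic _ m1) -Ex_indic; last by apply: measurableI; exact: mc.
congr _%:E; apply: Ex_ae.
- by apply: bmf_indic; apply: measurableI; exact: mc.
- exact: bmf_indic.
- move: (side01 false) (side01 true); apply: filterS2 => z z1 z2.
  rewrite !indicE; congr (nat_of_bool _)%:R.
  by apply/idP/idP; rewrite !inE /preimage /= (clip_id z1) (clip_id z2).
Qed.

(* The digits of even rank of a uniform variable yield [U 0]; those of odd rank
   are independent of it and serve to build the next variables. *)
Lemma exists_iid_uniform : exists U : nat -> {RV lam >-> R},
  mutually_independent U /\
  forall j (B : set R), measurable B -> lam (U j @^-1` B) = uniform_prob (@ltr01 R) B.
Proof.
pose u j : measurableTypeR R -> R := half_bits false \o iter j (half_bits true).
have mit j : measurable_fun [set: measurableTypeR R]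
    (iter j (half_bits true) : measurableTypeR R -> measurableTypeR R).
  elim: j => [|j IH]; first exact: measurable_id.
  have [mh _] := bmf_half true; exact: (measurableT_comp mh IH).
have mu j : measurable_fun setT (u j).
  have [mh _] := bmf_half false; exact: (measurableT_comp mh (mit j)).
exists (fun j => mfun_Sub (mem_set (mu j))).
have mpre (h : measurableTypeR R -> R) (C : set R) : measurable_fun setT h -> measurable C ->
    measurable (h @^-1` C).
  by move=> mh mC; exact: (measurable_preimageT mh).
have lam1 : lam setT = 1%E by exact: probability_setT.
have inv B : measurable B -> lam (half_bits true @^-1` B) = lam B.
  move=> mB; have := half_bits_indep measurableT mB.
  by rewrite preimage_setT setTI lam1 mul1e.
have lawu j B : measurable B -> lam (u j @^-1` B) = lam B.
  move=> mB; elim: j => [|j IH].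
    have := half_bits_indep mB measurableT.
    by rewrite preimage_setT setIT lam1 mule1.
  rewrite -IH -[RHS]inv; last exact: mpre (mu j) mB.
  by congr (lam _); apply/seteqP; split => x; rewrite /preimage /u /= -iterSr.
split; last by move=> j B mB; exact: lawu.
move=> n; elim: n => [|n IH] B mB.
  rewrite big_ord0 (_ : [set _ | _] = setT)//.
  by apply/seteqP; split => x // _ [].
rewrite big_ord_recl.
pose C : set R := [set x | forall i : 'I_n, B (lift ord0 i) (u i x)].
have mC : measurable C.
  by apply: measurable_forall => i; exact: mpre (mu i) (mB _).
rewrite (_ : [set _ | _] = half_bits false @^-1` B ord0 `&` half_bits true @^-1` C).
  rewrite half_bits_indep//; congr (_ * _)%E; first by rewrite -(lawu 0%N).
  have -> : lam C = (\prod_(i < n) lam (u i @^-1` B (lift ord0 i)))%E.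
    exact: (IH (fun i => B (lift ord0 i)) (fun i => mB _)).
  by apply: eq_bigr => i _; rewrite !lawu.
have uS (k : 'I_n) x : u (lift ord0 k) x = u k (half_bits true x).
  by rewrite /u lift0 /= -iterSr.
apply/seteqP; split => x /=.
  move=> Bx; split; first exact: Bx ord0.
  by move=> i; rewrite -uS; exact: (Bx (lift ord0 i)).
move=> [B0 Cx] i; case: (unliftP ord0 i) => [k|] ->; last exact: B0.
by have := Cx k; rewrite -uS.
Qed.

End IidUniform.

(** * Random cdf and means on a product space *)

Section Lift.
Context d (T : measurableType d) (R : realType) (Pr : probability T R).
Let lam : probability (measurableTypeR R) R := uniform_prob (@ltr01 R).
Let Pr2 : probability (T * measurableTypeR R)%type R := (Pr \x lam)%E.

Lemma measurable_fst_fun (f : T -> R) : measurable_fun setT f ->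
  measurable_fun setT (fun z : T * measurableTypeR R => f z.1).
Proof. by move=> mf; exact: (measurableT_comp mf measurable_fst). Qed.

Lemma measurable_snd_fun (f : measurableTypeR R -> R) : measurable_fun setT f ->
  measurable_fun setT (fun z : T * measurableTypeR R => f z.2).
Proof. by move=> mf; exact: (measurableT_comp mf measurable_snd). Qed.

Definition lift_fst (P : nat -> {RV Pr >-> R}) (j : nat) : {RV Pr2 >-> R} :=
  mfun_Sub (mem_set (measurable_fst_fun (measurable_funPT (P j)))).

Definition lift_snd (U : nat -> {RV lam >-> R}) (j : nat) : {RV Pr2 >-> R} :=
  mfun_Sub (mem_set (measurable_snd_fun (measurable_funPT (U j)))).

Lemma Ex_fst (f : T -> R) : bmf f -> Ex Pr2 (fun z => f z.1) = Ex Pr f.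
Proof.
move=> bf; rewrite -[RHS]mulr1 -(Ex_cst lam 1) -(Ex_prod _ _ bf (bmf_cst _ 1)).
by apply: eq_Ex => z; rewrite mulr1.
Qed.

Lemma lift_fst_law P : same_law_seq (lift_fst P) P.
Proof.
move=> A mA; have mPA : measurable (path_of P @^-1` A).
  exact: (measurable_preimageT (measurable_path_of _)).
exact: (prod_fst Pr lam mPA).
Qed.

Lemma lift_snd_prob U j (B : set R) : measurable B ->
  Pr2 (lift_snd U j @^-1` B) = lam (U j @^-1` B).
Proof.
move=> mB; have mUB : measurable (U j @^-1` B) by exact: measurable_funPTI.
exact: (prod_snd Pr lam mUB).
Qed.

Lemma lift_snd_indep U : mutually_independent U -> mutually_independent (lift_snd U).
Proof.
move=> iU n B mB; under eq_bigr do rewrite lift_snd_prob//.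
rewrite -iU//; apply: (prod_snd Pr lam (B := [set x | forall i : 'I_n, B i (U i x)])).
by apply: measurable_forall => i; exact: measurable_funPTI.
Qed.

Lemma lift_indep P U : independent_seqs (lift_fst P) (lift_snd U).
Proof.
move=> A B mA mB.
have mPA : measurable (path_of P @^-1` A).
  exact: (measurable_preimageT (measurable_path_of _)).
have mUB : measurable (path_of U @^-1` B).
  exact: (measurable_preimageT (measurable_path_of _)).
rewrite [X in (X * _)%E](_ : _ = Pr (path_of P @^-1` A)); last exact: (prod_fst Pr lam mPA).
rewrite [X in (_ * X)%E](_ : _ = lam (path_of U @^-1` B)); last exact: (prod_snd Pr lam mUB).
exact: (prod_rect Pr lam mPA mUB).
Qed.

Lemma lift_fst_dist P : random_discrete_distribution P ->
  random_discrete_distribution (lift_fst P).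
Proof. by move=> hP; exact: same_law_dist (lift_fst_law P) hP. Qed.

End Lift.

(** * From moments of linear combinations to joint moments *)

Section Polarization.
Context (R : realType) (d1 d2 : measure_display)
  (T1 : measurableType d1) (T2 : measurableType d2)
  (Pr1 : probability T1 R) (Pr2 : probability T2 R)
  (I : Type) (f : I -> T1 -> R) (g : I -> T2 -> R)
  (bf : forall i, bmf (f i)) (bg : forall i, bmf (g i)).

(** A polynomial with n + 1 coefficients that vanishes at the n + 1 points 0, ..., n. *)
Lemma poly_coef1_eq0 (D : nat -> R) n :
  (forall x : R, \sum_(k < n.+1) x ^+ k * D k = 0) -> forall k, (k <= n)%N -> D k = 0.
Proof.
move=> H k kn; pose p := \poly_(k < n.+1) D k.
suff p0 : p = 0 by have := coef0 R k; rewrite -p0 coef_poly ltnS kn.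
apply: (@roots_geq_poly_eq0 _ p [seq i%:R | i <- iota 0 n.+1]).
- apply/allP => _ /mapP[i _ ->]; rewrite /root horner_poly; apply/eqP.
  by rewrite -[RHS](H i%:R); apply: eq_bigr => l _; rewrite mulrC.
- by rewrite map_inj_uniq ?iota_uniq// => i l /eqP; rewrite eqr_nat => /eqP.
- by rewrite size_map size_iota size_poly.
Qed.

Hypothesis same_lin : forall (L : seq (R * I)) n,
  Ex Pr1 (fun w => (\sum_(x <- L) x.1 * f x.2 w) ^+ n) =
  Ex Pr2 (fun w => (\sum_(x <- L) x.1 * g x.2 w) ^+ n).

(* The product with one more factor [f i] is read off from the coefficient of
   [x] in the identity for the linear combination [x f i + sum]. *)
Lemma polarization (s : seq I) :
  Ex Pr1 (fun w => \prod_(i <- s) f i w) = Ex Pr2 (fun w => \prod_(i <- s) g i w).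
Proof.
(* A power of an arbitrary linear combination is carried along: with [s] empty this is [same_lin],
   with [L] empty and [n = 0] it is the goal. *)
suff H (L : seq (R * I)) n :
    Ex Pr1 (fun w => \prod_(i <- s) f i w * (\sum_(x <- L) x.1 * f x.2 w) ^+ n) =
    Ex Pr2 (fun w => \prod_(i <- s) g i w * (\sum_(x <- L) x.1 * g x.2 w) ^+ n).
  have := H [::] 0%N; rewrite (eq_Ex _ (g := fun w => \prod_(i <- s) f i w)).
    by move=> ->; apply: eq_Ex => w; rewrite expr0 mulr1.
  by move=> w; rewrite expr0 mulr1.
elim: s L n => [|i s IH] L n.
  rewrite (eq_Ex _ (g := fun w => (\sum_(x <- L) x.1 * f x.2 w) ^+ n)).
    by rewrite same_lin; apply: eq_Ex => w; rewrite big_nil mul1r.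
  by move=> w; rewrite big_nil mul1r.
pose E d (T : measurableType d) (Pr : probability T R) (h : I -> T -> R) k :=
  Ex Pr (fun w => \prod_(i <- s) h i w * (\sum_(x <- L) x.1 * h x.2 w) ^+ (n.+1 - k) * h i w ^+ k).
have bE d (T : measurableType d) (h : I -> T -> R) (bh : forall i, bmf (h i)) k :
    bmf (fun w => \prod_(i <- s) h i w * (\sum_(x <- L) x.1 * h x.2 w) ^+ (n.+1 - k) * h i w ^+ k).
  apply: bmfM; last exact: bmfX.
  by apply: bmfM; [exact: bmf_prod|apply/bmfX/bmf_sum => x; exact: bmfZ].
have ex d (T : measurableType d) (Pr : probability T R) (h : I -> T -> R) x :
    (forall i, bmf (h i)) ->
    Ex Pr (fun w => \prod_(i <- s) h i w * (\sum_(y <- (x, i) :: L) y.1 * h y.2 w) ^+ n.+1) =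
    \sum_(k < n.+2) x ^+ k * ('C(n.+1, k)%:R * E _ _ Pr h k).
  move=> bh; rewrite (eq_Ex _ (g := fun w => \sum_(k < n.+2) (x ^+ k * 'C(n.+1, k)%:R) *
    (\prod_(i <- s) h i w * (\sum_(x <- L) x.1 * h x.2 w) ^+ (n.+1 - k) * h i w ^+ k))) => [|w].
    rewrite Ex_sum => [|k]; last by apply: bmfZ; exact: bE.
    by apply: eq_bigr => k _; rewrite ExZ ?mulrA//; exact: bE.
  rewrite big_cons addrC exprDn big_distrr /=; apply: eq_bigr => k _.
  by rewrite -mulr_natl exprMn; ring.
(* In degree 1 the binomial factor n + 1 is nonzero, and the exponent of the sum over [L] falls from
   n + 1 to n. *)
have := @poly_coef1_eq0 (fun k => 'C(n.+1, k)%:R * (E _ _ Pr1 f k - E _ _ Pr2 g k)) n.+1 _ 1%N isT.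
rewrite bin1 => /(_ _)/eqP; rewrite mulf_eq0 pnatr_eq0 /= subr_eq0 => H.
have := H; rewrite /E subn1 /= => {}H.
rewrite (eq_Ex _ (g := fun w => \prod_(i <- s) f i w * (\sum_(x <- L) x.1 * f x.2 w) ^+ n * f i w ^+ 1)).
  rewrite (eqP (H _)); first by apply: eq_Ex => w; rewrite big_cons; ring.
  move=> x; apply/eqP; rewrite -[X in _ == X](subrr (Ex Pr1 (fun w =>
    \prod_(i <- s) f i w * (\sum_(y <- (x, i) :: L) y.1 * f y.2 w) ^+ n.+1))).
  rewrite [X in _ == _ - X]IH !ex//; apply/eqP; rewrite -sumrB; apply: eq_bigr => k _.
  by rewrite /E; ring.
by move=> w; rewrite big_cons; ring.
Qed.

End Polarization.

(** * A realization of the random cdf and of means of step functions *)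

Section Existence.
Context d (T : measurableType d) (R : realType) (Pr : probability T R).
Let lam : probability (measurableTypeR R) R := uniform_prob (@ltr01 R).
Let Pr2 : probability (T * measurableTypeR R)%type R := (Pr \x lam)%E.
Context (P : nat -> {RV Pr >-> R}) (U : nat -> {RV lam >-> R}).
Hypothesis hP : random_discrete_distribution P.
Hypothesis Uind : mutually_independent U.
Hypothesis Ulaw : forall j (B : set R), measurable B ->
  lam (U j @^-1` B) = uniform_prob (@ltr01 R) B.

Let P1 := lift_fst P.
Let U1 := lift_snd Pr U.

Definition ray_meas (v : R) := rand_meas P1 U1 `]-oo, v]%classic.

Lemma bmf_ray_meas v : bmf (ray_meas v).
Proof. by apply: bmf_rand_meas; exact: measurable_itv. Qed.

Lemma lift_snd_uniform j (B : set R) : measurable B ->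
  Pr2 (U1 j @^-1` B) = (fine (uniform_prob (@ltr01 R) B))%:E.
Proof.
move=> mB; rewrite /U1 lift_snd_prob// Ulaw// fineK//.
by rewrite fin_num_measure.
Qed.

Definition ray_cdf (v : R) : {RV Pr2 >-> R} := mfun_Sub (mem_set (bmf_ray_meas v).1).

Lemma ray_meas_series v : {ae Pr2, forall w,
  series (fun j => P1 j w * (U1 j w <= v)%R%:R : R) @ \oo --> ray_meas v w}.
Proof.
apply: filterS (dist_ae (lift_fst_dist hP)) => w [dw _].
apply: eq_cvgn (rand_meas_series (V := U1) (B := `]-oo, v]%classic) dw) => N.
apply: eq_bigr => j _; congr (_ * _); rewrite indicE; congr (nat_of_bool _)%:R.
by apply/idP/idP; rewrite inE /= in_itv.
Qed.

Lemma ray_cdf_is_random_cdf : is_random_cdf P ray_cdf.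
Proof.
exists P1, U1; split.
- exact: lift_fst_law.
- move=> j B mB; rewrite /distribution /= /pushforward lift_snd_prob//; exact: Ulaw.
- exact: lift_snd_indep.
- exact: lift_indep.
- by move=> v _; exact: ray_meas_series.
Qed.

Variable L : seq (R * R).

Definition step_fun (u : R) : R := \sum_(x <- L) x.1 * (u <= x.2)%R%:R.

Lemma measurable_step_fun : measurable_fun setT step_fun.
Proof.
apply: measurable_sum => x; apply: measurable_funM; first exact: measurable_cst.
rewrite (_ : (fun u => _) = \1_`]-oo, x.2]%classic :> (R -> R)).
  by apply: measurable_indic; exact: measurable_itv.
apply/funext => u; rewrite indicE; congr (nat_of_bool _)%:R.
by apply/idP/idP; rewrite inE /= in_itv.
Qed.

Let mstep : @measurable_fun _ _ (measurableTypeR R) R setT step_fun.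
Proof. exact: measurable_step_fun. Qed.

Definition step_var : {RV lam >-> R} := @mfun_Sub _ _ (measurableTypeR R) R step_fun (mem_set mstep).

Lemma finite_step_var : finite_set (range step_var).
Proof.
rewrite (_ : range step_var = range step_fun)// /step_fun; elim: L => [|x s IH].
  by apply: sub_finite_set (finite_set1 0) => _ [u _ <-]; rewrite big_nil.
apply: sub_finite_set (finite_image2 +%R (finite_set2 x.1 0) IH) => _ [u _ <-].
rewrite big_cons; exists (x.1 * (u <= x.2)%R%:R).
  by case: (u <= x.2); rewrite ?mulr1 ?mulr0; [left|right].
by exists (\sum_(x0 <- s) x0.1 * (u <= x0.2)%R%:R) => //; exists u.
Qed.

Let mstepU j : measurable_fun setT (fun z => step_fun (U1 j z)).
Proof. exact: (measurableT_comp measurable_step_fun (measurable_funPT (U1 j))). Qed.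

Let X1 j : {RV Pr2 >-> R} := mfun_Sub (mem_set (mstepU j)).

Lemma bmf_ray_comb : bmf (fun w => \sum_(x <- L) x.1 * ray_meas x.2 w).
Proof. by apply: bmf_sum => x; apply: bmfZ; exact: bmf_ray_meas. Qed.

Definition ray_comb : {RV Pr2 >-> R} := mfun_Sub (mem_set bmf_ray_comb.1).

(** The mean of a step function of U is the same combination of values of the random cdf. Laws of
    means of simple variables thus determine the laws of all linear combinations of these values. *)
Lemma ray_comb_is_mean : is_mean P step_var ray_comb.
Proof.
have mS (B : set R) : measurable B -> measurable (step_fun @^-1` B).
  by move=> mB; exact: (measurable_preimageT measurable_step_fun).
have mSS : measurable_fun setT (fun x : seqspace R => (fun j => step_fun (x j)) : seqspace R).
  apply: measurable_to_seqspace => j.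
  exact: (measurableT_comp measurable_step_fun (measurable_coord j)).
exists P1, X1; split.
- exact: lift_fst_law.
- move=> j B mB; rewrite /pushforward.
  have := lift_snd_prob Pr U j (mS B mB); rewrite Ulaw; last exact: mS.
  exact.
- move=> n B mB.
  exact: (@lift_snd_indep _ _ _ Pr _ Uind n (fun i => step_fun @^-1` B i) (fun i => mS _ (mB i))).
- move=> A B mA mB.
  have mSB : measurable ((fun x : seqspace R => (fun j => step_fun (x j)) : seqspace R) @^-1` B).
    exact: (measurable_preimageT mSS mB).
  exact: (lift_indep P U mA mSB).
have : {ae Pr2, forall w, forall x, x \in L ->
    series (fun j => P1 j w * (U1 j w <= x.2)%R%:R : R) @ \oo --> ray_meas x.2 w}.
  elim: L => [|x s IH]; first exact: aeW.
  move: (ray_meas_series x.2) IH; apply: filterS2 => w cx cs y.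
  by rewrite inE => /predU1P[->|/cs].
apply: filterS => w cw.
have : (fun N => \sum_(x <- L) x.1 * series (fun j => P1 j w * (U1 j w <= x.2)%R%:R) N : R)
    @ \oo --> (\sum_(x <- L) x.1 * ray_meas x.2 w : R).
  elim: L cw => [|x s IH] cw.
    by under eq_fun do rewrite big_nil; rewrite big_nil; exact: cvg_cst.
  under eq_fun do rewrite big_cons; rewrite big_cons; apply: cvgD.
    by apply: cvgMr; apply: cw; rewrite inE eqxx.
  by apply: IH => y ys; apply: cw; rewrite inE ys orbT.
apply: eq_cvgn => N; rewrite /series /=; under eq_bigr do rewrite big_distrr.
rewrite exchange_big; apply: eq_bigr => j _ /=.
by rewrite /step_fun big_distrl; apply: eq_bigr => x _ /=; ring.
Qed.

End Existence.

(** * Power sums as limits of statistics of the random cdf *)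

Lemma cvgn_sum (R : realType) (I : Type) (r : seq I) (u : I -> nat -> R) (l : I -> R) :
  (forall i, u i @ \oo --> l i) ->
  (fun n => \sum_(i <- r) u i n : R) @ \oo --> (\sum_(i <- r) l i : R).
Proof.
move=> ul; elim: r => [|i r IH].
  by under eq_fun do rewrite big_nil; rewrite big_nil; exact: cvg_cst.
by under eq_fun do rewrite big_cons; rewrite big_cons; exact: cvgD.
Qed.

Lemma cvgn_exp (R : realType) (u : nat -> R) (l : R) k :
  u @ \oo --> l -> (fun n => u n ^+ k : R) @ \oo --> (l ^+ k : R).
Proof.
move=> ul; elim: k => [|k IH]; first exact: cvg_cst.
by rewrite exprS; under eq_fun do rewrite exprS; exact: cvgM.
Qed.

Lemma pow_diff (R : realDomainType) (x y : R) m : 0 <= x <= y -> y <= 1 ->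
  0 <= y ^+ m - x ^+ m <= m%:R * (y - x).
Proof.
move=> /andP[x0 xy] y1; have y0 : 0 <= y by exact: le_trans xy.
elim: m => [|m /andP[h0 h1]]; first by rewrite !expr0 subrr mul0r lexx.
have xm0 : 0 <= x ^+ m by rewrite exprn_ge0.
have xm1 : x ^+ m <= 1 by rewrite exprn_ile1// (le_trans xy).
have -> : y ^+ m.+1 - x ^+ m.+1 = y * (y ^+ m - x ^+ m) + (y - x) * x ^+ m.
  by rewrite !exprS; ring.
have yx0 : 0 <= y - x by rewrite subr_ge0.
apply/andP; split; first by rewrite addr_ge0// mulr_ge0.
rewrite -natr1 [(m%:R + 1) * _]mulrDl mul1r lerD//; last by rewrite ler_piMr.
by apply: le_trans h1; rewrite ler_piMl.
Qed.

(* Cells [l] carry masses [A l]; the sum of the [n]-th powers of the masses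
   exceeds that of the atoms by at most a multiple of the excess of squares. *)
Lemma cell_excess (R : realType) (I : Type) (J : eqType) (r : seq I) (s : seq J) (e : I -> J -> bool)
    (p : J -> R) (A : I -> R) m :
  (forall j, 0 <= p j) -> \sum_(j <- s) p j <= 1 ->
  (forall j, \sum_(l <- r) (e l j)%:R = 1 :> R) ->
  (forall l, A l = \sum_(j <- s) p j * (e l j)%:R) ->
  0 <= \sum_(l <- r) A l ^+ m.+1 - \sum_(j <- s) p j ^+ m.+1 <=
  m%:R * (\sum_(l <- r) A l ^+ 2 - \sum_(j <- s) p j ^+ 2).
Proof.
move=> p0 p1 e1 AE.
(* Every atom lies in exactly one cell, so both sums run over pairs of a cell and an atom in it:
   A_l^(n+1) is the sum of p_j A_l^n, and p_j^(n+1) is p_j p_j^n. *)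
have split n : \sum_(l <- r) A l ^+ n.+1 - \sum_(j <- s) p j ^+ n.+1 =
    \sum_(l <- r) \sum_(j <- s) p j * (e l j)%:R * (A l ^+ n - p j ^+ n).
  rewrite [RHS](eq_bigr (fun l => A l ^+ n.+1 - \sum_(j <- s) p j ^+ n.+1 * (e l j)%:R)).
    rewrite sumrB; congr (_ - _); rewrite exchange_big; apply: eq_bigr => j _ /=.
    by rewrite -big_distrr /= e1 mulr1.
  move=> l _; rewrite [A l ^+ n.+1]exprS [X in X * A l ^+ n]AE big_distrl -sumrB; apply: eq_bigr => j _ /=.
  by rewrite exprS; ring.
have A1 l : A l <= 1.
  by rewrite AE; apply: le_trans p1; apply: ler_sum => j _; rewrite ler_piMr// lern1 leq_b1.
have pA l j : j \in s -> e l j -> p j <= A l.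
  move=> js elj; rewrite AE (big_rem j js) /= elj mulr1 lerDl.
  by apply: sumr_ge0 => i _; rewrite mulr_ge0.
rewrite !split.
rewrite big_distrr /=.
have H l j : j \in s -> 0 <= p j * (e l j)%:R * (A l ^+ m - p j ^+ m) <=
    m%:R * (p j * (e l j)%:R * (A l ^+ 1 - p j ^+ 1)).
  move=> js; case: (boolP (e l j)) => elj; last by rewrite mulr0 !mul0r mulr0 lexx.
  have pl := pA _ _ js elj; rewrite mulr1 !expr1.
  have /andP[h0 h1] := @pow_diff _ (p j) (A l) m (introT andP (conj (p0 j) pl)) (A1 l).
  by rewrite mulr_ge0//= mulrCA ler_wpM2l.
apply/andP; split.
  by apply: sumr_ge0 => l _; rewrite big_seq; apply: sumr_ge0 => j /(H l)/andP[].
apply: ler_sum => l _; rewrite big_distrr /= big_seq [leRHS]big_seq.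
by apply: ler_sum => j /(H l)/andP[].
Qed.

Lemma sum_alls2 (R : realType) (G : seq nat -> R) M : \sum_(t <- alls M 2) G t =
  \sum_(a <- iota 0 M) \sum_(b <- iota 0 M) G [:: a; b].
Proof.
rewrite (_ : alls M 2 = [seq a :: s | a <- iota 0 M, s <- alls M 1])// big_allpairs_dep.
apply: eq_bigr => a _.
rewrite (_ : alls M 1 = [seq b :: s | b <- iota 0 M, s <- alls M 0])// big_allpairs_dep.
by apply: eq_bigr => b _; rewrite big_seq1.
Qed.

(** * Excess of the powers of cell masses over the power sums *)

Section CellApproximation.
Context d (T : measurableType d) (R : realType) (Pr : probability T R)
  (P V : nat -> {RV Pr >-> R}) (nu : set R -> R).
Hypothesis hP : random_discrete_distribution P.
Hypothesis Vnu : forall j (B : set R), measurable B -> Pr (V j @^-1` B) = (nu B)%:E.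
Hypothesis Vind : mutually_independent V.
Hypothesis PVind : independent_seqs P V.
Variables (N : nat) (B : 'I_N -> set R).
Hypothesis mB : forall l, measurable (B l).

Let F l := rand_meas P V (B l).

Lemma rand_meas_excess m w : dist_seq (P ^~ w) ->
  (forall j, \sum_(l < N) \1_(B l) (V j w) = 1 :> R) ->
  0 <= \sum_(l < N) F l w ^+ m.+1 - powersum m.+1 (P ^~ w) <=
  m%:R * (\sum_(l < N) F l w ^+ 2 - powersum 2 (P ^~ w)).
Proof.
move=> dw e1; pose a M l := atom_sum P V M (B l) w.
have cp : cpath P w = P ^~ w by exact: (@dist_clip _ (P ^~ w)).
have c n : (fun M => \sum_(l < N) a M l ^+ n.+1 - psum M (cpath P w) n.+1 : R) @ \oo -->
    (\sum_(l < N) F l w ^+ n.+1 - powersum n.+1 (P ^~ w) : R).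
  apply: cvgB; last by rewrite cp; exact: dist_psum_cvg.
  apply: cvgn_sum => l; apply: cvgn_exp; exact: atom_sum_cvg.
have H M := @cell_excess R 'I_N nat (index_enum 'I_N) (iota 0 M) (fun l j => V j w \in B l)
  (cpath P w) (a M) m (cpath_ge0 P w).
have {}H M : 0 <= \sum_(l < N) a M l ^+ m.+1 - psum M (cpath P w) m.+1 <=
    m%:R * (\sum_(l < N) a M l ^+ 2 - psum M (cpath P w) 2).
  apply: H => [|j|l]; first by have := dist_psum1 M dw; rewrite cp /psum; under eq_bigr do rewrite expr1.
    by rewrite -[RHS](e1 j).
  by rewrite /a /atom_sum.
apply/andP; split.
  rewrite -oppr_le0; apply: (cvgn_le (cvgN (c m))); apply: nearW => M.
  by rewrite oppr_le0; case/andP : (H M).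
rewrite -subr_le0; apply: (@cvgn_le _ (fun M =>
  (\sum_(l < N) a M l ^+ m.+1 - psum M (cpath P w) m.+1) -
  m%:R * (\sum_(l < N) a M l ^+ 2 - psum M (cpath P w) 2))).
  by apply: cvgB; [exact: c|apply: cvgMr; exact: c].
apply: nearW => M.
by rewrite subr_le0; case/andP : (H M).
Qed.

Hypothesis nuB : forall l, nu (B l) = N%:R^-1.
Hypothesis N0 : (0 < N)%N.

Lemma cells_prob2 l (a b : nat) : cells_prob nu [:: B l; B l] [:: a; b] =
  N%:R^-1 * (if a == b then 1 else N%:R^-1).
Proof.
rewrite /cells_prob /= inE; have [<-|ab] := eqVneq a b.
  by rewrite big_seq1 /cell /= !big_cons big_nil eqxx setIT setIid nuB mulr1.
rewrite !big_cons big_nil /cell /= !big_cons !big_nil !eqxx /=.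
by rewrite [b == a]eq_sym (negbTE ab) !setIT nuB mulr1.
Qed.

(** An atom paired with itself contributes exactly to the power sum. Two distinct atoms share a cell
    with probability N N^-2 = 1/N, and the products P_a P_b add up to at most 1. *)
Lemma Ex_excess2 :
  Ex Pr (fun w => \sum_(l < N) F l w ^+ 2 - powersum 2 (P ^~ w)) <= N%:R^-1.
Proof.
have bF l : bmf (fun w => F l w ^+ 2) by apply: bmfX; exact: bmf_rand_meas.
rewrite ExB; [|exact: bmf_sum|exact: bmf_powersum].
rewrite Ex_sum//.
pose E t := Ex Pr (fun w => mon (cpath P w) [:: 1%N; 1%N] t).
have c1 : (fun M => \sum_(l < N) \sum_(t <- alls M 2) cells_prob nu [:: B l; B l] t * E t : R)
    @ \oo --> (\sum_(l < N) Ex Pr (fun w => F l w ^+ 2) : R).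
  apply: cvgn_sum => l.
  have ms C : C \in [:: B l; B l] -> measurable C by rewrite !inE => /orP[]/eqP->.
  have := cvg_rand_meas hP Vnu Vind PVind ms.
  rewrite (eq_Ex _ (g := fun w => F l w ^+ 2))// => w.
  by rewrite !big_cons big_nil mulr1 expr2.
have c2 : (fun M => Ex Pr (fun w => psum M (cpath P w) 2)) @ \oo -->
    Ex Pr (fun w => powersum 2 (P ^~ w)).
  have := cvg_Ex_prod_psum (a := [:: 2%N]) isT hP.
  rewrite (eq_Ex _ (g := fun w => powersum 2 (P ^~ w))) => [|w]; last by rewrite big_seq1.
  apply: eq_cvgn => M; apply: eq_Ex => w; by rewrite big_seq1.
apply: (cvgn_le (cvgB c1 c2)); apply: nearW => M; rewrite /= lerBlDr.
have NN : N%:R * N%:R^-1 = 1 :> R by rewrite mulfV// pnatr_eq0 -lt0n.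
have E0 t : 0 <= E t by apply: Ex_ge0 => w; apply: mon_ge0; exact: cpath_ge0.
have -> : \sum_(l < N) \sum_(t <- alls M 2) cells_prob nu [:: B l; B l] t * E t =
    \sum_(a <- iota 0 M) \sum_(b <- iota 0 M) (if a == b then 1 else N%:R^-1) * E [:: a; b].
  rewrite exchange_big sum_alls2; apply: eq_bigr => a _; apply: eq_bigr => b _.
  under eq_bigr do rewrite cells_prob2.
  by rewrite sumr_const card_ord -mulrA -mulrnAl -mulr_natl NN mul1r.
(* The diagonal terms are granted an extra multiple 1/N, which completes the off-diagonal sum to the
   square of the total mass. *)
apply: (@le_trans _ _ (\sum_(a <- iota 0 M) \sum_(b <- iota 0 M)
    (N%:R^-1 * E [:: a; b] + if a == b then E [:: a; b] else 0))).
  apply: ler_sum => a _; apply: ler_sum => b _; case: eqP => _; last by rewrite addr0.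
  by rewrite mul1r lerDr mulr_ge0// invr_ge0.
under eq_bigr do rewrite big_split /=.
rewrite big_split /= lerD//.
  under eq_bigr do rewrite -big_distrr /=.
  rewrite -big_distrr /= ler_piMr ?invr_ge0//.
  have -> : \sum_(a <- iota 0 M) \sum_(b <- iota 0 M) E [:: a; b] =
      Ex Pr (fun w => \prod_(n <- [:: 1%N; 1%N]) psum M (cpath P w) n).
    rewrite (eq_Ex _ (fun w => prod_psum [:: 1%N; 1%N] M (cpath P w))).
    by rewrite Ex_sum => [|t]; [rewrite sum_alls2|exact: bmf_mon].
  rewrite -[leRHS](Ex_cst Pr); apply: Ex_le_ae; [|exact: bmf_cst|].
    by apply: bmf_prod => n; exact: bmf_psum.
  apply: filterS (dist_ae hP) => w [dw ->]; rewrite !big_cons big_nil mulr1.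
  by have /andP[? ?] := @dist_psum _ (P ^~ w) M 1 isT dw; rewrite mulr_ile1.
rewrite Ex_sum => [|j]; last by apply: bmfX; exact: bmf_cpath.
rewrite big_seq [leRHS]big_seq; apply: ler_sum => a aM.
rewrite (bigD1_seq a) ?iota_uniq//= eqxx big1 ?addr0 => [|b /negbTE ba]; last first.
  by rewrite eq_sym ba.
rewrite le_eqVlt; apply/orP; left; apply/eqP; apply: eq_Ex => w.
by rewrite /mon !big_cons big_nil /= !expr1 mulr1 expr2.
Qed.

End CellApproximation.

(** * Division of the unit interval into equal cells *)

Section UniformCells.
Context (R : realType).
Let lam : probability (measurableTypeR R) R := uniform_prob (@ltr01 R).

Lemma uniform_rayc (x : R) : lam `]-oo, x]%classic = (clip x)%:E.
Proof.
have l1 : lam [set x] = 0%E by rewrite /lam /= /uniform_prob integral_set1.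
have -> : `]-oo, x]%classic = `]-oo, x[%classic `|` [set x].
  apply/seteqP; split => y /=; rewrite !in_itv /=.
    by rewrite le_eqVlt => /predU1P[->|]; [right|left].
  by move=> [/ltW//|->].
rewrite measureU0//; first exact: uniform_rayo.
Qed.

Lemma uniform_itvoc (a b : R) : a <= b -> lam `]a, b]%classic = (clip b - clip a)%:E.
Proof.
move=> ab; have -> : `]a, b]%classic = `]-oo, b]%classic `\` `]-oo, a]%classic.
  apply/seteqP; split => x /=; rewrite !in_itv /=.
    by move=> /andP[ax ->]; split => //; apply/negP; rewrite -ltNge.
  by move=> [-> /negP]; rewrite -ltNge => ->.
rewrite measureD; try exact: measurable_itv.
- rewrite setIidr; first exact: (f_equal2 (fun u v : \bar R => (u - v)%E) (uniform_rayc b) (uniform_rayc a)).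
  by move=> x /=; rewrite !in_itv /= => /le_trans; exact.
- exact: (eq_ind _ (fun u => (u < +oo)%E) (ltry (clip b)) _ (esym (uniform_rayc b))).
Qed.

(** Open on the left, so that the random mass of a cell is a difference of two values of the cdf.
    The point 0 is missed, but has probability 0. *)
Definition uniform_cell (N l : nat) : set R := `]l%:R / N%:R, l.+1%:R / N%:R]%classic.

Lemma uniform_cell_prob N l : (l < N)%N -> lam (uniform_cell N l) = (N%:R^-1)%:E.
Proof.
move=> lN; have N0 : 0 < N%:R :> R by rewrite ltr0n (leq_trans _ lN).
have c (k : nat) : (k <= N)%N -> clip (k%:R / N%:R : R) = k%:R / N%:R.
  by move=> kN; rewrite clip_id// divr_ge0 ?ler0n//= ler_pdivrMr// mul1r ler_nat.
rewrite uniform_itvoc; last by rewrite ler_pM2r ?invr_gt0// ler_nat.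
by rewrite !c// 1?ltnW// -mulrBl -natr1 addrAC subrr add0r mul1r.
Qed.

Lemma sum_uniform_cell N (x : R) : (0 < N)%N -> 0 < x <= 1 ->
  \sum_(l < N) \1_(uniform_cell N l) x = 1 :> R.
Proof.
move=> N0 /andP[x0 x1]; have NR : 0 < N%:R :> R by rewrite ltr0n.
have E l : \1_(uniform_cell N l) x = (x <= l.+1%:R / N%:R)%R%:R - (x <= l%:R / N%:R)%R%:R :> R.
  rewrite indicE mem_setE /= in_itv /=.
  have h : l%:R / N%:R <= l.+1%:R / N%:R :> R by rewrite ler_pM2r ?invr_gt0// ler_nat.
  case: (leP x (l%:R / N%:R)) => xl /=; last by rewrite subr0.
  by rewrite (le_trans xl h) subrr.
under eq_bigr do rewrite E.
rewrite -(big_mkord xpredT (fun l => (x <= l.+1%:R / N%:R)%R%:R - (x <= l%:R / N%:R)%R%:R)).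
rewrite telescope_sumr// divff ?gt_eqF// x1 mul0r leNgt x0 subr0//.
Qed.

End UniformCells.

(** * Power sums as L1-limits of powers of increments *)

Section RayCells.
Context d (T : measurableType d) (R : realType) (Pr : probability T R).
Let lam : probability (measurableTypeR R) R := uniform_prob (@ltr01 R).
Let Pr2 : probability (T * measurableTypeR R)%type R := (Pr \x lam)%E.
Context (P : nat -> {RV Pr >-> R}) (U : nat -> {RV lam >-> R}).
Hypothesis hP : random_discrete_distribution P.
Hypothesis Uind : mutually_independent U.
Hypothesis Ulaw : forall j (B : set R), measurable B ->
  lam (U j @^-1` B) = uniform_prob (@ltr01 R) B.

Let P1 := lift_fst P.
Let U1 := lift_snd Pr U.

Lemma ray_meas_diff a b w : a <= b -> dist_seq (P1 ^~ w) ->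
  rand_meas P1 U1 `]a, b]%classic w = ray_meas P U b w - ray_meas P U a w.
Proof.
move=> ab dw; apply/esym; apply: cvg_unique (atom_sum_cvg (V := U1) (B := `]a, b]%classic) dw) => //=.
have : (fun N => atom_sum P1 U1 N `]-oo, b]%classic w - atom_sum P1 U1 N `]-oo, a]%classic w : R)
    @ \oo --> (ray_meas P U b w - ray_meas P U a w : R).
  by apply: cvgB; exact: atom_sum_cvg.
apply: eq_cvgn => N; rewrite /atom_sum -sumrB; apply: eq_bigr => j _.
rewrite -mulrBr; congr (_ * _); rewrite !indicE !mem_setE !in_itv /=.
case: (leP (U1 j w) a) => ua /=; last by rewrite subr0.
by rewrite (le_trans ua ab) subrr.
Qed.

(** [clip] does not move the division points; it makes every argument visibly a time in [0, 1], as
    for the base statistics in [ray_powersums]. *)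
Definition ray_cell_powersum (n N : nat) w : R :=
  \sum_(l < N) (ray_meas P U (clip (l.+1%:R / N%:R)) w - ray_meas P U (clip (l%:R / N%:R)) w) ^+ n.

Lemma bmf_ray_cell_powersum n N : bmf (ray_cell_powersum n N).
Proof. by apply: bmf_sum => l; apply: bmfX; apply: bmfB; exact: bmf_ray_meas. Qed.

Let Unu := lift_snd_uniform Pr Ulaw.

Let U01 : {ae Pr2, forall w j, 0 < U1 j w <= 1}.
Proof.
apply: ae_foralln => j.
have mI : measurable `]0 : R, 1]%classic by exact: measurable_itv.
have h : Pr2 (U1 j @^-1` `]0, 1]%classic) = 1%E.
  rewrite /U1 lift_snd_prob// Ulaw//.
  rewrite [LHS](uniform_itvoc (@ler01 R)) clip_id ?ler01 ?lexx// clip_id ?ler01 ?lexx//.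
  by rewrite subr0.
have mS : measurable (U1 j @^-1` `]0, 1]%classic) by exact: measurable_funPTI.
have h0 : Pr2 (~` (U1 j @^-1` `]0, 1]%classic)) = 0%E by rewrite probability_setC// h subee.
by exists (~` (U1 j @^-1` `]0, 1]%classic)); split => //; exact: measurableC.
Qed.

(** The excess over the power sum is nonnegative and at most [m] times that of the squares, whose
    expectation is at most 1/N. *)
Lemma ray_cell_powersum_L1 m N : (0 < N)%N ->
  Ex Pr2 (fun w => `|ray_cell_powersum m.+1 N w - powersum m.+1 (P1 ^~ w)|) <= m%:R / N%:R.
Proof.
move=> N0; have NR : 0 < N%:R :> R by rewrite ltr0n.
pose B (l : 'I_N) : set R := uniform_cell N l.
have mB l : measurable (B l) by exact: measurable_itv.
have nuB l : fine (uniform_prob (@ltr01 R) (B l)) = N%:R^-1.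
  by rewrite [X in fine X](uniform_cell_prob R (ltn_ord l)).
have hP1 := lift_fst_dist hP.
have b2 : bmf (fun w => \sum_(l < N) rand_meas P1 U1 (B l) w ^+ 2 - powersum 2 (P1 ^~ w)).
  apply: bmfB; last exact: bmf_powersum.
  by apply: bmf_sum => l; apply: bmfX; exact: bmf_rand_meas.
have := Ex_excess2 hP1 Unu (lift_snd_indep Pr Uind) (lift_indep P U) mB nuB N0.
move=> /(ler_wpM2l (ler0n R m)); rewrite -ExZ//; apply: le_trans.
apply: Ex_le_ae; [|exact: bmfZ|].
  apply: bmf_abs; apply: bmfB; [exact: bmf_ray_cell_powersum|exact: bmf_powersum].
move: (dist_ae hP1) U01; apply: filterS2 => w [dw _] u01.
have S1 j : \sum_(l < N) \1_(B l) (U1 j w) = 1 :> R by exact: sum_uniform_cell.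
have /andP[h0 h1] := rand_meas_excess m dw S1.
have E : ray_cell_powersum m.+1 N w = \sum_(l < N) rand_meas P1 U1 (B l) w ^+ m.+1.
  apply: eq_bigr => l _; rewrite ray_meas_diff//; last first.
    by rewrite ler_pM2r ?invr_gt0// ler_nat.
  rewrite !clip_id// divr_ge0 ?ler0n//= ler_pdivrMr// mul1r ler_nat//.
  exact: ltnW.
by rewrite E ger0_norm.
Qed.

End RayCells.

Section RayMoments.
Context (R : realType) (d1 d2 : measure_display)
  (T1 : measurableType d1) (T2 : measurableType d2)
  (Pr1 : probability T1 R) (Pr2 : probability T2 R)
  (P : nat -> {RV Pr1 >-> R}) (Q : nat -> {RV Pr2 >-> R}).
Let lam : probability (measurableTypeR R) R := uniform_prob (@ltr01 R).
Context (U : nat -> {RV lam >-> R}).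
Hypothesis hP : random_discrete_distribution P.
Hypothesis hQ : random_discrete_distribution Q.
Hypothesis Uind : mutually_independent U.
Hypothesis Ulaw : forall j (B : set R), measurable B ->
  lam (U j @^-1` B) = uniform_prob (@ltr01 R) B.

(** The common end of the arguments from (d) and from (e): polarization gives the joint moments of
    the values of the cdf, which couples the powers of increments, and then their L1-limits. *)
Lemma ray_powersums :
  (forall (L : seq (R * R)) n,
    Ex (Pr1 \x lam)%E (fun w => (\sum_(x <- L) x.1 * ray_meas P U (clip x.2) w) ^+ n) =
    Ex (Pr2 \x lam)%E (fun w => (\sum_(x <- L) x.1 * ray_meas Q U (clip x.2) w) ^+ n)) ->
  same_powersums P Q.
Proof.
move=> same_lin.
pose f v := ray_meas P U (clip v); pose g v := ray_meas Q U (clip v).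
have bf v : bmf (f v) by exact: bmf_ray_meas.
have bg v : bmf (g v) by exact: bmf_ray_meas.
have mom := polarization bf bg same_lin.
have cpl m : coupled (Pr1 \x lam)%E (Pr2 \x lam)%E f g
    (fun w => powersum m.+1 (lift_fst P ^~ w)) (fun w => powersum m.+1 (lift_fst Q ^~ w)).
  have L1 d (T : measurableType d) (Pr : probability T R) (X : nat -> {RV Pr >-> R}) :
      random_discrete_distribution X ->
      (fun N => Ex (Pr \x lam)%E (fun w => `|ray_cell_powersum X U m.+1 N.+1 w -
        powersum m.+1 (lift_fst X ^~ w)|) : R) @ \oo --> (0 : R).
    move=> hX.
    have c : (fun N => m%:R * N.+1%:R^-1 : R) @ \oo --> (m%:R * 0 : R).
      by apply: cvgMr; exact: cvg_harmonic.
    rewrite mulr0 in c; apply: (squeeze_cvgr _ (cvg_cst 0) c); apply: nearW => N.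
    by rewrite ray_cell_powersum_L1//= andbT; exact: Ex_ge0.
  apply: (@coupled_L1 _ _ _ _ _ _ _ _ _ _ (fun N => ray_cell_powersum P U m.+1 N.+1)
    (fun N => ray_cell_powersum Q U m.+1 N.+1)).
  all: try exact: L1.
  all: try exact: bmf_powersum.
  move=> N; apply: coupled_sum => l; apply: coupledX; apply: coupledB.
    exact: (coupled_base _ _ f g (l.+1%:R / N.+1%:R)).
  exact: (coupled_base _ _ f g (l%:R / N.+1%:R)).
move=> a a0.
have bp d (T : measurableType d) (Pr : probability T R) (X : nat -> {RV Pr >-> R}) :
  bmf (fun w => \prod_(n <- a) powersum n (X ^~ w)).
  by apply: bmf_prod => n; exact: bmf_powersum.
rewrite -(Ex_fst _ (bp _ _ _ P)) -(Ex_fst _ (bp _ _ _ Q)); apply: (coupled_Ex bf bg mom).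
elim: a a0 {bp} => [_|[|n] a IH //= /IH {}IH].
  have := coupled_cst (Pr1 \x lam)%E (Pr2 \x lam)%E f g 1.
  by apply: eq_coupled => w; rewrite big_nil.
by have := coupledM (cpl n) IH; apply: eq_coupled => w; rewrite big_cons.
Qed.

End RayMoments.

(** * Power sums from conditions (d) and (e) *)

Section LinearMoments.
Context (R : realType) (d1 d2 : measure_display)
  (T1 : measurableType d1) (T2 : measurableType d2)
  (Pr1 : probability T1 R) (Pr2 : probability T2 R)
  (P : nat -> {RV Pr1 >-> R}) (Q : nat -> {RV Pr2 >-> R}).
Hypothesis hP : random_discrete_distribution P.
Hypothesis hQ : random_discrete_distribution Q.

Lemma fdd_powersums :
  (forall (d3 d4 : measure_display)
          (T3 : measurableType d3) (T4 : measurableType d4)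
          (Pr3 : probability T3 R) (Pr4 : probability T4 R)
          (FP : R -> {RV Pr3 >-> R}) (FQ : R -> {RV Pr4 >-> R}),
     is_random_cdf P FP -> is_random_cdf Q FQ -> same_fdd01 FP FQ) ->
  same_powersums P Q.
Proof.
have [U [Uind Ulaw]] := exists_iid_uniform R => H.
have {}H := H _ _ _ _ _ _ _ _ (ray_cdf_is_random_cdf hP Uind Ulaw)
                              (ray_cdf_is_random_cdf hQ Uind Ulaw).
apply: (ray_powersums hP hQ Uind Ulaw) => L n.
pose v := [tuple clip (tnth (in_tuple L) i).2 | i < size L].
(* [clip] makes [g] bounded and acts as the identity on the values of [ray_cdf]. *)
pose g (x : (size L).-tuple R) : R :=
  (\sum_(i < size L) (tnth (in_tuple L) i).1 * clip (tnth x i)) ^+ n.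
have bg : bmf g.
  apply: bmfX; apply: bmf_sum => i; apply: bmfZ; apply: bmf_clip.
  exact: measurable_tnth.
have v01 i : 0 <= tnth v i <= 1 by rewrite tnth_mktuple clip01.
have mF d (T : measurableType d) (Pr : probability T R) (F : R -> {RV Pr >-> R}) :
    measurable_fun setT (fun w => [tuple F (tnth v i) w | i < size L]).
  apply/measurable_fun_tnthP => i.
  apply: eq_measurable_fun (measurable_funPT (F (tnth v i))) => w _ /=.
  by rewrite tnth_mktuple.
have E d (T : measurableType d) (Pr : probability T R) (X : nat -> {RV Pr >-> R}) w :
    (\sum_(x <- L) x.1 * ray_meas X U (clip x.2) w) ^+ n =
    g [tuple ray_cdf X U (tnth v i) w | i < size L].
  rewrite /g; congr (_ ^+ n); rewrite big_tnth; apply: eq_bigr => i _.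
  by rewrite !tnth_mktuple /ray_cdf /= [X in _ = _ * X]clip_id//; exact: clip01.
rewrite (eq_Ex _ (E _ _ _ P)) (eq_Ex _ (E _ _ _ Q)).
exact: (same_law_Ex (mF _ _ _ _) (mF _ _ _ _) (H _ v v01) bg).
Qed.

Lemma mean_powersums :
  (forall (dX : measure_display) (TX : measurableType dX)
          (PrX : probability TX R) (X : {RV PrX >-> R})
          (d3 d4 : measure_display)
          (T3 : measurableType d3) (T4 : measurableType d4)
          (Pr3 : probability T3 R) (Pr4 : probability T4 R)
          (MP : {RV Pr3 >-> R}) (MQ : {RV Pr4 >-> R}),
     finite_set (range X) -> is_mean P X MP -> is_mean Q X MQ ->
     same_law Pr3 Pr4 MP MQ) ->
  same_powersums P Q.
Proof.
have [U [Uind Ulaw]] := exists_iid_uniform R => H.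
apply: (ray_powersums hP hQ Uind Ulaw) => L n.
pose L' := [seq (x.1, clip x.2) | x <- L].
have sl := H _ _ _ _ _ _ _ _ _ _ _ _ (finite_step_var L')
  (ray_comb_is_mean hP Uind Ulaw L') (ray_comb_is_mean hQ Uind Ulaw L').
(* The values of the cdf lie in [0, 1], so the combination never leaves [-K, K], and [g] may be cut
   off there. *)
pose K := \sum_(x <- L) `|x.1|.
pose g (x : R) : R := (x * \1_(`[- K, K]%classic) x) ^+ n.
have mK : measurable (`[- K, K]%classic : set R) by exact: measurable_itv.
have bg : bmf g.
  apply: bmfX; split.
    by apply: measurable_funM; [exact: measurable_id|exact: measurable_indic].
  exists K => x; rewrite indicE mem_setE in_itv /=.
  case: (boolP (- K <= x <= K)) => [xK|_]; first by rewrite mulr1 ler_norml.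
  by rewrite mulr0 normr0 sumr_ge0.
have E d (T : measurableType d) (Pr : probability T R) (X : nat -> {RV Pr >-> R}) w :
    (\sum_(x <- L) x.1 * ray_meas X U (clip x.2) w) ^+ n = g (ray_comb X U L' w).
  rewrite /g /ray_comb /= big_map; set s := \sum_(x <- L) _ * _.
  rewrite indicE mem_setE in_itv /= -ler_norml.
  rewrite (_ : `|s| <= K) ?mulr1//; apply: (le_trans (ler_norm_sum _ _ _)).
  apply: ler_sum => x _; rewrite normrM ler_piMr//.
  by have /andP[r0 r1] := clip01 (fine (\sum_(0 <= j <oo) (cpath (lift_fst X) w j *
    \1_(`]-oo, clip x.2]%classic) (lift_snd Pr U j w))%:E)); rewrite ger0_norm.
rewrite (eq_Ex _ (E _ _ _ P)) (eq_Ex _ (E _ _ _ Q)).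
exact: (same_law_Ex (measurable_funPT _) (measurable_funPT _) sl bg).
Qed.

End LinearMoments.

(** * Existence of samples *)

Section PickAtom.
Context (R : realType).

(* The generalized inverse of the distribution function of [p] (0 if no partial
   sum exceeds [u]). *)
Definition pick_atom (p : nat -> R) (u : R) : nat :=
  if pselect (exists j, u < psum j.+1 p 1) is left h then ex_minn h else 0.

Lemma pick_atomE p u j : pick_atom p u = j <->
  (u < psum j.+1 p 1 /\ forall i, (i < j)%N -> ~ (u < psum i.+1 p 1)) \/
  (j = 0%N /\ forall i, ~ (u < psum i.+1 p 1)).
Proof.
rewrite /pick_atom; case: pselect => [h|h].
  case: ex_minnP => k uk kmin; split=> [<-|[[uj jmin]|[_ no]]].
  - by left; split => // i ik /kmin; rewrite leqNgt ik.
  - apply/eqP; rewrite eqn_leq kmin// leqNgt; apply/negP => /jmin; exact.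
  - by case: (no _ uk).
split=> [<-|[[uj _]|[]//]]; last by case: h; exists j.
by right; split => // i ui; apply: h; exists i.
Qed.

Lemma pick_atomP p u j : dist_seq p -> 0 <= u < 1 ->
  pick_atom p u = j <-> psum j p 1 <= u < psum j.+1 p 1.
Proof.
move=> dp /andP[u0 u1]; have [p0 ps] := dp.
have nd := psum_nd 1 p0.
rewrite pick_atomE; split=> [[[uj jmin]|[_ no]]|/andP[ju uj]].
- rewrite uj andbT; case: j {uj} jmin => [|j] jmin; first by rewrite /psum big_nil.
  by rewrite leNgt; apply/negP; exact: jmin.
- suff : 1 <= u by rewrite leNgt u1.
  apply: (cvgn_le ps); near=> N.
  have N0 : (0 < N)%N by near: N; exact: nbhs_infty_gt.
  rewrite -psum1E -(prednK N0) leNgt; exact/negP/no.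
- left; split => // i ij /lt_le_trans/(_ (nd _ _ ij)).
  by rewrite ltNge ju.
Unshelve. all: by end_near. Qed.

Lemma measurable_pick_atom d (T : measurableType d) (X : nat -> T -> R) (Y : T -> R) :
  (forall j, measurable_fun setT (X j)) -> measurable_fun setT Y ->
  measurable_fun setT (fun z => pick_atom (X ^~ z) (Y z)).
Proof.
move=> mX mY.
pose G k := [set z | Y z < psum k.+1 (X ^~ z) 1].
have mG k : measurable (G k).
  have m : measurable_fun setT (fun z => Y z - psum k.+1 (X ^~ z) 1).
    apply: measurable_funB => //; apply: measurable_sum => j; exact: measurable_funX.
  have := m measurableT _ (measurable_itv `]-oo, 0[); rewrite setTI.
  congr measurable; apply/seteqP; split => z; by rewrite /G /preimage /= in_itv /= subr_lt0.
move=> _ B _; rewrite setTI.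
have -> : (fun z => pick_atom (X ^~ z) (Y z)) @^-1` B =
    \bigcup_(j in B) [set z | pick_atom (X ^~ z) (Y z) = j].
  by apply/seteqP; split => z /=; [exists (pick_atom (X ^~ z) (Y z))|case=> j Bj /= ->].
apply: bigcup_measurable => j _.
have -> : [set z | pick_atom (X ^~ z) (Y z) = j] =
    (G j `&` \bigcap_(i in `I_j) ~` G i) `|`
    (if j == 0%N then \bigcap_i ~` G i else set0).
  apply/seteqP; split => z.
    move=> /pick_atomE[[uj jm]|[-> no]]; first by left; split => // i /jm.
    by right => i _; exact: no.
  move=> H; apply/pick_atomE; case: H => [[uj jm]|]; first by left; split => // i; exact: jm.
  by case: eqP => // -> no; right; split => // i; exact: no.
apply: measurableU.
  apply: measurableI => //; apply: bigcap_measurableType => i _; exact: measurableC.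
case: ifP => // _; apply: bigcap_measurableType => i _; exact: measurableC.
Qed.

Lemma measurable_pick_atom_preimage p (B : set nat) : measurable [set u | B (pick_atom p u)].
Proof.
apply: (measurable_preimageT (f := pick_atom p)) => //.
exact: (measurable_pick_atom (X := fun j _ => p j)).
Qed.

Let lam : probability (measurableTypeR R) R := uniform_prob (@ltr01 R).

Lemma uniform_lt1 : {ae lam, forall u : R, 0 <= u < 1}.
Proof.
have h : lam `[0, 1[%classic = 1%E.
  by rewrite uniform_itvco// !clip_id ?ler01 ?lexx// subr0.
have h0 : lam (~` `[0, 1[%classic) = 0%E by rewrite probability_setC// h subee.
by exists (~` `[0, 1[%classic); split => //; exact: measurableC.
Qed.

Lemma pick_atom_prob p j : dist_seq p -> lam [set u | pick_atom p u = j] = (p j)%:E.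
Proof.
move=> dp; have [p0 _] := dp.
have mp : measurable ([set u | pick_atom p u = j] : set (measurableTypeR R)).
  exact: (measurable_pick_atom_preimage p [set j]).
have s01 k : 0 <= psum k p 1 <= 1 by exact: dist_psum.
transitivity (lam (`[psum j p 1, psum j.+1 p 1[%classic : set (measurableTypeR R))).
  rewrite -!Ex_indic//; congr _%:E; apply: Ex_ae; try exact: bmf_indic.
  have [N [mN N0 sN]] := uniform_lt1; exists N; split => // u; apply: contra_notP => /= Nu.
  have u01 : 0 <= u < 1 by apply: contrapT => /sN.
  rewrite !indicE; congr (nat_of_bool _)%:R.
  by apply/idP/idP; rewrite !inE /= in_itv /= => /(pick_atomP j dp u01).
rewrite uniform_itvco; last exact: psum_nd.
by rewrite !clip_id// psumS expr1 addrAC subrr add0r.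
Qed.

End PickAtom.

Section SampleExistence.
Context d (T : measurableType d) (R : realType) (Pr : probability T R).
Let lam : probability (measurableTypeR R) R := uniform_prob (@ltr01 R).
Let Pr2 : probability (T * measurableTypeR R)%type R := (Pr \x lam)%E.
Context (P : nat -> {RV Pr >-> R}) (U : nat -> {RV lam >-> R}).
Hypothesis hP : random_discrete_distribution P.
Hypothesis Uind : mutually_independent U.
Hypothesis Ulaw : forall j (B : set R), measurable B ->
  lam (U j @^-1` B) = uniform_prob (@ltr01 R) B.

Lemma measurable_pick_sample i :
  measurable_fun setT (fun z : T * measurableTypeR R => pick_atom (cpath P z.1) (U i z.2)).
Proof.
apply: (measurable_pick_atom (X := fun j z => cpath P z.1 j)).
  move=> j; have [m _] := bmf_cpath P j; exact: (measurable_fst_fun m).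
exact: measurable_snd_fun (measurable_funPT (U i)).
Qed.

Definition pick_sample (i : nat) : {RV Pr2 >-> nat} :=
  mfun_Sub (mem_set (measurable_pick_sample i)).

Lemma pick_sample_prob n (j : n.-tuple nat) p : dist_seq p ->
  lam [set y | forall i : 'I_n, pick_atom p (U i y) = tnth j i] =
  (\prod_(i < n) p (tnth j i))%:E.
Proof.
move=> dp.
rewrite (Uind (fun i => measurable_pick_atom_preimage p [set tnth j i])) -prodEFin; apply: eq_bigr => i _.
rewrite Ulaw; first exact: pick_atom_prob.
exact: (measurable_pick_atom_preimage p [set tnth j i]).
Qed.

(** Integration over sections: for fixed [x] the draws are independent with law P(x), and the
    section of the event has the product of the masses as its probability. *)
Lemma pick_sample_from : sample_from (lift_fst P) pick_sample.
Proof.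
move=> n j A mA; pose A' := path_of P @^-1` A.
have mA' : measurable A'.
  exact: (measurable_preimageT (measurable_path_of _)).
have mfA : measurable (fst @^-1` A' : set (T * measurableTypeR R)).
  exact: (measurable_preimageT measurable_fst).
pose g x := \1_A' x * \prod_(i < n) cpath P x (tnth j i).
have bg : bmf g.
  apply: bmfM; first exact: bmf_indic.
  by apply: bmf_prod => i; exact: bmf_cpath.
set E := [set w | forall i : 'I_n, _ = _].
have mE : measurable E.
  by apply: measurable_forall => i; exact: (measurable_funPTI (pick_sample i) (Y := [set tnth j i])).
transitivity (Ex Pr g)%:E.
  rewrite -ExE// -[LHS]/(\int[Pr]_x lam (xsection (fst @^-1` A' `&` E) x))%E.
  apply: ae_eq_integral => //.
  - apply: measurable_fun_xsection; exact: measurableI.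
  - by apply/measurable_EFinP; case: bg.
  apply: filterS (dist_ae hP) => x [dx cx] _; rewrite /g indicE.
  case: (boolP (x \in A')) => xA; last first.
    rewrite mul0r (_ : xsection _ x = set0) ?measure0//.
    by apply/seteqP; split => y //; rewrite /xsection /= inE => -[Ax _]; case/negP : xA; exact: mem_set.
  rewrite mul1r cx -(pick_sample_prob j dx); congr (lam _).
  apply/seteqP; split => y; rewrite /xsection /= inE /E /= -/(cpath P x) cx; first by case.
  by move=> H; split => //; exact: set_mem xA.
rewrite -(Ex_fst _ bg) -ExE; last exact: bmf_fst.
rewrite [RHS]integral_mkcond; apply: ae_eq_integral => //.
- by apply/measurable_EFinP; case: (bmf_fst (measurableTypeR R) bg).
- apply/(measurable_restrictT _ _).1 => //; apply: measurable_funTS; apply/measurable_EFinP.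
  by apply: measurable_prod => i _; exact: (measurable_funPT (lift_fst P (tnth j i))).
apply: filterS (dist_ae (lift_fst_dist hP)) => z [_ cz] _.
rewrite patchE /g indicE (_ : (z \in _) = (z.1 \in A')); last by apply/idP/idP; rewrite !inE.
case: (boolP (z.1 \in A')) => _; last by rewrite mul0r.
by rewrite mul1r; congr _%:E; apply: eq_bigr => i _; rewrite -[RHS](congr1 (fun f => f (tnth j i)) cz).
Qed.

(** The first n draws all miss [j] with probability (1 - p_j)^n. *)
Lemma pick_atom_miss (p : nat -> R) j : dist_seq p -> 0 < p j ->
  lam [set y | forall i, pick_atom p (U i y) <> j] = 0%E.
Proof.
move=> dp pj; have /andP[_ p1] := dist_le1 j dp.
have mp := measurable_pick_atom_preimage p [set~ j].
have mU n : measurable [set y | forall i : 'I_n, pick_atom p (U i y) <> j].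
  by apply: measurable_forall => i; exact: (measurable_funPTI (U i) mp).
have c0 : (fun n => (1 - p j) ^+ n) @ \oo --> (0 : R).
  by apply: cvg_expr; rewrite ger0_norm ?subr_ge0// ltrBlDr ltrDl.
apply/eqP; rewrite eq_le measure_ge0 andbT.
apply: cvge_ge (cvgr_EFin c0); apply: nearW => n.
rewrite [leRHS](_ : _ = lam [set y | forall i : 'I_n, pick_atom p (U i y) <> j]).
  apply: le_measure; rewrite ?inE//; last by move=> y /= H i; exact: H.
  by apply: measurable_forall => i; exact: (measurable_funPTI (U i) mp).
rewrite (Uind (fun=> mp)) (eq_bigr (fun=> (1 - p j)%:E)) => [|i _].
  by rewrite prodEFin prodr_const card_ord.
rewrite Ulaw// EFinB -pick_atom_prob//.
have mj : measurable ([set u | pick_atom p u = j] : set (measurableTypeR R)).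
  by rewrite -[X in measurable X]setCK; exact: measurableC.
exact: (probability_setC lam mj).
Qed.

Lemma pick_sample_hits :
  {ae Pr2, forall z j, 0 < P j z.1 -> exists i, pick_sample i z = j}.
Proof.
apply: ae_foralln => j.
pose N : set (T * measurableTypeR R) :=
  (fst @^-1` [set x | 0 < P j x]) `&` [set z | forall i, pick_sample i z <> j].
have mN : measurable N.
  apply: measurableI.
    apply: (measurable_preimageT measurable_fst).
    rewrite (_ : [set x | _] = P j @^-1` `]0, +oo[%classic); first exact: measurable_funPTI.
    by apply/seteqP; split => x /=; rewrite in_itv /= andbT.
  by apply: measurable_forall => i; exact: (measurable_funPTI (pick_sample i) (Y := [set~ j])).
exists N; split => //; last first.
  by move=> z /= /not_implyP[pj no]; split => // i e; apply: no; exists i.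
rewrite -[LHS]/(\int[Pr]_x lam (xsection N x))%E.
transitivity (\int[Pr]_(x in setT) 0)%E; last exact: integral0.
apply: ae_eq_integral => //; first exact: measurable_fun_xsection.
apply: filterS (dist_ae hP) => x [dx cx] _ /=.
have [pj|pj] := pselect (0 < P j x).
  rewrite -(pick_atom_miss dx pj); congr (lam _).
  by apply/seteqP; split => y; rewrite /xsection /= inE /N /= cx => // -[].
rewrite (_ : xsection N x = set0) ?measure0//.
by apply/seteqP; split => y //; rewrite /xsection /= inE => -[].
Qed.

End SampleExistence.

(** * Law of the ranked sequence *)

Section RankedLaw.
Context (R : realType).

Definition ranked_seq (x : seqspace R) : seqspace R := fun k => ranked k x.

Lemma measurable_ranked_seq : measurable_fun setT ranked_seq.
Proof. by apply: measurable_to_seqspace => k; exact: measurable_ranked. Qed.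

Lemma bmf_powersum_seq n : bmf (fun x : seqspace R => powersum n x).
Proof.
apply: bmf_clip; apply: measurableT_comp => //.
apply: ge0_emeasurable_sum => [j x _ _|j _].
  by rewrite lee_fin exprn_ge0//; case/andP : (clip01 (x j)).
by apply/measurable_EFinP; case: (bmfX n (bmf_coord_clip R j)).
Qed.

Lemma same_law_comp (d1 d2 d d' : measure_display)
    (T1 : measurableType d1) (T2 : measurableType d2)
    (E : measurableType d) (E' : measurableType d')
    (Pr1 : probability T1 R) (Pr2 : probability T2 R)
    (X : T1 -> E) (Y : T2 -> E) (h : E -> E') : measurable_fun setT h ->
  same_law Pr1 Pr2 X Y -> same_law Pr1 Pr2 (fun w => h (X w)) (fun w => h (Y w)).
Proof.
move=> mh XY A mA; apply: (XY (h @^-1` A)).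
exact: (measurable_preimageT mh).
Qed.

Section OneSequence.
Context d (T : measurableType d) (Pr : probability T R) (P : nat -> {RV Pr >-> R}).
Let lam : probability (measurableTypeR R) R := uniform_prob (@ltr01 R).
Let Pr2 : probability (T * measurableTypeR R)%type R := (Pr \x lam)%E.
Hypothesis hP : random_discrete_distribution P.

Lemma measurable_ranking k : measurable_fun setT (fun w => ranked k (path_of P w)).
Proof. exact: (measurableT_comp (@measurable_ranked R k) (measurable_path_of P)). Qed.

Definition ranking k : {RV Pr >-> R} := mfun_Sub (mem_set (measurable_ranking k)).

Lemma is_ranked_ranking : is_ranked P ranking.
Proof.
apply: filterS (dist_ae hP) => w [dw _].
exact: is_ranking_ranked (dist_vanishing dw).
Qed.

Lemma is_ranked_ae D : is_ranked P D ->
  {ae Pr, forall w, path_of D w = ranked_seq (path_of P w)}.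
Proof.
move=> PD; move: PD (dist_ae hP); apply: filterS2 => w Dw [dw _].
exact: ranking_unique Dw (is_ranking_ranked (dist_vanishing dw)).
Qed.

Lemma Ex_powersum_ranking a : all (ltn 0) a ->
  Ex Pr (fun w => \prod_(n <- a) powersum n (path_of ranking w)) =
  Ex Pr (fun w => \prod_(n <- a) powersum n (P ^~ w)).
Proof.
move=> a0; apply: Ex_ae.
- by apply: bmf_prod => n; exact: bmf_powersum ranking n.
- by apply: bmf_prod => n; exact: bmf_powersum.
apply: filterS (dist_ae hP) => w [dw _].
rewrite !big_seq; apply: eq_bigr => n na.
exact: powersum_ranked dw (allP a0 n na).
Qed.

(** [D] lives on the original space and [S] on the product, so that [D] and the ranking of [S] are
    compared in law, through the lifted copy of [P], on whose space both rankings agree almost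
    surely. *)
Lemma exists_size_biased : exists S : nat -> {RV Pr2 >-> R},
  is_size_biased P S /\ forall D, is_ranked P D ->
    same_law Pr Pr2 (path_of D) (fun w => ranked_seq (path_of S w)).
Proof.
have [U [Uind Ulaw]] := exists_iid_uniform R.
pose J := pick_sample P U; pose P' := lift_fst P.
have mS k : measurable_fun setT (fun w => size_biased_term (cpath P' w) (J ^~ w) k).
  exact: (measurableT_comp (@measurable_coord R k) (measurable_size_biased P' J)).
pose S k := mfun_Sub (mem_set (mS k)); exists S; have hP' := lift_fst_dist hP.
split.
  exists P', J; split; [exact: lift_fst_law|exact: pick_sample_from|].
  by apply: filterS (dist_ae hP') => w [_ cw] k /=; rewrite cw.
move=> D PD.
have PP' : same_law Pr Pr2 (path_of P) (path_of P') by move=> A mA; rewrite (lift_fst_law P mA).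
have sl := same_law_comp measurable_ranked_seq PP'.
have mcomp d0 (T0 : measurableType d0) (Pr0 : probability T0 R) (X : nat -> {RV Pr0 >-> R}) :
    measurable_fun setT (fun w => ranked_seq (path_of X w)).
  exact: (measurableT_comp measurable_ranked_seq (measurable_path_of X)).
apply: (same_law_ae (mcomp _ _ _ P) (measurable_path_of D) (mcomp _ _ _ P') (mcomp _ _ Pr2 S) _ _ sl).
  by apply: filterS (is_ranked_ae PD) => w ->.
move: (dist_ae hP') (pick_sample_hits hP Uind Ulaw); apply: filterS2 => w [dw cw] hw.
have vw := dist_vanishing dw.
rewrite [LHS](ranked_size_biased (j := J ^~ w) vw hw (is_ranking_ranked vw)).
by congr ranked_seq; apply/funext => k; rewrite /path_of /= cw.
Qed.

End OneSequence.
End RankedLaw.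

(** * Implications from (a) and (b) *)

Section Equivalences.
Context (R : realType) (d1 d2 : measure_display)
  (T1 : measurableType d1) (T2 : measurableType d2)
  (Pr1 : probability T1 R) (Pr2 : probability T2 R)
  (P : nat -> {RV Pr1 >-> R}) (Q : nat -> {RV Pr2 >-> R}).
Hypothesis hP : random_discrete_distribution P.
Hypothesis hQ : random_discrete_distribution Q.

(** Power sums ignore the order of the terms, so they are functions of the ranked sequence. *)
Lemma ranked_powersums :
  (forall (DP : nat -> {RV Pr1 >-> R}) (DQ : nat -> {RV Pr2 >-> R}),
      is_ranked P DP -> is_ranked Q DQ -> same_law_seq DP DQ) ->
  same_powersums P Q.
Proof.
move=> H a a0; have sl := H _ _ (is_ranked_ranking hP) (is_ranked_ranking hQ).
rewrite -(Ex_powersum_ranking hP a0) -(Ex_powersum_ranking hQ a0).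
apply: (same_law_Ex (measurable_path_of _) (measurable_path_of _) sl
  (g := fun x : seqspace R => \prod_(n <- a) powersum n x)).
by apply: bmf_prod => n; exact: bmf_powersum_seq.
Qed.

Lemma size_biased_ranked :
  (forall (d3 d4 : measure_display)
          (T3 : measurableType d3) (T4 : measurableType d4)
          (Pr3 : probability T3 R) (Pr4 : probability T4 R)
          (SP : nat -> {RV Pr3 >-> R}) (SQ : nat -> {RV Pr4 >-> R}),
      is_size_biased P SP -> is_size_biased Q SQ -> same_law_seq SP SQ) ->
  forall (DP : nat -> {RV Pr1 >-> R}) (DQ : nat -> {RV Pr2 >-> R}),
      is_ranked P DP -> is_ranked Q DQ -> same_law_seq DP DQ.
Proof.
move=> H DP DQ rP rQ A mA.
have [SP [sP rSP]] := exists_size_biased hP; have [SQ [sQ rSQ]] := exists_size_biased hQ.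
rewrite (rSP _ rP _ mA) (rSQ _ rQ _ mA).
exact: (same_law_comp (@measurable_ranked_seq R) (H _ _ _ _ _ _ _ _ sP sQ)).
Qed.

End Equivalences.

Theorem corollary9 (R : realType) (d1 d2 : measure_display)
    (T1 : measurableType d1) (T2 : measurableType d2)
    (Pr1 : probability T1 R) (Pr2 : probability T2 R)
    (P : nat -> {RV Pr1 >-> R}) (Q : nat -> {RV Pr2 >-> R})
    (hP : random_discrete_distribution P)
    (hQ : random_discrete_distribution Q) :
  [<->
    (* (a) *)
    forall (DP : nat -> {RV Pr1 >-> R}) (DQ : nat -> {RV Pr2 >-> R}),
      is_ranked P DP -> is_ranked Q DQ -> same_law_seq DP DQ;
    (* (b) *)
    forall (d3 d4 : measure_display)
           (T3 : measurableType d3) (T4 : measurableType d4)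
           (Pr3 : probability T3 R) (Pr4 : probability T4 R)
           (SP : nat -> {RV Pr3 >-> R}) (SQ : nat -> {RV Pr4 >-> R}),
      is_size_biased P SP -> is_size_biased Q SQ -> same_law_seq SP SQ;
    (* (c) *)
    forall ns : seq nat, ns != [::] -> all (fun n => 0 < n)%N ns ->
      eppf P ns = eppf Q ns;
    (* (d) *)
    forall (d3 d4 : measure_display)
           (T3 : measurableType d3) (T4 : measurableType d4)
           (Pr3 : probability T3 R) (Pr4 : probability T4 R)
           (FP : R -> {RV Pr3 >-> R}) (FQ : R -> {RV Pr4 >-> R}),
      is_random_cdf P FP -> is_random_cdf Q FQ -> same_fdd01 FP FQ;
    (* (e) *)
    forall (dX : measure_display) (TX : measurableType dX)
           (PrX : probability TX R) (X : {RV PrX >-> R})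
           (d3 d4 : measure_display)
           (T3 : measurableType d3) (T4 : measurableType d4)
           (Pr3 : probability T3 R) (Pr4 : probability T4 R)
           (MP : {RV Pr3 >-> R}) (MQ : {RV Pr4 >-> R}),
      finite_set (range X) -> is_mean P X MP -> is_mean Q X MQ ->
      same_law Pr3 Pr4 MP MQ ].
Proof.
tfae.
- move=> /(ranked_powersums hP hQ)/(same_powersums_dsums hP hQ) D d3 d4 T3 T4 Pr3 Pr4 SP SQ sP sQ.
  exact: (same_dsums_size_biased hP hQ D sP sQ).
(* From (b) to (c) by way of (a). *)
- move=> /(size_biased_ranked hP hQ)/(ranked_powersums hP hQ)/(same_powersums_dsums hP hQ).
  exact: same_dsums_eppf.
- move=> /(eppf_same_dsums hP hQ) D d3 d4 T3 T4 Pr3 Pr4 FP FQ fP fQ.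
  exact: (same_dsums_fdd hP hQ D fP fQ).
- move=> /(fdd_powersums hP hQ)/(same_powersums_dsums hP hQ) D dX TX PrX X d3 d4 T3 T4 Pr3 Pr4 MP MQ fX mP mQ.
  exact: (same_dsums_mean hP hQ D fX mP mQ).
(* From (e) to (a) by way of the EPPF and then (b). *)
- move=> /(mean_powersums hP hQ)/(same_powersums_dsums hP hQ) D.
  apply: (size_biased_ranked hP hQ) => d3 d4 T3 T4 Pr3 Pr4 SP SQ sP sQ.
  exact: (same_dsums_size_biased hP hQ D sP sQ).
Qed.
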